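(* Let $F$ be a field of characteristic $0$. For any partition $\lambda=(\lambda_1,\lambda_2)$ (with $\lambda_1\ge\lambda_2\ge0$), the multiplicities $m_{\lambda}=m_{\lambda}(T)$ of the mixed trace cocharacter of $3\times 3$ matrices over $F$ satisfy \[ m_{\lambda}=\frac{\lambda_2^7}{7!\cdot 2^5}+\frac{(\lambda_1-\lambda_2)\lambda_2^6}{6!\cdot 2^4} +\frac{(\lambda_1-\lambda_2)^2\lambda_2^5}{5!\cdot 2^4} +{\mathcal O}((\lambda_1+\lambda_2)^6), \] if $\lambda_1>2\lambda_2\geq 0$, and \[ m_{\lambda}=\frac{\lambda_2^7}{7!\cdot 2^5}+\frac{(\lambda_1-\lambda_2)\lambda_2^6}{6!\cdot 2^4} +\frac{(\lambda_1-\lambda_2)^2\lambda_2^5}{5!\cdot 2^4} -\frac{(2\lambda_2-\lambda_1)^7}{7!\cdot 2^5} +{\mathcal O}((\lambda_1+\lambda_2)^6), \] if $2\lambda_2\geq \lambda_1\geq \lambda_2\geq 0$. If $\lambda_2$ is fixed, then, for $\lambda_1>2\lambda_2$, \[ m_{\lambda}=\lambda_1^2\left(\left(\frac{\lambda_2^5}{5!\cdot 2^4} +\frac{\lambda_2^4}{2^5\cdot 3}+\frac{5\lambda_2^3}{2^6}+\frac{13\lambda_2^2}{4!\cdot 2}+\frac{1633\lambda_2}{5!\cdot 2^5}+\frac{15}{2^6}\right) +(-1)^{\lambda_2}\left(\frac{\lambda_2}{2^8}+\frac{1}{2^6}\right)\right)+ {\mathcal O}(\lambda_1). \]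
   Context: Let $X_1,X_2,\ldots$ be a countable set of generic $3\times 3$ matrices over $F$ (all entries are algebraically independent commuting variables). $R$ is the (unital) $F$-algebra generated by the $X_i$; $C$ is the pure trace algebra, generated by the traces $\mathrm{tr}(X_{i_1}\cdots X_{i_k})$ of all products; the mixed trace algebra $T$ is generated by $R$ and $C$, the elements of $C$ being regarded as scalar matrices. The symmetric group $S_k$ acts (by permuting $X_1,\ldots,X_k$) on the space of elements of $T$ multilinear of degree $k$ in $X_1,\ldots,X_k$; its character $\chi_k(T)$ is the mixed trace cocharacter, and $\chi_k(T)=\sum_{\lambda\vdash k}m_\lambda(T)\chi_\lambda$, where $\chi_\lambda$ is the irreducible $S_k$-character indexed by the partition $\lambda$; this defines $m_\lambda(T)$. For $\lambda=(\lambda_1,\lambda_2)$ with at most two parts, $m_\lambda(T)$ is also the coefficient of the Schur function $S_\lambda(x,y)$ in the Hilbert series (with respect to multidegree) of the mixed trace algebra $T_2$ of two generic $3\times3$ matrices $X_1,X_2$, which is known (Berele and Stembridge) to be \[ H(T_2,x,y)=\frac{1}{(1-x)^2(1-y)^2(1-x^2)(1-y^2)(1-xy)^2(1-x^2y)(1-xy^2)}. \] *)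

(* Defs.v *)
From HB Require Import structures.
From mathcomp Require Import all_boot all_order all_algebra all_fingroup.
From mathcomp Require Import finmap.
From mathcomp.multinomials Require Import monalg.

Set Implicit Arguments.
Unset Strict Implicit.
Unset Printing Implicit Defensive.

Import GRing.Theory.
Local Open Scope ring_scope.

Inductive gen_alg (F : fieldType) (A : algType F) (S : A -> Prop) : A -> Prop :=
| gen_alg_in a of S a : gen_alg S a
| gen_alg_scal (c : F) : gen_alg S c%:A
| gen_alg_add a b of gen_alg S a & gen_alg S b : gen_alg S (a + b)
| gen_alg_mul a b of gen_alg S a & gen_alg S b : gen_alg S (a * b).

Section Characters.
Variables (F : fieldType) (V : lmodType F).

Definition is_basis (U : V -> Prop) (d : nat) (b : 'I_d -> V) : Prop :=
  (forall v, U v <-> exists c : 'I_d -> F, v = \sum_i c i *: b i) /\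
  (forall c : 'I_d -> F, \sum_i c i *: b i = 0 -> forall i, c i = 0).

(* [chi g] is the trace of [act g] on the finite-dimensional invariant
   subspace [U]. *)
Definition affords_char (G : Type) (U : V -> Prop) (act : G -> V -> V)
    (chi : G -> F) : Prop :=
  exists (d : nat) (b : 'I_d -> V) (rho : G -> 'M[F]_d),
    [/\ is_basis U b,
        forall g i, act g (b i) = \sum_j rho g i j *: b j &
        forall g, chi g = \tr (rho g)].

End Characters.

Section GenericMatrices.
Variable F : fieldType.

(* The variable (r, i, j) is the (i, j) entry of the generic matrix numbered r;
   matrices are numbered from 0. *)
Definition genvar : choiceType := (nat * 'I_3 * 'I_3)%type.
Definition genpoly : comAlgType F := {malg F[{cmonom genvar}]}.
Definition genmat : Type := 'M[genpoly]_3.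

HB.instance Definition _ := GRing.NzRing.on genmat.

(* 'M[genpoly]_3 is only a [genpoly]-algebra for the library; [genmat] is the
   same ring seen as an F-algebra. *)
Definition genmat_scale (c : F) (M : genmat) : genmat :=
  (c%:A : genpoly) *: (M : 'M[genpoly]_3).

Fact genmat_scaleA a b M :
  genmat_scale a (genmat_scale b M) = genmat_scale (a * b) M.
Proof.
rewrite /genmat_scale [LHS](@scalerA genpoly 'M[genpoly]_3).
by rewrite -(rmorphM (in_alg genpoly)).
Qed.
Fact genmat_scale1 : left_id 1 genmat_scale.
Proof.
move=> M; rewrite /genmat_scale (@scale1r F genpoly).
exact: (@scale1r genpoly 'M[genpoly]_3).
Qed.
Fact genmat_scaleDr : right_distributive genmat_scale +%R.
Proof. by move=> c M N; exact: (@scalerDr genpoly 'M[genpoly]_3). Qed.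
Fact genmat_scaleDl M : {morph genmat_scale^~ M : a b / a + b}.
Proof.
move=> a b; rewrite /genmat_scale (@scalerDl F genpoly).
exact: (@scalerDl genpoly 'M[genpoly]_3).
Qed.
HB.instance Definition _ := GRing.Zmodule_isLmodule.Build F genmat
  genmat_scaleA genmat_scale1 genmat_scaleDr genmat_scaleDl.

Fact genmat_scaleAl (c : F) (M N : genmat) : c *: (M * N) = c *: M * N.
Proof. exact: (@scalerAl genpoly 'M[genpoly]_3). Qed.
HB.instance Definition _ := GRing.Lmodule_isLalgebra.Build F genmat
  genmat_scaleAl.
Fact genmat_scaleAr (c : F) (M N : genmat) : c *: (M * N) = M * (c *: N).
Proof. exact: (@scalerAr genpoly 'M[genpoly]_3). Qed.
HB.instance Definition _ := GRing.Lalgebra_isAlgebra.Build F genmat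
  genmat_scaleAr.

Definition var (v : genvar) : genpoly := << ucm v >>.

Definition generic_mx (r : nat) : genmat := \matrix_(i, j) var (r, i, j).

Definition generic_alg : genmat -> Prop :=
  gen_alg (fun M => exists r, M = generic_mx r).

Definition pure_trace_alg : genpoly -> Prop :=
  gen_alg (fun p : genpoly =>
             exists w : seq nat,
               p = \tr (\prod_(r <- w) generic_mx r : 'M[genpoly]_3)).

Definition mixed_trace_alg : genmat -> Prop :=
  gen_alg (fun M => generic_alg M \/
                    exists2 p, pure_trace_alg p & M = (p%:M : 'M[genpoly]_3)).

(* Elements of the mixed trace algebra all of whose monomials have degree 1 in
   generic_mx r for r < k and degree 0 in the other generic matrices. *)
Definition mixed_trace_multilin (k : nat) (M : genmat) : Prop :=
  mixed_trace_alg M /\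
  forall (i j : 'I_3) (mon : {cmonom genvar}), mon \in msupp (M i j) ->
  forall r : nat, (\sum_(a : 'I_3) \sum_(b : 'I_3) mon (r, a, b))%N = (r < k)%N.

Definition gensubst (g : genvar -> genpoly) (p : genpoly) : genpoly :=
  mmap (fun c : F => c%:A : genpoly)
       (fun mon : {cmonom genvar} => \prod_(v <- finsupp mon) g v ^+ mon v) p.

Definition perm_index (k : nat) (s : 'S_k) (r : nat) : nat :=
  if insub r is Some i then s i : 'I_k else r.

(* The algebra endomorphism with generic_mx r |-> generic_mx (s r) for r < k,
   which fixes the other generic matrices. *)
Definition perm_act (k : nat) (s : 'S_k) (M : genmat) : genmat :=
  map_mx (gensubst (fun v : genvar =>
                      var (perm_index s v.1.1, v.1.2, v.2))) M.

Definition mixed_trace_cocharacter (k : nat) (chi : 'S_k -> F) : Prop :=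
  affords_char (mixed_trace_multilin k) (@perm_act k) chi.

End GenericMatrices.

(* A partition is the nonincreasing sequence of its nonzero parts. *)
Definition is_partition (l : seq nat) : bool := sorted geq l && (0%N \notin l).

Definition partitions (k : nat) : seq (seq nat) :=
  [seq l <- [seq [seq val i | i <- bseqval t] | t : k.-bseq 'I_k.+1]
     | is_partition l & sumn l == k].

Section Specht.
Variables (F : fieldType) (k : nat).

Definition grp_alg : lmodType F := {ffun 'S_k -> F^o}.

Definition conv (a b : grp_alg) : grp_alg :=
  [ffun g => \sum_(h : 'S_k) a h * b (h^-1 * g)%g].

Definition left_mul (s : 'S_k) (a : grp_alg) : grp_alg :=
  [ffun g => a (s^-1 * g)%g].

(* The tableau of shape [l] has entries 0, ..., k - 1 in reading order: row by
   row, from left to right; [reshape_index l i] and [reshape_offset l i] are the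
   row and the column of the entry i. *)
Definition row_stab (l : seq nat) : {set 'S_k} :=
  [set s : 'S_k | [forall i, reshape_index l (s i) == reshape_index l i]].
Definition col_stab (l : seq nat) : {set 'S_k} :=
  [set s : 'S_k | [forall i, reshape_offset l (s i) == reshape_offset l i]].

Definition young_symmetrizer (l : seq nat) : grp_alg :=
  [ffun g => \sum_(p in row_stab l) \sum_(q in col_stab l | (p * q)%g == g)
               (-1) ^+ q].

Definition specht_module (l : seq nat) (v : grp_alg) : Prop :=
  exists a, v = conv a (young_symmetrizer l).

Definition specht_char (l : seq nat) (chi : 'S_k -> F) : Prop :=
  affords_char (specht_module l) left_mul chi.

End Specht.

(* [m] gives the coefficients of the mixed trace cocharacters on the
   irreducible characters of the symmetric groups. *)
Definition mixed_trace_multiplicities (F : fieldType) (m : seq nat -> nat) :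
    Prop :=
  forall k : nat,
  exists (chiT : 'S_k -> F) (chi : seq nat -> 'S_k -> F),
    [/\ mixed_trace_cocharacter chiT,
        forall l, l \in partitions k -> specht_char l (chi l) &
        forall s, chiT s = \sum_(l <- partitions k) (m l)%:R * chi l s].

(* The partition (l1, l2), without its zero parts. *)
Definition two_row (l1 l2 : nat) : seq nat := [seq x <- [:: l1; l2] | 0 < x]%N.

(* Main.v *)
Require Import Defs.
From HB Require Import structures.
From mathcomp Require Import all_boot all_order all_algebra all_fingroup.
From mathcomp Require Import finmap.
From mathcomp.multinomials Require Import monalg.
From mathcomp Require Import zify ring lra.

Set Implicit Arguments.
Unset Strict Implicit.
Unset Printing Implicit Defensive.

Import GRing.Theory.
Local Open Scope ring_scope.

(** The multiplicity of a two-row partition is a difference of two dimensions,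
    and these dimensions count the solutions in natural numbers of a linear
    system with ten unknowns.

    Let k = l1 + l2 and let H be the stabilizer of {0, ..., l1 - 1} in S_k. The
    sum of a character over H is #|H| times the dimension of the H-invariants
    ([sum_char_invariants]). In the Specht module of a partition this dimension
    is 1 if there are at most two parts, the second being at most l2, and 0
    otherwise. Therefore m (l1, l2) = h (l1, l2) - h (l1 + 1, l2 - 1), where
    h (l1, l2) is the dimension of the H-invariant multilinear elements of
    degree k of the mixed trace algebra ([multiplicity_difference]).

    Replacing the first l1 generic matrices by X and the others by Y embeds
    these invariants in the mixed trace algebra of X and Y
    ([restitution_inj]), with image the part of bidegree (l1, l2)
    ([restitution_span], [invariant_lift]). That algebra is free
    over the polynomial ring in the nine traces of X, Y, XX, XY, YY, XXX, XXY,
    XYY, YYY, with basis the words X^i (YX)^n Y^j, i, j <= 2. These elements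
    span because the polarized Cayley-Hamilton identity reduces all other words
    and traces of words ([words_in_span], [scal_in_words]). They are linearly
    independent because on a suitable deformation of a pair of nilpotent
    matrices the nine traces vanish at t = 0, have independent first-order
    terms, and the words of a given bidegree stay independent at t = 0
    ([coef_tmon], [word_entry], [basis_independent]). Merging X^i with the
    power of tr(XXX) into one exponent, and Y^j with that of tr(YYY), h (a, b)
    becomes the coefficient of x^a y^b in
      1 / ((1-x)^2 (1-y)^2 (1-x^2) (1-y^2) (1-xy)^2 (1-x^2 y) (1-x y^2)).

    In this series the coefficients c(n) of the factor in x alone satisfy
    c(n) + c(-n-4) = (n+2)^2/4 + O(1), with c(n) = 0 for n < 0
    ([xcount_refl]). The quadratic term contributes moments of the x-degree
    over the solutions for the other seven unknowns, whose growth is found one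
    unknown at a time ([moments_cons]); this gives the main term. The reflected
    term c(-n-4) collapses to a partition function of the single variable
    2b - a - 4 ([wsum_reflect]), which vanishes for a > 2b and yields the
    seventh power of 2b - a otherwise. For fixed b, the coefficient of a^2 is a
    quarter of a number of solutions for six unknowns ([mult2E]), which
    [moment0_wts6] computes exactly. *)

(** * Characters and invariants of a subgroup *)

(** If Q = C R is a rank factorization of an idempotent, cancelling C on the
    left and R on the right in C (R C) R = C R gives R C = 1. *)
Lemma trace_idempotent (F : fieldType) n (Q : 'M[F]_n) : Q *m Q = Q -> \tr Q = (\rank Q)%:R.
Proof.
move=> hQ; rewrite -[Q in LHS]mulmx_base mxtrace_mulC.
suff -> : row_base Q *m col_base Q = 1%:M by rewrite mxtrace1.
have h : col_base Q *m (row_base Q *m col_base Q) *m row_base Q = col_base Q *m 1%:M *m row_base Q.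
  by rewrite mulmx1 mulmxA -mulmxA !mulmx_base.
have /row_freeP[R hR] := row_base_free Q.
have /row_fullP[L hL] := col_base_full Q.
move: (row_base Q) (col_base Q) hR hL h => S D hR hL h.
have := congr1 (fun M => L *m M *m R) h.
by rewrite /= !mulmxA hL !mul1mx -!mulmxA hR !mulmx1.
Qed.

Section Invariants.
Variables (F : fieldType) (V : lmodType F) (gT : finGroupType) (U : V -> Prop).
Variables (act : gT -> V -> V) (chi : gT -> F) (H : {group gT}).
Hypothesis act_lin : forall g, linear (act g).
Hypothesis actM : forall g h v, act g (act h v) = act (h * g)%g v.
Hypothesis charF0 : [pchar F] =i pred0.

Definition fixed_vector (v : V) : Prop := U v /\ forall h, h \in H -> act h v = v.

Let actZD g a u v : act g (a *: u + v) = a *: act g u + act g v.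
Proof. exact: act_lin. Qed.

Let act0 g : act g 0 = 0.
Proof.
by have := actZD g 1 0 0; rewrite !scale1r addr0 => /(congr1 (fun x => x - act g 0)); rewrite subrr addrK.
Qed.

Let act_sum g d (c : 'I_d -> F) (b : 'I_d -> V) :
  act g (\sum_i c i *: b i) = \sum_i c i *: act g (b i).
Proof.
elim/big_rec2: _ => [|i x y _ <-]; first exact: act0.
by rewrite actZD.
Qed.

(** The average over H acts on U as an idempotent whose image is the space of
    invariants; its trace is the average of the character. *)
Lemma sum_char_invariants d' (b' : 'I_d' -> V) :
  affords_char U act chi -> is_basis fixed_vector b' ->
  \sum_(h in H) chi h = #|H|%:R * d'%:R.
Proof.
move=> [d [b [rho [[bU bI] hrho hchi]]]] [b'U b'I].
pose lin (c : 'rV[F]_d) := \sum_i c 0 i *: b i.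
have linE g c : act g (lin c) = lin (c *m rho g).
  rewrite act_sum /lin; under eq_bigr => i _ do rewrite hrho scaler_sumr.
  rewrite exchange_big /=; apply: eq_bigr => j _; rewrite mxE scaler_suml.
  by apply: eq_bigr => i _; rewrite scalerA.
have lin_inj c c' : lin c = lin c' -> c = c'.
  move=> e; apply/rowP => i; apply/eqP; rewrite -subr_eq0; apply/eqP.
  apply: (bI (fun i => c 0 i - c' 0 i)); under eq_bigr => j _ do rewrite scalerBl.
  by rewrite sumrB -/(lin c) -/(lin c') e subrr.
have linP v : U v -> exists c, v = lin c.
  move/bU=> [c ->]; exists (\row_i c i); apply: eq_bigr => i _; by rewrite mxE.
have linU c : U (lin c) by apply/bU; exists (fun i => c 0 i).
have linD a c c' : lin (a *: c + c') = a *: lin c + lin c'.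
  rewrite /lin scaler_sumr -big_split; apply: eq_bigr => i _.
  by rewrite !mxE scalerDl scalerA.
have rhoM g h : rho (h * g)%g = rho h *m rho g.
  apply/row_matrixP => i; rewrite !rowE; apply: lin_inj.
  by rewrite -linE -actM !linE mulmxA.
have nH0 : (#|H|%:R : F) != 0.
  have /pcharf0P -> := charF0; by rewrite -lt0n cardG_gt0.
pose Q := #|H|%:R^-1 *: \sum_(h in H) rho h.
have Qrho k : k \in H -> Q *m rho k = Q.
  move=> kH; rewrite /Q -scalemxAl mulmx_suml; congr (_ *: _).
  rewrite [RHS](reindex_inj (mulIg k)); apply: eq_big => h; first by rewrite groupMr.
  by move=> _; rewrite rhoM.
have QQ : Q *m Q = Q.
  rewrite {2}/Q -scalemxAr mulmx_sumr.
  under eq_bigr => h hH do rewrite Qrho //.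
  by rewrite sumr_const -scaler_nat scalerA mulVf // scale1r.
have invQ c : (forall h, h \in H -> act h (lin c) = lin c) <-> c *m Q = c.
  split=> [hc|hc h hH].
    rewrite /Q -scalemxAr mulmx_sumr.
    rewrite (eq_bigr (fun=> c)); last by move=> h hH; apply: lin_inj; rewrite -linE hc.
    by rewrite sumr_const -scaler_nat scalerA mulVf // scale1r.
  by rewrite linE -hc -mulmxA Qrho.
have /fin_all_exists[cb hcb] : forall i, exists c, b' i = lin c.
  move=> i; apply: linP.
  suff [] : fixed_vector (b' i) by [].
  apply/b'U; exists (fun j => (j == i)%:R).
  by rewrite (bigD1 i) //= eqxx scale1r big1 ?addr0 // => j /negbTE ->; rewrite scale0r.
pose B := \matrix_i cb i.
have linB (c : 'rV_d') : lin (c *m B) = \sum_i c 0 i *: b' i.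
  have -> : c *m B = \sum_i c 0 i *: cb i.
    by rewrite mulmx_sum_row; apply: eq_bigr => i _; rewrite rowK.
  rewrite [RHS](eq_bigr (fun i => c 0 i *: lin (cb i))); last by move=> i _; rewrite hcb.
  have lin0 : lin 0 = 0 by rewrite /lin big1 // => i _; rewrite mxE scale0r.
  elim/big_rec2: _ => [//|i x y _ <-]; exact: linD.
have freeB : row_free B.
  rewrite -kermx_eq0; apply/eqP/row_matrixP => i; rewrite row0.
  set c := row i _.
  have cB : c *m B = 0 by rewrite /c -row_mul mulmx_ker row0.
  have := linB c; rewrite cB => e.
  have lin0 : lin 0 = 0 by rewrite /lin big1 // => j _; rewrite mxE scale0r.
  by apply/rowP => j; rewrite [RHS]mxE; apply: (b'I (fun j => c 0 j)); rewrite -e.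
have eqBQ : (B :=: Q)%MS.
  apply/eqmxP/andP; split.
    apply/row_subP => i; rewrite /B rowK.
    have [iU ii] : fixed_vector (b' i).
      apply/b'U; exists (fun j => (j == i)%:R).
      by rewrite (bigD1 i) //= eqxx scale1r big1 ?addr0 // => j /negbTE ->; rewrite scale0r.
    have /invQ <- : forall h, h \in H -> act h (lin (cb i)) = lin (cb i) by rewrite -hcb.
    exact: submxMl.
  apply/row_subP => i.
  have iQ : row i Q *m Q = row i Q by rewrite -row_mul QQ.
  have : fixed_vector (lin (row i Q)) by split=> //; apply/invQ.
  move/b'U=> [c hc].
  have -> : row i Q = (\row_j c j) *m B.
    by apply: lin_inj; rewrite linB hc; apply: eq_bigr => j _; rewrite mxE.
  exact: submxMl.
have rQ : \rank Q = d' by rewrite -eqBQ; apply/eqP.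
have -> : \sum_(h in H) chi h = \tr (\sum_(h in H) rho h).
  by rewrite raddf_sum; apply: eq_bigr => h _; rewrite hchi.
have -> : \sum_(h in H) rho h = #|H|%:R *: Q by rewrite scalerA mulfV // scale1r.
by rewrite mxtraceZ trace_idempotent // rQ.
Qed.

End Invariants.

(** * Invariants of a two-block group in Specht modules *)

Section BlockGroup.
Variables (k n : nat).

Definition block_stab : {set 'S_k} := [set s : 'S_k | [forall i, (s i < n)%N == (i < n)%N]].

Lemma block_stabP (s : 'S_k) : reflect (forall i, (s i < n)%N = (i < n)%N) (s \in block_stab).
Proof. by rewrite inE; apply: (iffP forallP) => h i; [exact: eqP (h i)|rewrite h]. Qed.

Lemma block_stab_group_set : group_set block_stab.
Proof.
apply/group_setP; split; first by apply/block_stabP => i; rewrite perm1.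
by move=> s t /block_stabP hs /block_stabP ht; apply/block_stabP => i; rewrite permM ht hs.
Qed.
Canonical block_group := group block_stab_group_set.

(** An injection of the finite block into itself is onto. *)
Lemma block_stab_sub (s : 'S_k) : (forall i : 'I_k, (i < n)%N -> (s i < n)%N) -> s \in block_stab.
Proof.
move=> hs; pose A := [set i : 'I_k | (i < n)%N].
have sA : s @: A = A.
  apply/eqP; rewrite eqEcard card_imset ?leqnn ?andbT; last exact: perm_inj.
  by apply/subsetP => x /imsetP[i]; rewrite inE => hi ->; rewrite inE hs.
apply/block_stabP => i; have := mem_imset A i (@perm_inj _ s).
by rewrite sA !inE.
Qed.

Lemma tperm_block (u v : 'I_k) : (u < n)%N = (v < n)%N -> tperm u v \in block_stab.
Proof. by move=> e; apply/block_stabP => i; case: tpermP => [->|->|]. Qed.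
End BlockGroup.

Section SpechtInvariants.
Variables (F : fieldType) (k : nat).
Hypothesis charF0 : [pchar F] =i pred0.
Implicit Types (la : seq nat) (y : grp_alg F k) (g p q : 'S_k).

Let natF0 (m : nat) : (m%:R == 0 :> F) = (m == 0)%N.
Proof. by have /pcharf0P -> := charF0. Qed.

Lemma row_stabP la p : reflect (forall i, reshape_index la (p i) = reshape_index la i) (p \in row_stab k la).
Proof. by rewrite inE; apply: (iffP forallP) => h i; [exact: eqP (h i)|rewrite h]. Qed.

Lemma col_stabP la p : reflect (forall i, reshape_offset la (p i) = reshape_offset la i) (p \in col_stab k la).
Proof. by rewrite inE; apply: (iffP forallP) => h i; [exact: eqP (h i)|rewrite h]. Qed.

Lemma col_stabM la p q : q \in col_stab k la -> (p * q \in col_stab k la)%g = (p \in col_stab k la).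
Proof.
move=> /col_stabP hq; apply/col_stabP/col_stabP => h i; last by rewrite permM hq.
by rewrite -[RHS]h permM hq.
Qed.

Lemma row_stabM la p q : q \in row_stab k la -> (p * q \in row_stab k la)%g = (p \in row_stab k la).
Proof.
move=> /row_stabP hq; apply/row_stabP/row_stabP => h i; last by rewrite permM hq.
by rewrite -[RHS]h permM hq.
Qed.

(** The signed sum over the column stabilizer absorbs q up to its sign. *)
Lemma specht_col la y g q : specht_module la y -> q \in col_stab k la ->
  y (g * q)%g = (-1) ^+ q * y g.
Proof.
move=> [a ->] qC; rewrite !ffunE mulr_sumr; apply: eq_bigr => h _.
rewrite mulrCA; congr (_ * _); rewrite mulgA !ffunE mulr_sumr; apply: eq_bigr => p _.
rewrite mulr_sumr [LHS](reindex_inj (mulIg q)) /=; apply: eq_big => x.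
  by rewrite col_stabM // mulgA (inj_eq (mulIg q)).
by move=> _; rewrite odd_permM signr_addb mulrC.
Qed.

(** Once p has been moved past the column permutations, the sum over the row
    stabilizer absorbs it. *)
Lemma specht_row la y g p : specht_module la y -> p \in row_stab k la ->
  (forall q, q \in col_stab k la -> commute p q) -> y (g * p)%g = y g.
Proof.
move=> [a ->] pR pC; rewrite !ffunE; apply: eq_bigr => h _.
congr (_ * _); rewrite mulgA !ffunE [LHS](reindex_inj (mulIg p)) /=.
apply: eq_big => x; first by rewrite row_stabM.
move=> _; apply: eq_bigl => q; case: (boolP (q \in _)) => //= qC.
by rewrite -mulgA (pC q qC) mulgA (inj_eq (mulIg p)).
Qed.

(** The transposition of u and v acts on the right by the sign -1 and, after
    conjugation by g, on the left as an element of the block stabilizer; so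
    y g = - y g. *)
Lemma specht_same_block la y g n (u v : 'I_k) : specht_module la y ->
  (forall h, h \in block_stab k n -> left_mul h y = y) ->
  u != v -> reshape_offset la u = reshape_offset la v ->
  (g^-1 u < n)%g%N = (g^-1 v < n)%g%N -> y g = 0.
Proof.
move=> yS yH uv ouv guv; set t := tperm u v.
have tC : t \in col_stab k la by apply/col_stabP => i; rewrite /t; case: tpermP => [->|->|].
have e : (g * t)%g = (tperm ((g^-1)%g u) ((g^-1)%g v) * g)%g by rewrite -tpermJ /conjg invgK !mulgA mulgKV.
have := specht_col g yS tC; rewrite e odd_tperm uv expr1 mulN1r.
have /yH /ffunP/(_ (tperm ((g^-1)%g u) ((g^-1)%g v) * g)%g) : tperm ((g^-1)%g u) ((g^-1)%g v) \in block_stab k n.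
  exact: tperm_block.
rewrite ffunE tpermV mulgA tperm2 mul1g => <- /eqP.
by rewrite -subr_eq0 opprK -mulr2n -mulr_natr mulf_eq0 natF0 orbF => /eqP.
Qed.

Section Shape.
Variables (la : seq nat) (l1 l2 : nat).
Hypothesis la_part : la \in partitions k.
Hypothesis l12 : (l1 + l2)%N = k.
Hypothesis l21 : (l2 <= l1)%N.
Let V := specht_module (F := F) (k := k) la.
Let H := block_group k l1.

Let la_sorted : sorted geq la.
Proof. by move: la_part; rewrite mem_filter => /andP[/andP[/andP[]]]. Qed.
Let la_pos : 0%N \notin la.
Proof. by move: la_part; rewrite mem_filter => /andP[/andP[/andP[]]]. Qed.
Let la_sum : sumn la = k.
Proof. by move: la_part; rewrite mem_filter => /andP[/andP[_ /eqP]]. Qed.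

(** Three entries of the first column have only two blocks to come from, so two
    of them come from the same one. *)
Lemma specht_inv_high y : (2 < size la)%N -> V y ->
  (forall h, h \in H -> left_mul h y = y) -> y = 0.
Proof.
move=> hsz yV yH; apply/ffunP => g; rewrite [RHS]ffunE.
have pos r : (r < 3)%N -> (0 < nth 0 la r)%N.
  move=> hr; rewrite lt0n; apply: contra la_pos => /eqP <-.
  by rewrite mem_nth // (leq_trans hr).
have ltk r : (r < 3)%N -> (flatten_index la r 0 < k)%N.
  move=> hr; rewrite -la_sum -{2}(cat_take_drop r la) sumn_cat /flatten_index addn0.
  rewrite -addn1 leq_add2l.
  by rewrite (drop_nth 0) ?(leq_trans hr) //= addn_gt0 pos.
pose P r (hr : (r < 3)%N) := Ordinal (ltk r hr).
have off r hr : reshape_offset la (@P r hr) = 0%N by rewrite flatten_indexKr ?pos.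
have idx r hr : reshape_index la (@P r hr) = r by rewrite flatten_indexKl ?pos.
pose st r hr := ((g^-1)%g (@P r hr) < l1)%N.
have key r s hr hs : r != s -> @st r hr = @st s hs -> y g = 0.
  move=> rs; apply: (specht_same_block yV yH); last by rewrite !off.
  by apply: contra rs => /eqP e; rewrite -(idx r hr) -(idx s hs) e.
case e01: (@st 0 isT == @st 1 isT); first exact: (key 0%N 1%N isT isT _ (eqP e01)).
case e02: (@st 0 isT == @st 2 isT); first exact: (key 0%N 2%N isT isT _ (eqP e02)).
apply: (key 1%N 2%N isT isT) => //; by move: e01 e02; case: (@st 0%N isT); case: (@st 1%N isT); case: (@st 2%N isT).
Qed.

Section TwoRows.
Hypothesis la2 : (size la <= 2)%N.
Let r := nth 0%N la 0.
Let j := nth 0%N la 1.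

Lemma rj_sum : (r + j)%N = k.
Proof. by rewrite -la_sum /r /j; case: la la2 => [|a [|b []]] //= _; rewrite ?addn0. Qed.
Lemma j_le_r : (j <= r)%N.
Proof. by move: la_sorted; rewrite /r /j; case: la la2 => [|a [|b []]] //= _ /andP[]. Qed.

Lemma rowE (i : 'I_k) : (reshape_index la i = (r <= i)%N) * (reshape_offset la i = if (i < r)%N then i : nat else (i - r)%N).
Proof.
case: (ltnP i r) => h.
  have e : nat_of_ord i = flatten_index la 0 i by rewrite /flatten_index take0.
  by rewrite e flatten_indexKl // flatten_indexKr.
have e : nat_of_ord i = flatten_index la 1 (i - r).
  rewrite /flatten_index -[LHS](subnKC h); congr (_ + _)%N.
  by rewrite /r; case: la => //= a s; rewrite take0 /= addn0.
have h' : (i - r < nth 0 la 1)%N by rewrite ltn_subLR // rj_sum.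
by split; rewrite [in LHS]e ?flatten_indexKl ?flatten_indexKr.
Qed.

Let botP (c : 'I_k) : (c < j)%N -> (r + c < k)%N.
Proof. by move=> h; rewrite -[X in (_ < X)%N]rj_sum ltn_add2l. Qed.
(** The entry of the second row below the entry c of the first row. *)
Let bot (c : 'I_k) (hc : (c < j)%N) : 'I_k := Ordinal (botP hc).

Let bot_off (c : 'I_k) (hc : (c < j)%N) : reshape_offset la c = reshape_offset la (@bot c hc).
Proof.
by rewrite !rowE (leq_trans hc j_le_r) /= ltnNge leq_addr addKn.
Qed.

Let bot_neq (c : 'I_k) (hc : (c < j)%N) : c != @bot c hc.
Proof. by rewrite -val_eqE /=; have := leq_trans hc j_le_r; lia. Qed.

Let split_column y g (c : 'I_k) (hc : (c < j)%N) : V y ->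
  (forall h, h \in H -> left_mul h y = y) -> y g != 0 ->
  (g^-1%g (@bot c hc) < l1)%N = ~~ (g^-1%g c < l1)%N.
Proof.
move=> yV yH; apply: contraNeq => e; rewrite (specht_same_block yV yH (bot_neq hc) (bot_off hc)) //.
by move: e; case: (_ < l1)%N; case: (_ < l1)%N.
Qed.

(** Where y does not vanish, each of the j columns of length two has an entry
    coming from the second block, and that block has only l2 elements. *)
Lemma specht_inv_low y : (l2 < j)%N -> V y ->
  (forall h, h \in H -> left_mul h y = y) -> y = 0.
Proof.
move=> hj yV yH; apply/ffunP => g; rewrite [RHS]ffunE; apply/eqP; apply: contraLR hj => yg.
rewrite -leqNgt.
have jk : (j <= k)%N by rewrite -rj_sum leq_addl.
pose wj (c : 'I_j) : 'I_k := widen_ord jk c.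
have wjP c : (wj c < j)%N by exact: (ltn_ord c).
pose f (c : 'I_j) := if (g^-1%g (wj c) < l1)%N then @bot _ (wjP c) else wj c.
have fP c : (l1 <= g^-1%g (f c))%N.
  rewrite /f; case: ifP => e; last by rewrite leqNgt e.
  by rewrite leqNgt (split_column (wjP c) yV yH yg) e.
have fI : injective f.
  move=> c c' /(congr1 val); rewrite /f; have := j_le_r; have := ltn_ord c; have := ltn_ord c'.
  by case: ifP; case: ifP => _ _ /= *; apply: val_inj => /=; lia.
have cardB : #|[set i : 'I_k | (l1 <= g^-1%g i)%N]| = l2.
  have -> : [set i : 'I_k | (l1 <= g^-1%g i)%N] = g @: [set i : 'I_k | (l1 <= i)%N].
    apply/setP => i; rewrite !inE -[i in RHS](permKV g) mem_imset ?inE //; exact: perm_inj.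
  rewrite card_imset; last exact: perm_inj.
  have -> : [set i : 'I_k | (l1 <= i)%N] = ~: [set i : 'I_k | (i < l1)%N].
    by apply/setP => i; rewrite !inE leqNgt.
  rewrite cardsCs setCK card_ord.
  have hl : (l1 <= k)%N by rewrite -l12 leq_addr.
  have -> : #|[set i : 'I_k | (i < l1)%N]| = l1.
    rewrite -sum1_card (eq_bigl (fun i : 'I_k => (i < l1)%N)); last by move=> i; rewrite inE.
    by rewrite (big_ord_narrow hl) sum1_card card_ord.
  by rewrite -l12 addKn.
rewrite -cardB -[X in (X <= _)%N]card_ord -(card_imset _ fI); apply/subset_leq_card/subsetP.
by move=> i /imsetP[c _ ->]; rewrite inE fP.
Qed.

Section Fits.
Hypothesis jl2 : (j <= l2)%N.

Let j_le_l1 : (j <= l1)%N. Proof. exact: leq_trans jl2 l21. Qed.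
Let l1_le_r : (l1 <= r)%N. Proof. by have := rj_sum; have := l12; have := jl2; lia. Qed.

Let tpermVE (t u : 'I_k) g i : (g * tperm t u)^-1%g i = g^-1%g (tperm t u i).
Proof. by rewrite invMg tpermV permM. Qed.

(** Exchanging the two entries of a column only changes the sign of y g, so it
    suffices to know y when all the columns have their top entry in the first
    block. *)
Let normalize_columns y : V y -> (forall h, h \in H -> left_mul h y = y) ->
  (forall g, (forall c : 'I_k, (c < j)%N -> (g^-1%g c < l1)%N) -> y g = 0) -> forall g, y g = 0.
Proof.
move=> yV yH hy g.
have [m] := ubnP #|[set c : 'I_k | (c < j)%N && ~~ (g^-1%g c < l1)%N]|.
elim: m g => // m IH g hm.
case: (set_0Vmem [set c : 'I_k | (c < j)%N && ~~ (g^-1%g c < l1)%N]) => [e0|[c]].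
  by apply: hy => c hc; move/setP/(_ c): e0; rewrite !inE hc /= => /negbFE.
rewrite inE => /andP[hc gc].
case: (eqVneq (y g) 0) => // yg.
have sc := split_column hc yV yH yg.
have tC : tperm c (bot hc) \in col_stab k la.
  by apply/col_stabP => i; case: tpermP => [->|->|] //; rewrite -?bot_off.
have := specht_col g yV tC; rewrite IH; first by move=> /eqP; rewrite eq_sym mulf_eq0 signr_eq0 (negbTE yg).
rewrite ltnS in hm; apply: leq_trans hm; apply: proper_card; apply/properP; split; last first.
  by exists c; rewrite !inE hc /= ?gc // tpermVE tpermL sc negbK.
apply/subsetP => i; rewrite !inE tpermVE => /andP[hi]; rewrite hi /=.
case: tpermP => [->|e|//]; first by rewrite sc negbK (negbTE gc).
by have := congr1 val e => /=; have := j_le_r; lia.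
Qed.

(** After normalization of the columns of length two, the blocks differ from the
    standard ones only at entries of columns of length one. Transpositions of
    such entries are row permutations commuting with the column stabilizer, so
    they preserve y and lead to an element of H. *)
Lemma specht_inv_determined y : V y -> (forall h, h \in H -> left_mul h y = y) -> y 1%g = 0 -> y = 0.
Proof.
move=> yV yH y1; apply/ffunP => g; rewrite [RHS]ffunE; move: g; apply: normalize_columns => // g.
have [m] := ubnP #|[set c : 'I_k | (c < l1)%N && ~~ (g^-1%g c < l1)%N]|.
elim: m g => // m IH g hm htop.
case: (eqVneq (y g) 0) => // yg.
have hbot (i : 'I_k) : (r <= i)%N -> ~~ (g^-1%g i < l1)%N.
  move=> ri; have hc : (i - r < j)%N by rewrite ltn_subLR // rj_sum.
  have hk : (i - r < k)%N by apply: leq_ltn_trans (ltn_ord i); exact: leq_subr.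
  have -> : i = @bot (Ordinal hk) hc by apply: val_inj; rewrite /= subnKC.
  by rewrite (split_column (c := Ordinal hk) hc yV yH yg) htop.
case: (set_0Vmem [set c : 'I_k | (c < l1)%N && ~~ (g^-1%g c < l1)%N]) => [e0|[u]].
  have gH : g^-1%g \in H.
    by apply: block_stab_sub => i hi; move/setP/(_ i): e0; rewrite !inE hi /= => /negbFE.
  have := yH _ gH => /ffunP/(_ 1%g); rewrite ffunE mulg1 invgK y1 => e.
  by rewrite e eqxx in yg.
rewrite inE => /andP[ul1 gu].
have [v vl1 gv] : exists2 v : 'I_k, ~~ (v < l1)%N & (g^-1%g v < l1)%N.
  case: (set_0Vmem [set v : 'I_k | ~~ (v < l1)%N && (g^-1%g v < l1)%N]) => [e0|[v]]; last first.
    by rewrite inE => /andP[]; exists v.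
  have gH : g \in H.
    apply: block_stab_sub => i hi; move/setP/(_ (g i)): e0.
    by rewrite !inE permK hi andbT => /negbFE.
  by have /groupVr/block_stabP/(_ u) := gH; rewrite ul1 (negbTE gu).
have ju : (j <= u)%N by rewrite leqNgt; apply/negP => /htop; rewrite (negbTE gu).
have ur : (u < r)%N by apply: leq_trans l1_le_r.
have vr : (v < r)%N by rewrite ltnNge; apply/negP => /hbot; rewrite gv.
have jv : (j <= v)%N by apply: leq_trans j_le_l1 _; rewrite leqNgt.
have tR : tperm u v \in row_stab k la.
  by apply/row_stabP => i; case: tpermP => [->|->|] //; rewrite !rowE (leqNgt r u) (leqNgt r v) ur vr.
have fixC q (w : 'I_k) : q \in col_stab k la -> (j <= w)%N -> (w < r)%N -> q w = w.
  move=> /col_stabP/(_ w); rewrite !rowE => + jw wr; rewrite wr => e.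
  apply: val_inj; move: e => /=; case: ltnP => // h e; have := ltn_ord (q w); have := rj_sum; lia.
have tC q : q \in col_stab k la -> commute (tperm u v) q.
  move=> qC; apply/commgP/conjg_fixP; by rewrite tpermJ !fixC.
have yt := specht_row g yV tR tC.
move: (yg); rewrite -yt IH ?eqxx //; last first.
  move=> c hc; rewrite tpermVE tpermD ?htop //; apply/eqP => e; rewrite -e in hc; lia.
rewrite ltnS in hm; apply: leq_trans hm; apply: proper_card; apply/properP; split; last first.
  by exists u; rewrite !inE ul1 /= ?gu // tpermVE tpermL gv.
apply/subsetP => i; rewrite !inE tpermVE => /andP[hi]; rewrite hi /=.
by case: tpermP => [-> _|e|//]; [rewrite gu|rewrite e (negbTE vl1) in hi].
Qed.

Definition specht_fixed : grp_alg F k := conv [ffun h => (h \in H)%:R] (young_symmetrizer F k la).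

Lemma specht_fixed_mem : V specht_fixed. Proof. by exists [ffun h => (h \in H)%:R]. Qed.

Lemma specht_fixed_inv h : h \in H -> left_mul h specht_fixed = specht_fixed.
Proof.
move=> hH; apply/ffunP => g; rewrite !ffunE [RHS](reindex_inj (mulgI h)) /=.
apply: eq_bigr => x _; rewrite !ffunE groupMl //; congr (_ * _).
by rewrite invMg mulgA.
Qed.

(** A nontrivial q exchanges the entries of some column c. Then p q sends an
    element of the second row, which lies outside the first block, to the top of
    that column, which lies inside. *)
Let row_col_block p q : p \in row_stab k la -> q \in col_stab k la -> (p * q)%g \in H -> q = 1%g.
Proof.
move=> /row_stabP pR /col_stabP qC /block_stabP pqH; apply/permP => x; rewrite perm1.
apply/eqP; apply/negPn/negP => qx.
have [c hc qc] : exists2 c : 'I_k, (c < j)%N & q c != c.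
  have := qC x; rewrite !rowE; case: (ltnP x r) => hx.
    case: ltnP => hqx; first by move=> e; case/negP: qx; apply/eqP/val_inj.
    by move=> e; exists x => //; rewrite -e ltn_subLR // rj_sum.
  case: ltnP => hqx; last by move=> e; case/negP: qx; apply/eqP/val_inj => /=; lia.
  move=> e; exists (q x); first by rewrite e ltn_subLR // rj_sum.
  by apply: contra qx => /eqP/perm_inj->.
have cr : (c < r)%N by apply: leq_trans j_le_r.
have qcE : q c = bot hc.
  have := qC c; rewrite !rowE cr; case: ltnP => h e.
    by case/negP: qc; apply/eqP/val_inj.
  by apply: val_inj => /=; lia.
have qbE : q (bot hc) = c.
  have := qC (bot hc); rewrite !rowE /= (ltnNge (r + c)) leq_addr /= addKn; case: ltnP => h e.
    exact: val_inj.
  have : q (bot hc) = q c by rewrite qcE; apply: val_inj => /=; lia.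
  by move/perm_inj/eqP; rewrite eq_sym (negbTE (bot_neq hc)).
have := pqH (p^-1%g (bot hc)); rewrite permM permKV qbE.
have : (r <= p^-1%g (bot hc))%N.
  by have := pR (p^-1%g (bot hc)); rewrite permKV !rowE /= leq_addr; case: leqP.
move: l1_le_r j_le_l1; lia.
Qed.

(** All nonzero terms have q = 1, hence sign 1, and the term of the identity
    permutations is one of them: the value is a positive integer. *)
Lemma specht_fixed1 : specht_fixed 1%g != 0.
Proof.
pose N := (\sum_(h in H) \sum_(p in row_stab k la) \sum_(q in col_stab k la | (p * q)%g == (h^-1)%g) 1)%N.
have -> : specht_fixed 1%g = N%:R.
  rewrite /N natr_sum ffunE [RHS]big_mkcond; apply: eq_bigr => h _; rewrite ffunE mulg1.
  case: (boolP (h \in H)) => hH; last by rewrite mul0r.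
  rewrite mul1r ffunE natr_sum; apply: eq_bigr => p pR; rewrite natr_sum; apply: eq_bigr => q /andP[qC /eqP e].
  by rewrite (row_col_block pR qC) ?odd_perm1 ?expr0 // e groupV.
have one1 : 1%g \in row_stab k la by apply/row_stabP => i; rewrite perm1.
have one2 : 1%g \in col_stab k la by apply/col_stabP => i; rewrite perm1.
rewrite natF0 -lt0n /N (bigD1 1%g) //= (bigD1 1%g) //= (bigD1 1%g) ?one2 ?invg1 ?mulg1 ?eqxx //.
Qed.
End Fits.

End TwoRows.
End Shape.
End SpechtInvariants.

(** * Two-row multiplicities as differences of dimensions *)

Lemma partitions_uniq k : uniq (partitions k).
Proof.
rewrite filter_uniq // map_inj_uniq ?enum_uniq // => s t /(inj_map val_inj).
exact: val_inj.
Qed.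

Lemma mem_partitions k la : (la \in partitions k) = is_partition la && (sumn la == k).
Proof.
rewrite mem_filter; case E: (is_partition la && _) => //=.
case/andP: E => /andP[_ h0] /eqP hk.
have lt_k x : x \in la -> (x < k.+1)%N.
  rewrite ltnS -hk; elim: la {h0 hk} => //= a s IH; rewrite inE => /orP[/eqP->|/IH h]; first exact: leq_addr.
  exact: leq_trans h (leq_addl _ _).
have hsz : (size (map (@inord k) la) <= k)%N.
  rewrite size_map -hk; move: h0 {hk lt_k}; elim: la => //= a s IH.
  by rewrite inE negb_or => /andP[a0 /IH]; lia.
apply/mapP; exists (Bseq hsz); first by rewrite mem_enum.
rewrite /= -map_comp map_id_in // => x /lt_k hx; exact: inordK.
Qed.

Section Multiplicity.
Variables (F : fieldType).
Hypothesis charF0 : [pchar F] =i pred0.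

Lemma left_mul_lin k (s : 'S_k) : linear (@left_mul F k s).
Proof. by move=> a u v; apply/ffunP => g; rewrite !ffunE. Qed.

Lemma left_mulM k (s t : 'S_k) (v : grp_alg F k) : left_mul s (left_mul t v) = left_mul (s * t)%g v.
Proof. by apply/ffunP => g; rewrite !ffunE invMg mulgA. Qed.

Lemma grp_algZ k (c : F) (v : grp_alg F k) g : (c *: v) g = c * v g.
Proof. by rewrite ffunE. Qed.

Lemma grp_algB k (v w : grp_alg F k) g : (v - w) g = v g - w g.
Proof. by rewrite !ffunE. Qed.

Lemma grp_alg0 k g : (0 : grp_alg F k) g = 0.
Proof. by rewrite ffunE. Qed.

Definition fits (n : nat) (la : seq nat) : bool := (size la <= 2)%N && (nth 0%N la 1 <= n)%N.

(** The invariants form a line exactly for the shapes with at most two rows and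
    second row at most l2, since an invariant vector is determined by its value
    at 1 and [specht_fixed] does not vanish there. *)
Lemma specht_block_sum k l1 l2 la (chi : 'S_k -> F) : la \in partitions k ->
  (l1 + l2)%N = k -> (l2 <= l1)%N -> specht_char la chi ->
  \sum_(h in block_group k l1) chi h = #|block_group k l1|%:R * (fits l2 la)%:R.
Proof.
move=> lak l12 l21 [d [b [rho [bV hrho hchi]]]].
pose act (g : 'S_k) := @left_mul F k g^-1%g.
have aff : affords_char (specht_module (F := F) (k := k) la) act (fun g => chi g^-1%g).
  exists d, b, (fun g => rho g^-1%g); split => //.
  by move=> g i; exact: hrho.
have actM g h v : act g (act h v) = act (h * g)%g v by rewrite /act left_mulM invMg.
have -> : \sum_(h in block_group k l1) chi h = \sum_(h in block_group k l1) chi h^-1%g.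
  by rewrite [LHS](reindex_inj invg_inj); apply: eq_bigl => h; rewrite groupV.
have invE v : fixed_vector (specht_module (F := F) la) act (block_group k l1) v ->
   specht_module la v /\ forall h, h \in block_group k l1 -> left_mul h v = v.
  by move=> [h1 h2]; split=> // h hH; rewrite -[h]invgK; apply: h2; rewrite groupV.
have sub0 : (forall v, fixed_vector (specht_module (F := F) la) act (block_group k l1) v -> v = 0) ->
   is_basis (fixed_vector (specht_module (F := F) la) act (block_group k l1)) (fun i : 'I_0 => 0).
  move=> h0; split => [v|c _ []//]; split => [/h0->|[c ->]].
    by exists (fun=> 0); rewrite big_ord0.
  rewrite big_ord0; split; last by move=> h _; apply/ffunP => g; rewrite !ffunE.
  by exists 0; apply/ffunP => g; rewrite !ffunE big1 // => x _; rewrite ffunE mul0r.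
rewrite /fits; case: leqP => [la2|la3] /=; last first.
  apply: (sum_char_invariants (fun g => left_mul_lin _) actM charF0 aff (sub0 _)) => v /invE[vV vH].
  exact: (specht_inv_high charF0 lak la3 vV vH).
case: leqP => hj; last first.
  apply: (sum_char_invariants (fun g => left_mul_lin _) actM charF0 aff (sub0 _)) => v /invE[vV vH].
  exact: (specht_inv_low charF0 lak l12 l21 la2 hj vV vH).
pose y0 := specht_fixed F k la l1.
have y0V : specht_module la y0 by exact: specht_fixed_mem.
have y0H h : h \in block_group k l1 -> left_mul h y0 = y0 by exact: specht_fixed_inv.
have y01 : y0 1%g != 0 by exact: (specht_fixed1 charF0 lak l12 l21 la2 hj).
apply: (sum_char_invariants (fun g => left_mul_lin _) actM charF0 aff (b' := fun i : 'I_1 => y0)).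
have scV (c : F) v : specht_module la v -> specht_module la (c *: v).
  move=> [a ->]; exists (c *: a); apply/ffunP => g; rewrite !ffunE scaler_sumr.
  by apply: eq_bigr => x _; rewrite !ffunE -scalerAl.
have scH (c : F) v : (forall h, h \in block_group k l1 -> left_mul h v = v) ->
    forall h, h \in block_group k l1 -> left_mul h (c *: v) = c *: v.
  by move=> hv h hH; rewrite -[in RHS](hv h hH); apply/ffunP => g; rewrite !ffunE.
split => [v|c]; last first.
  by rewrite big_ord1 => /ffunP/(_ 1%g); rewrite grp_algZ grp_alg0 => /eqP; rewrite mulf_eq0 (negbTE y01) orbF => /eqP e i; rewrite ord1.
split => [/invE[vV vH]|[c ->]]; last first.
  rewrite big_ord1; split; first exact: scV.
  by move=> h hH; rewrite /act; apply: scH; rewrite ?groupV.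
pose c := v 1%g / y0 1%g.
exists (fun=> c); rewrite big_ord1; apply/eqP; rewrite -subr_eq0; apply/eqP.
apply: (specht_inv_determined charF0 lak l12 l21 la2 hj).
- have [[a ea] [a0 ea0]] := (vV, y0V); clearbody c; rewrite ea ea0.
  exists (a - c *: a0); apply/ffunP => g.
  rewrite grp_algB grp_algZ /conv !ffunE mulr_sumr -sumrB; apply: eq_bigr => x _.
  by rewrite grp_algB grp_algZ mulrBl mulrA.
- move=> h hH; have := vH h hH; have := scH c _ y0H h hH; clearbody c.
  move: (c *: y0) => u hu hv; rewrite -{2}hu -{2}hv.
  by apply/ffunP => g; rewrite grp_algB !ffunE.
by rewrite grp_algB grp_algZ divfK // subrr.
Qed.

Lemma two_row_fits k l1 l2 la : la \in partitions k -> (l1 + l2)%N = k -> (l2 <= l1)%N ->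
  fits l2 la = ((if l2 is l2'.+1 then fits l2' la else false) + (la == two_row l1 l2))%N :> nat.
Proof.
rewrite mem_partitions => /andP[/andP[hs h0] /eqP hk] l12 l21.
rewrite /fits /two_row; move: h0 hs hk; case: la => [|a [|b [|c s]]] /=.
- by move=> _ _ e; case: l2 l12 l21 => [|l2]; case: l1 => //=; lia.
- rewrite inE addn0 => a0 _ e; case: l2 l12 l21 => [|l2] h1 h2 /=.
    have -> : (0 < l1)%N by lia.
    by rewrite /= eqseq_cons eqxx andbT; lia.
  have -> : (0 < l1)%N by lia.
  by rewrite /= eqseq_cons andbF.
- rewrite !inE addn0 => h0 _ e; case: l2 l12 l21 => [|l2] h1 h2 /=.
    by case: (0 < l1)%N; rewrite /= ?eqseq_cons ?andbF //; case: b h0 {e} => //; rewrite orbT.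
  have -> : (0 < l1)%N by lia.
  by rewrite /= !eqseq_cons eqxx !andbT; lia.
move=> _ _ _; have -> : (a :: b :: c :: s == [seq x <- [:: l1; l2] | (0 < x)%N]) = false.
  by rewrite /=; case: (0 < l1)%N; case: (0 < l2)%N; rewrite /= ?eqseq_cons ?andbF.
by case: l2 {l12 l21}.
Qed.

(** dd l1 l2 is the sum of the multiplicities of the shapes that fit l2, and
    (l1, l2) is the only shape that fits l2 but not l2 - 1. *)
Lemma multiplicity_difference (m : seq nat -> nat) (k : nat) (dd : nat -> nat -> nat)
    (chiT : 'S_k -> F) (chi : seq nat -> 'S_k -> F) (l1 l2 : nat) :
  (forall l, l \in partitions k -> specht_char l (chi l)) ->
  (forall s, chiT s = \sum_(l <- partitions k) (m l)%:R * chi l s) ->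
  (forall a b, (a + b)%N = k ->
     \sum_(h in block_group k a) chiT h = #|block_group k a|%:R * (dd a b)%:R) ->
  (l1 + l2)%N = k -> (l2 <= l1)%N ->
  dd l1 l2 = ((if l2 is l2'.+1 then dd l1.+1 l2' else 0) + m (two_row l1 l2))%N.
Proof.
move=> hchi hT hdd.
have key a b : (a + b)%N = k -> (b <= a)%N -> dd a b = (\sum_(l <- partitions k) m l * fits b l)%N.
  move=> ab ba.
  have e1 : \sum_(h in block_group k a) chiT h =
      #|block_group k a|%:R * \sum_(l <- partitions k) (m l)%:R * (fits b l)%:R.
    rewrite (eq_bigr _ (fun h _ => hT h)) exchange_big /= mulr_sumr big_seq [RHS]big_seq.
    apply: eq_bigr => l hl.
    by rewrite -mulr_sumr (specht_block_sum hl ab ba (hchi l hl)) mulrCA.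
  have := hdd a b ab; rewrite e1 => /mulfI e {e1}.
  have {e} := e _; have /pcharf0P c0 := charF0.
  rewrite c0 -lt0n cardG_gt0 => /(_ isT) e.
  have inj0 x y : (x <= y)%N -> x%:R = y%:R :> F -> x = y.
    move=> h /esym/eqP; rewrite -subr_eq0 -natrB // c0 subn_eq0 => h'.
    by apply/eqP; rewrite eqn_leq h h'.
  have inj x y : x%:R = y%:R :> F -> x = y.
    by case: (leqP x y) => [/inj0//|/ltnW/inj0 h /esym/h].
  apply: inj; rewrite -e natr_sum; apply: eq_bigr => l _; by rewrite natrM.
move=> l12 l21; rewrite key //.
have -> : (if l2 is l2'.+1 then dd l1.+1 l2' else 0%N) =
   (\sum_(l <- partitions k) m l * (if l2 is l2'.+1 then fits l2' l else false))%N.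
  case: l2 l12 l21 => [|l2] l12 l21; first by rewrite big1 // => l _; rewrite muln0.
  by rewrite key //; lia.
have hmem : two_row l1 l2 \in partitions k.
  rewrite mem_partitions /two_row; case: l1 l2 l12 l21 => [|l1] [|l2] //= l12 l21.
  - by rewrite -l12.
  - by rewrite -l12 /is_partition /= !addn0 eqxx.
  - by rewrite -l12 /is_partition /= addn0 eqxx andbT; lia.
rewrite [RHS]addnC -[m (two_row l1 l2)](_ : \sum_(l <- partitions k) m l * (l == two_row l1 l2) = _)%N.
  rewrite -big_split /= big_seq [RHS]big_seq; apply: eq_bigr => l hl.
  by rewrite (two_row_fits hl l12 l21) mulnDr addnC.
rewrite (bigD1_seq (two_row l1 l2)) ?partitions_uniq //= eqxx muln1 big1 ?addn0 //.
by move=> l /negbTE->; rewrite muln0.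
Qed.
End Multiplicity.

(** * Evaluation and degrees in the algebra of generic matrices *)

Lemma cmonom_ind (I : choiceType) (P : cmonom I -> Prop) :
  P (@mone {cmonom I}) -> (forall i m, P m -> P (mmul (ucm i) m)) -> forall m, P m.
Proof.
move=> h1 hU m; have [n] := ubnP (mdeg m); elim: n m => // n IH m hm.
case: (fset_0Vmem (finsupp m)) => [e|[i im]].
  have -> : m = @mone {cmonom I} by apply/mdeg_eq0I; rewrite mdegE e big_seq_fset0.
  exact: h1.
have e : m = mmul (ucm i) (divcm m (ucm i)).
  apply/eqP/cmP => j; rewrite cmM cmU divcmE cmU; case: eqVneq => [<-|_]; last by rewrite subn0.
  by rewrite subnKC // lt0n cmE_neq0.
rewrite e; apply/hU/IH.
by move: hm; rewrite {1}e mdegM mdegU.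
Qed.

Section Evaluation.
Variables (I : choiceType) (S : comNzRingType) (g : I -> S).

Definition monom_eval (m : {cmonom I}) : S := \prod_(v <- finsupp m) g v ^+ m v.

Lemma monom_evalE (d : {fset I}) (m : {cmonom I}) : (finsupp m `<=` d)%fset ->
  monom_eval m = \prod_(v <- d) g v ^+ m v.
Proof.
move=> h; rewrite /monom_eval (big_fset_incl _ h) // => v _.
by rewrite memNfinsupp => /eqP->; rewrite expr0.
Qed.

Lemma monom_eval_mmorphism : monalg.mmorphism monom_eval.
Proof.
split=> [m1 m2|]; last by rewrite /monom_eval mdom1 big_seq_fset0.
rewrite (@monom_evalE (finsupp m1 `|` finsupp m2)%fset) ?mdomD //.
rewrite (@monom_evalE (finsupp m1 `|` finsupp m2)%fset m1) ?fsubsetUl //.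
rewrite (@monom_evalE (finsupp m1 `|` finsupp m2)%fset m2) ?fsubsetUr //.
by rewrite -big_split; apply: eq_bigr => v _; rewrite cmM exprD.
Qed.

HB.instance Definition _ := monalg.isMultiplicative.Build {cmonom I} S monom_eval monom_eval_mmorphism.

Lemma monom_evalU v : monom_eval (ucm v) = g v.
Proof. by rewrite /monom_eval mdomU big_seq_fset1 cmUU expr1. Qed.
End Evaluation.

Section GenPoly.
Variable F : fieldType.
Notation genpoly := (genpoly F).

(** Evaluation at g with the scalars sent through f. It generalizes [gensubst],
    whose target is the algebra itself, to targets in which a deformation
    parameter is available. *)
Definition geval (S : comNzRingType) (f : {rmorphism F -> S}) (g : genvar -> S) : genpoly -> S :=
  mmap f (monom_eval g).
HB.instance Definition _ S f g := GRing.RMorphism.copy (@geval S f g) (mmap f (monom_eval g)).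

Lemma gevalV S f g v : @geval S f g (var F v) = g v.
Proof. rewrite /geval /var mmapU monom_evalU.
exact: (etrans (congr1 (fun x => x * g v) (rmorph1 f)) (mul1r _)).
Qed.

Lemma gevalA S f g (c : F) : @geval S f g c%:A = f c.
Proof. by rewrite /geval (mmapZ c 1) mmap1 mulr1. Qed.

Lemma gensubstE g p : gensubst g p = geval (in_alg genpoly) g p.
Proof. by []. Qed.
End GenPoly.

Section Monomials.
Variable F : fieldType.
Notation genpoly := (genpoly F).
Implicit Types (p q : genpoly) (m : {cmonom genvar}).

(** The monomial that is the product of a sequence of variables: sequences are
    easier to rename and to permute than exponent functions. *)
Definition mvars (s : seq genvar) : {cmonom genvar} := \big[mmul/@mone {cmonom genvar}]_(v <- s) ucm v.

Lemma mvarsE s v : mvars s v = count_mem v s.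
Proof.
rewrite /mvars; elim: s => [|u s IH]; first by rewrite big_nil cm1.
by rewrite big_cons cmM cmU IH.
Qed.

Lemma mulU1 m m' : << m >> * << m' >> = << mmul m m' >> :> genpoly.
Proof. by rewrite -[LHS]/(_ * _ : {malg F[{cmonom genvar}]}) malgM_def fgmulUU mulr1. Qed.

Lemma prod_var s : \prod_(v <- s) var F v = << mvars s >>.
Proof.
rewrite /mvars; elim: s => [|v s IH]; first by rewrite !big_nil.
rewrite big_cons [in RHS]big_cons IH; exact: mulU1.
Qed.

Lemma gensubst_mvars g s : gensubst g (<< mvars s >> : genpoly) = \prod_(v <- s) g v.
Proof.
by rewrite -prod_var gensubstE rmorph_prod; apply: eq_bigr => v _; exact: gevalV.
Qed.

Lemma gensubstZ g c p : gensubst g (c *: p) = c *: gensubst g p :> genpoly.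
Proof.
rewrite gensubstE -[c *: p]mulr_algl [LHS](rmorphM (geval (in_alg genpoly) g)).
by rewrite -[RHS]mulr_algl; congr (_ * _); exact: gevalA.
Qed.

Lemma gensubst_sum g (J : Type) (r : seq J) (P : pred J) (c : J -> F) (q : J -> genpoly) :
  gensubst g (\sum_(i <- r | P i) c i *: q i) = \sum_(i <- r | P i) c i *: gensubst g (q i) :> genpoly.
Proof.
rewrite gensubstE rmorph_sum; apply: eq_bigr => i _.
exact: gensubstZ.
Qed.

Definition deg_in (r : nat) m : nat := (\sum_(a : 'I_3) \sum_(b : 'I_3) m (r, a, b))%N.

Definition multideg (d : nat -> nat) p : Prop := forall m, m \in msupp p -> forall r, deg_in r m = d r.

Lemma multidegD d p q : multideg d p -> multideg d q -> multideg d (p + q).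
Proof.
move=> hp hq m /(fsubsetP (msuppD_le p q)); rewrite inE => /orP[/hp|/hq]; exact.
Qed.

Lemma multideg0 d : multideg d 0.
Proof. by move=> m; rewrite msupp0. Qed.

Lemma multidegM d e p q : multideg d p -> multideg e q -> multideg (fun r => d r + e r)%N (p * q).
Proof.
move=> hp hq m /msuppM_le[m1 [m2 [h1 h2 ->]]] r.
rewrite -(hp _ h1) -(hq _ h2) /deg_in -big_split; apply: eq_bigr => a _.
by rewrite -big_split; apply: eq_bigr => b _; rewrite cmM.
Qed.

Lemma multideg1 : multideg (fun=> 0%N) 1.
Proof.
move=> m; rewrite -mcoeff_neq0 mcoeff1; case: (eqVneq m mone) => [-> _ r|_]; last by rewrite eqxx.
by rewrite /deg_in big1 // => a _; rewrite big1 // => b _; rewrite cm1.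
Qed.

Lemma multideg_var i a b : multideg (fun r => (r == i)) (var F (i, a, b)).
Proof.
move=> m hm; have {hm} : m \in msupp (<< ucm (i, a, b) >> : {malg F[{cmonom genvar}]}) by exact: hm.
rewrite msuppU1. rewrite in_fset1. move=> /eqP-> r.
rewrite /deg_in.
have e a' b' : ucm ((i, a, b) : genvar) (r, a', b') = ((r == i) && (a' == a) && (b' == b))%N :> nat.
  by rewrite cmU eq_sym.
rewrite (bigD1 a) //= (bigD1 b) //= e !eqxx !andbT !big1 ?addn0 // => [a' ha|b' hb].
  by rewrite big1 // => b' _; rewrite e (negbTE ha) andbF.
by rewrite e (negbTE hb) andbF.
Qed.

Lemma multideg_ext d e p : (forall r, d r = e r) -> multideg d p -> multideg e p.
Proof. by move=> h hp m hm r; rewrite -h hp. Qed.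

Definition multideg_mx (d : nat -> nat) (M : genmat F) : Prop := forall i j, multideg d (M i j).

Lemma multideg_mxM d e (M N : genmat F) : multideg_mx d M -> multideg_mx e N ->
  multideg_mx (fun r => d r + e r)%N (M * N).
Proof.
move=> hM hN i j; rewrite -[M * N]/(M *m N) mxE; elim/big_rec: _ => [|l x _ hx]; first exact: multideg0.
by apply: multidegD => //; exact: multidegM.
Qed.

Definition word_mx (w : seq nat) : genmat F := \prod_(r <- w) generic_mx F r.

Lemma multideg_word w : multideg_mx (fun r => count_mem r w) (word_mx w).
Proof.
rewrite /word_mx; elim: w => [|r w IH].
  by rewrite big_nil => i j; rewrite mxE; case: (i == j) => /=; [exact: multideg1|exact: multideg0].
rewrite big_cons => i j; apply: (multideg_ext (d := fun s => (s == r) + count_mem s w)%N).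
  by move=> s; rewrite /= eq_sym.
by apply: multideg_mxM => // a b; rewrite mxE; exact: multideg_var.
Qed.

Lemma multideg_trace w : multideg (fun r => count_mem r w) (\tr (word_mx w : 'M[genpoly]_3)).
Proof.
rewrite /mxtrace; elim/big_rec: _ => [|l x _ hx]; first exact: multideg0.
by apply: multidegD => //; exact: multideg_word.
Qed.

Definition trace_mon (w0 : seq nat) (ws : seq (seq nat)) : genmat F :=
  ((\prod_(w <- ws) \tr (word_mx w : 'M[genpoly]_3))%:M : 'M[genpoly]_3) * word_mx w0.

Lemma multideg_trace_mon w0 ws : multideg_mx (fun r => count_mem r (w0 ++ flatten ws)) (trace_mon w0 ws).
Proof.
move=> i j; rewrite /trace_mon -[_ * word_mx _]/(_ *m word_mx _) mul_scalar_mx mxE.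
apply: (multideg_ext (d := fun r => count_mem r (flatten ws) + count_mem r w0)%N).
  by move=> r; rewrite count_cat addnC.
apply: multidegM; last exact: multideg_word.
elim: ws => [|w ws IH]; first by rewrite big_nil; exact: multideg1.
rewrite big_cons /=; apply: (multideg_ext (d := fun r => count_mem r w + count_mem r (flatten ws))%N).
  by move=> r; rewrite count_cat.
by apply: multidegM => //; exact: multideg_trace.
Qed.

Lemma trace_mon_mem w0 ws : mixed_trace_alg (trace_mon w0 ws).
Proof.
apply: gen_alg_mul; apply: gen_alg_in; [right|left].
  exists (\prod_(w <- ws) \tr (word_mx w : 'M[genpoly]_3)) => //.
  elim: ws => [|w ws IH].
    rewrite big_nil -[1](scale1r 1); exact: gen_alg_scal.
  by rewrite big_cons; apply: gen_alg_mul => //; apply: gen_alg_in; exists w.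
rewrite /word_mx; elim: w0 => [|r w IH].
  rewrite big_nil -[1](scale1r 1); exact: gen_alg_scal.
by rewrite big_cons; apply: gen_alg_mul => //; apply: gen_alg_in; exists r.
Qed.
End Monomials.

(** * Restitution of multilinear elements *)

Section Restitution.
Variable F : fieldType.
Hypothesis charF0 : [pchar F] =i pred0.
Variables (k l1 : nat).
Notation genpoly := (genpoly F).
Notation pos := ('I_3 * 'I_3)%type.

Definition pvar (r : nat) (ab : pos) : genvar := (r, ab.1, ab.2).
(** The variables of a multilinear monomial, which takes one entry c r from each
    generic matrix r < k. *)
Definition pvars (c : {ffun 'I_k -> pos}) : seq genvar := [seq pvar (nat_of_ord r) (c r) | r : 'I_k <- enum 'I_k].
Definition rename (f : nat -> nat) (v : genvar) : genvar := (f v.1.1, v.1.2, v.2).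

Lemma pvar_inj r s (x y : pos) : (pvar r x == pvar s y) = (r == s) && (x == y).
Proof. by case: x => a b; case: y => a' b'; rewrite /pvar -!pair_eqE /= -!pair_eqE /= -andbA. Qed.

Lemma rename_pvar f r x : rename f (pvar r x) = pvar (f r) x. Proof. by []. Qed.

Lemma mvars_pvarsE c (r : 'I_k) x : mvars (pvars c) (pvar r x) = (c r == x) :> nat.
Proof.
rewrite mvarsE count_map (@eq_count _ _ (fun i : 'I_k => (i == r) && (c r == x))); last first.
  by move=> i; rewrite /= pvar_inj -[(_ == _ :> nat)]/(i == r); case: eqVneq => // ->.
case: (c r == x).
  by rewrite (eq_count (a2 := pred1 r)) ?count_uniq_mem ?enum_uniq ?mem_enum // => i; rewrite /= andbT.
by rewrite (eq_count (a2 := pred0)) ?count_pred0 // => i; rewrite /= andbF.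
Qed.

Lemma mvars_pvars_out c (r : nat) x : (k <= r)%N -> mvars (pvars c) (pvar r x) = 0%N.
Proof.
move=> kr; rewrite mvarsE; apply/count_memPn/negP => /mapP[i _ /eqP].
by rewrite pvar_inj => /andP[/eqP e _]; have := ltn_ord i; rewrite -e ltnNge kr.
Qed.

Lemma pvars_inj c d : mvars (pvars c) = mvars (pvars d) -> c = d.
Proof.
move=> e; apply/ffunP => r; have := mvars_pvarsE d r (c r).
by rewrite -e mvars_pvarsE eqxx; case: eqP.
Qed.

(** Degree 1 in a matrix means that exactly one of its nine entries occurs, with
    exponent 1. *)
Lemma multilin_monom m : (forall r, deg_in r m = (r < k)%N) -> exists c, m = mvars (pvars c).
Proof.
move=> hm.
have degE r : deg_in r m = (\sum_(x : pos) m (pvar r x))%N by rewrite /deg_in pair_bigA.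
have one (r : 'I_k) : exists x, forall y, m (pvar r y) = (x == y).
  have := hm r; rewrite degE ltn_ord => e.
  have [x hx] : exists x, m (pvar r x) != 0%N.
    apply/existsP; apply: contra_eqT e => /existsPn h.
    by rewrite big1 // => x _; apply/eqP; rewrite -[_ == _]negbK; exact: h.
  exists x => y; move: e hx; rewrite (bigD1 x) //=; case: (eqVneq x y) => [<-|xy].
    by move: (m _) (\sum_(i | _) _)%N => a b; lia.
  rewrite (bigD1 y) 1?eq_sym //=; move: (m (pvar r x)) (m (pvar r y)) (\sum_(i | _) _)%N => a b s; lia.
have /fin_all_exists[c hc] := one; exists (finfun c).
apply/eqP/cmP => -[[r a] b]; rewrite -[(r, a, b)]/(pvar r (a, b)).
case: (ltnP r k) => hr; last first.
  rewrite mvars_pvars_out //; have := hm r; rewrite degE ltnNge hr /=.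
  by move/eqP; rewrite sum_nat_eq0 => /forallP/(_ (a, b))/eqP.
by rewrite -[r]/(nat_of_ord (Ordinal hr)) mvars_pvarsE ffunE hc.
Qed.

Lemma gensubst_rename f s : gensubst (fun v => var F (rename f v)) (<< mvars s >> : genpoly) = << mvars (map (rename f) s) >>.
Proof. by rewrite gensubst_mvars -prod_var big_map. Qed.

Lemma coefZU (c : F) (m m' : {cmonom genvar}) : (c *: (<< m >> : genpoly))@_m' = c * (m == m')%:R.
Proof. by have := mcoeffZ c << m >> m'; rewrite mcoeffU1. Qed.

Lemma coef_sumZU (J : finType) (c : J -> F) (m : J -> {cmonom genvar}) m' :
  (\sum_i c i *: (<< m i >> : genpoly))@_m' = \sum_i c i * (m i == m')%:R.
Proof.
have -> : (\sum_i c i *: (<< m i >> : genpoly))@_m' = \sum_i (c i *: (<< m i >> : genpoly))@_m'.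
  exact: (raddf_sum (mcoeff m')).
by apply: eq_bigr => i _; exact: coefZU.
Qed.

Definition block (r : nat) : nat := if (r < l1)%N then 0 else 1.

Lemma perm_index_ord (h : 'S_k) (r : 'I_k) : perm_index h r = h r.
Proof. by rewrite /perm_index valK. Qed.

Lemma rename_pvars_perm (h : 'S_k) (c : {ffun 'I_k -> pos}) :
  mvars (map (rename (perm_index h)) (pvars [ffun r => c (h r)])) = mvars (pvars c).
Proof.
apply/eqP/cmP => v; rewrite !mvarsE.
suff /seq.permP : perm_eq (map (rename (perm_index h)) (pvars [ffun r => c (h r)])) (pvars c) by apply.
rewrite /pvars -map_comp.
have -> : [seq (rename (perm_index h) \o (fun r : 'I_k => pvar r ([ffun r => c (h r)] r))) r | r <- enum 'I_k] =
   [seq pvar (nat_of_ord r) (c r) | r : 'I_k <- [seq h r | r <- enum 'I_k]].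
  by rewrite -[RHS]map_comp; apply: eq_map => r; rewrite /= rename_pvar ffunE perm_index_ord.
apply: perm_map; apply: uniq_perm; [rewrite map_inj_uniq ?enum_uniq //; exact: perm_inj|exact: enum_uniq|].
by move=> r; rewrite mem_enum; apply/mapP; exists ((h^-1)%g r); rewrite ?mem_enum ?permKV.
Qed.

Lemma sum_const_eq0 (J : finType) (P : pred J) (x : J) (a : F) : P x -> \sum_(d | P d) a = 0 -> a = 0.
Proof.
move=> Px; rewrite sumr_const -mulr_natl => /eqP; have /pcharf0P c0 := charF0.
rewrite mulf_eq0 c0 => /orP[|/eqP //] /eqP h.
have : (0 < #|P|)%N by apply/card_gt0P; exists x.
by rewrite h.
Qed.

(** The coefficients of p form a function q of the choice c of entries, and q is
    constant on the orbits of H. Two monomials become equal after the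
    identification of the matrices in each block exactly when H permutes one
    into the other, so each coefficient of the image is the size of an orbit
    times a value of q. *)
Lemma restitution_inj (p : genpoly) : multideg (fun r => (r < k)%N : nat) p ->
  (forall h, h \in block_group k l1 -> gensubst (fun v => var F (rename (perm_index h) v)) p = p) ->
  gensubst (fun v => var F (rename block v)) p = 0 -> p = 0.
Proof.
move=> hdeg hinv hres.
pose q (c : {ffun 'I_k -> pos}) := p@_(mvars (pvars c)).
have pE : p = \sum_c q c *: (<< mvars (pvars c) >> : genpoly).
  apply/malgP => m; rewrite coef_sumZU.
  case: (boolP (m \in msupp p)) => hm.
    have [c ->] := multilin_monom (hdeg m hm).
    rewrite (bigD1 c) //= eqxx mulr1 big1 ?addr0 // => d dc.
    case: eqP => [/pvars_inj e|]; last by rewrite mulr0.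
    by rewrite e eqxx in dc.
  rewrite mcoeff_outdom // big1 // => c _.
  by case: eqP => [e|]; [rewrite /q e mcoeff_outdom ?mul0r|rewrite mulr0].
have substE f : gensubst (fun v => var F (rename f v)) p =
    \sum_c q c *: (<< mvars (map (rename f) (pvars c)) >> : genpoly).
  by rewrite {1}pE gensubst_sum; apply: eq_bigr => c _; rewrite gensubst_rename.
have qh (h : 'S_k) (c : {ffun 'I_k -> pos}) : h \in block_group k l1 -> q [ffun r => c (h r)] = q c.
  move=> hH; have := congr1 (fun f : genpoly => f@_(mvars (pvars c))) (hinv h hH).
  rewrite /= substE coef_sumZU -/(q c) => <-.
  rewrite (bigD1 [ffun r => c (h r)]) //= rename_pvars_perm eqxx mulr1.
  rewrite big1 ?addr0 // => d hd.
  have e : d = [ffun r => [ffun r => d (h^-1%g r)] (h r)] by apply/ffunP => r; rewrite !ffunE permK.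
  rewrite {2}e rename_pvars_perm; case: eqP => [/pvars_inj e'|]; last by rewrite mulr0.
  by case/eqP: hd; apply/ffunP => r; rewrite -e' !ffunE permK.
suff q0 c : q c = 0 by rewrite pE big1 // => c _; rewrite q0 scale0r.
have := congr1 (fun f : genpoly => f@_(mvars (map (rename block) (pvars c)))) hres.
rewrite /= substE coef_sumZU mcoeff0.
have key (d : {ffun 'I_k -> pos}) : mvars (map (rename block) (pvars d)) = mvars (map (rename block) (pvars c)) -> q d = q c.
  move=> e; pose tp (f : {ffun 'I_k -> pos}) := [tuple pvar (block r) (f r) | r < k].
  have tpE f : map (rename block) (pvars f) = tp f :> seq _.
    by rewrite /pvars -map_comp.
  have : perm_eq (tp d) (tp c).
    by rewrite -!tpE; apply/allP => v _ /=; rewrite -!mvarsE e.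
  move=> /tuple_permP[h he].
  have hr (r : 'I_k) : (block r == block (h r)) && (d r == c (h r)).
    rewrite -pvar_inj; apply/eqP.
    have := congr1 (fun s => nth (pvar 0 (ord0, ord0)) s r) he.
    by rewrite -!tnth_nth !tnth_mktuple.
  rewrite -(qh h c).
    by congr q; apply/ffunP => r; rewrite ffunE; have /andP[_ /eqP] := hr r.
  apply/block_stabP => r; have /andP[/eqP + _] := hr r.
  by rewrite /block; case: ifP; case: ifP.
pose C := [pred d | mvars (map (rename block) (pvars d)) == mvars (map (rename block) (pvars c))].
rewrite (bigID C) /= [X in _ + X]big1 ?addr0; last first.
  by move=> d hd; rewrite (negbTE hd) mulr0.
rewrite (eq_bigr (fun=> q c)); last first.
  by move=> d hd; rewrite hd mulr1 key //; exact/eqP.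
move=> hs; apply: (@sum_const_eq0 _ C c); [exact: eqxx|exact: hs].
Qed.

End Restitution.

(** * The polarized Cayley-Hamilton identity *)

Definition o0 : 'I_3 := @Ordinal 3 0 isT.
Definition o1 : 'I_3 := @Ordinal 3 1 isT.
Definition o2 : 'I_3 := @Ordinal 3 2 isT.

Lemma ord3P (P : 'I_3 -> Prop) : P o0 -> P o1 -> P o2 -> forall i, P i.
Proof.
move=> h0 h1 h2 [[|[|[|//]]] hi].
- by rewrite (_ : Ordinal hi = o0) //; apply: val_inj.
- by rewrite (_ : Ordinal hi = o1) //; apply: val_inj.
by rewrite (_ : Ordinal hi = o2) //; apply: val_inj.
Qed.

Lemma sum3 (V : nmodType) (f : 'I_3 -> V) : \sum_i f i = f o0 + f o1 + f o2.
Proof.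
rewrite !big_ord_recr big_ord0 /= add0r.
by congr (f _ + f _ + f _); apply: val_inj.
Qed.

Section CayleyHamilton.
Variable R : comNzRingType.
Implicit Types A B C : 'M[R]_3.

Lemma tr3 A : \tr A = A o0 o0 + A o1 o1 + A o2 o2.
Proof. exact: sum3. Qed.

Lemma mul3 A B i j : (A * B) i j = A i o0 * B o0 j + A i o1 * B o1 j + A i o2 * B o2 j.
Proof. by rewrite mxE sum3. Qed.

Lemma add3 A B i j : (A + B) i j = A i j + B i j. Proof. by rewrite mxE. Qed.
Lemma opp3 A i j : (- A) i j = - A i j. Proof. by rewrite mxE. Qed.
Lemma one3 i j : (1 : 'M[R]_3) i j = (i == j)%:R. Proof. by rewrite mxE. Qed.

Lemma scal3 (c : R) A i j : (c%:M * A) i j = c * A i j.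
Proof. by rewrite -[_ * _]/(_ *m _) mul_scalar_mx mxE. Qed.

(** The full polarization of A^3 - (tr A) A^2 + e_2(A) A - (det A) 1 = 0. The
    trace of A B C + A C B occurs in the scalar term alone. *)
Lemma cayley_hamilton3 A B C :
  A * B * C + A * C * B + B * A * C + B * C * A + C * A * B + C * B * A =
  (\tr A)%:M * (B * C + C * B) + (\tr B)%:M * (A * C + C * A) + (\tr C)%:M * (A * B + B * A)
  - (\tr A * \tr B - \tr (A * B))%:M * C - (\tr A * \tr C - \tr (A * C))%:M * B
  - (\tr B * \tr C - \tr (B * C))%:M * A
  + (\tr A * \tr B * \tr C - \tr A * \tr (B * C) - \tr B * \tr (A * C) - \tr C * \tr (A * B)
     + \tr (A * B * C) + \tr (A * C * B))%:M * 1.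
Proof.
apply/matrixP => i j; rewrite !(add3, opp3, scal3, one3, mul3, tr3).
move: i j; apply: ord3P; apply: ord3P; rewrite /= ?mulr1n ?mulr0n.
all: ring.
Qed.
End CayleyHamilton.

(** * Reduction of words in two letters *)

(** The normal words X^i (YX)^k Y^j; in words, [false] stands for X and [true]
    for Y. *)
Definition std_word (i k j : nat) : seq bool :=
  nseq i false ++ flatten (nseq k [:: true; false]) ++ nseq j true.

(** Among words of the same length the order of these values is the
    lexicographic order; it decreases when an X moves to the left. *)
Definition bin_val (w : seq bool) : nat := foldl (fun n (b : bool) => n.*2 + b)%N 0%N w.

Lemma bin_val_cat u v : bin_val (u ++ v) = (bin_val u * 2 ^ size v + bin_val v)%N.
Proof.
elim/last_ind: v => [|v b IH]; first by rewrite cats0 muln1 addn0.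
by rewrite /bin_val -rcons_cat !foldl_rcons -!/(bin_val _) IH size_rcons expnS; lia.
Qed.

Lemma bin_val_lt u a a' v : size a = size a' -> (bin_val a < bin_val a')%N ->
  (bin_val (u ++ a ++ v) < bin_val (u ++ a' ++ v))%N.
Proof.
move=> sa h; rewrite !bin_val_cat !size_cat sa ltn_add2l ltn_add2r ltn_pmul2r ?expn_gt0 //.
Qed.

Variant pattern_spec (w : seq bool) : Prop :=
| PatXXX u v of w = u ++ [:: false; false; false] ++ v
| PatYYY u v of w = u ++ [:: true; true; true] ++ v
| PatYXX u v of w = u ++ [:: true; false; false] ++ v
| PatYYX u v of w = u ++ [:: true; true; false] ++ v
| PatStd i k j of (i <= 2)%N & (j <= 2)%N & w = std_word i k j.

(** A word without the factors XXX, YYY, YXX and YYX is normal: after a Y, only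
    YX can start again, until the final power of Y. *)
Lemma patternP w : pattern_spec w.
Proof.
elim: w => [|b w [u v ->|u v ->|u v ->|u v ->|i k j hi hj ->]].
- exact: (@PatStd _ 0 0 0).
- exact: (@PatXXX _ (b :: u) v).
- exact: (@PatYYY _ (b :: u) v).
- exact: (@PatYXX _ (b :: u) v).
- exact: (@PatYYX _ (b :: u) v).
case: b; last first.
  case: i hi => [|[|[|i]]] // hi; [exact: (@PatStd _ 1 k j)|exact: (@PatStd _ 2 k j)|].
  exact: (@PatXXX _ [::] (flatten (nseq k [:: true; false]) ++ nseq j true)).
case: i hi => [|[|[|i]]] // hi; last 1 first.
- exact: (@PatYXX _ [::] (flatten (nseq k [:: true; false]) ++ nseq j true)).
- case: k => [|k].
    case: j hj => [|[|[|j]]] // hj; [exact: (@PatStd _ 0 0 1)|exact: (@PatStd _ 0 0 2)|exact: (@PatYYY _ [::] [::])].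
  exact: (@PatYYX _ [::] (flatten (nseq k [:: true; false]) ++ nseq j true)).
exact: (@PatStd _ 0 k.+1 j).
Qed.

(** The third and fourth cases relate a word to two words that are smaller in
    the lexicographic order and have the same length; the words with a cube are
    dealt with directly. *)
Lemma word_reduction (P : seq bool -> Prop) (n : nat) :
  (forall u v, size (u ++ [:: false; false; false] ++ v) = n -> P (u ++ [:: false; false; false] ++ v)) ->
  (forall u v, size (u ++ [:: true; true; true] ++ v) = n -> P (u ++ [:: true; true; true] ++ v)) ->
  (forall u v, size (u ++ [:: true; false; false] ++ v) = n -> P (u ++ [:: false; false; true] ++ v) ->
     P (u ++ [:: false; true; false] ++ v) -> P (u ++ [:: true; false; false] ++ v)) ->
  (forall u v, size (u ++ [:: true; true; false] ++ v) = n -> P (u ++ [:: false; true; true] ++ v) ->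
     P (u ++ [:: true; false; true] ++ v) -> P (u ++ [:: true; true; false] ++ v)) ->
  (forall i k j, (i <= 2)%N -> (j <= 2)%N -> size (std_word i k j) = n -> P (std_word i k j)) ->
  forall w, size w = n -> P w.
Proof.
move=> hX hY hYX hYY hs w; have [m] := ubnP (bin_val w).
elim: m w => // m IH w; case: (patternP w) => [u v ->|u v ->|u v ->|u v ->|i k j hi hj ->] hm hn.
- exact: hX.
- exact: hY.
- apply: hYX => //; apply: IH; rewrite ?size_cat -?hn ?size_cat //; apply: leq_trans (bin_val_lt _ _ _ _) _; rewrite ?ltnS in hm *; try exact: hm; by [].
- apply: hYY => //; apply: IH; rewrite ?size_cat -?hn ?size_cat //; apply: leq_trans (bin_val_lt _ _ _ _) _; rewrite ?ltnS in hm *; try exact: hm; by [].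
exact: hs.
Qed.

(** * Traces of words in two matrices *)

Section Words.
Variables (R : comNzRingType) (X Y : 'M[R]_3).

Definition wev (w : seq bool) : 'M[R]_3 := \prod_(b <- w) (if b then Y else X).
Definition wtr (w : seq bool) : R := \tr (wev w).

Lemma wev_cat u v : wev (u ++ v) = wev u * wev v.
Proof. exact: big_cat. Qed.

Lemma wev_nil : wev [::] = 1. Proof. exact: big_nil. Qed.

Lemma wtr1 x : wtr [:: x] = \tr (if x then Y else X).
Proof. by rewrite /wtr /wev big_cons big_nil mulr1. Qed.
Lemma wtr2 x y :
  wtr [:: x; y] = \tr ((if x then Y else X) * (if y then Y else X)).
Proof. by rewrite /wtr /wev !big_cons big_nil mulr1. Qed.
Lemma wtr3 x y z : wtr [:: x; y; z] =
  \tr ((if x then Y else X) * (if y then Y else X) * (if z then Y else X)).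
Proof. by rewrite /wtr /wev !big_cons big_nil mulr1 mulrA. Qed.

Lemma mxtr_mulC (A B : 'M[R]_3) : \tr (A * B) = \tr (B * A).
Proof. exact: mxtrace_mulC. Qed.

Lemma wtr_rot n w : wtr (rot n w) = wtr w.
Proof. by rewrite /rot /wtr wev_cat mxtr_mulC -wev_cat cat_take_drop. Qed.

Lemma wtrC u v : wtr (u ++ v) = wtr (v ++ u).
Proof. by rewrite /wtr !wev_cat mxtr_mulC. Qed.

Lemma mxtr_scal (p : R) (A : 'M[R]_3) : \tr (p%:M * A) = p * \tr A.
Proof. by rewrite -[p%:M * A]/(p%:M *m A) mul_scalar_mx mxtraceZ. Qed.

(** Multiplied by a word and traced, the polarized identity becomes a relation
    between traces of words in which all the products of traces involve shorter
    words. *)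
Lemma wtr_polarized u a b c : let t w := wtr w in
  t (u ++ a ++ b ++ c) + t (u ++ a ++ c ++ b) + t (u ++ b ++ a ++ c)
  + t (u ++ b ++ c ++ a) + t (u ++ c ++ a ++ b) + t (u ++ c ++ b ++ a) =
  t a * (t (u ++ b ++ c) + t (u ++ c ++ b)) + t b * (t (u ++ a ++ c) + t (u ++ c ++ a))
  + t c * (t (u ++ a ++ b) + t (u ++ b ++ a))
  - (t a * t b - t (a ++ b)) * t (u ++ c) - (t a * t c - t (a ++ c)) * t (u ++ b)
  - (t b * t c - t (b ++ c)) * t (u ++ a)
  + (t a * t b * t c - t a * t (b ++ c) - t b * t (a ++ c) - t c * t (a ++ b)
     + t (a ++ b ++ c) + t (a ++ c ++ b)) * t u.
Proof.
move=> t; have := congr1 (fun M => \tr (wev u * M)) (cayley_hamilton3 (wev a) (wev b) (wev c)).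
have sc p (A : 'M[R]_3) : wev u * (p%:M * A) = p%:M * (wev u * A).
  by rewrite mulrA (_ : wev u * p%:M = p%:M * wev u) -?mulrA //; exact: scalar_mxC.
have trN (A : 'M[R]_3) : \tr (- A) = - \tr A by exact: raddfN.
rewrite /= !(mulrDr, mulrN) !sc !(mxtraceD, trN) !mxtr_scal ?mulr1.
rewrite /t /wtr !wev_cat !mulrA => ->.
by ring.
Qed.

Variable S : 'M[R]_3 -> Prop.
Hypothesis S1 : S 1.
Hypothesis SD : forall A B, S A -> S B -> S (A + B).
Hypothesis SN : forall A, S A -> S (- A).
Hypothesis SM : forall A B, S A -> S B -> S (A * B).
Hypothesis Sdiv : forall A n, S (A *+ n.+1) -> S A.
Hypothesis SX : S X.
Hypothesis SY : S Y.

Definition scal_in (p : R) : Prop := S p%:M.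

Hypothesis DX : scal_in (\tr X).
Hypothesis DY : scal_in (\tr Y).
Hypothesis DXX : scal_in (\tr (X * X)).
Hypothesis DXY : scal_in (\tr (X * Y)).
Hypothesis DYY : scal_in (\tr (Y * Y)).
Hypothesis DXXX : scal_in (\tr (X * X * X)).
Hypothesis DXXY : scal_in (\tr (X * X * Y)).
Hypothesis DXYY : scal_in (\tr (X * Y * Y)).
Hypothesis DYYY : scal_in (\tr (Y * Y * Y)).

Lemma scal_inD p q : scal_in p -> scal_in q -> scal_in (p + q).
Proof. by rewrite /scal_in raddfD; exact: SD. Qed.
Lemma scal_inN p : scal_in p -> scal_in (- p).
Proof. by rewrite /scal_in raddfN; exact: SN. Qed.
Lemma scal_inB p q : scal_in p -> scal_in q -> scal_in (p - q).
Proof. by move=> hp /scal_inN; exact: scal_inD. Qed.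
Lemma scal_inM p q : scal_in p -> scal_in q -> scal_in (p * q).
Proof. by move=> hp hq; rewrite /scal_in scalar_mxM; exact: SM. Qed.
Lemma scal_in_div n p : scal_in (p *+ n.+1) -> scal_in p.
Proof. by rewrite /scal_in raddfMn; exact: Sdiv. Qed.

Lemma S_wev w : S (wev w).
Proof.
elim: w => [|b w IH]; first by rewrite wev_nil.
by rewrite /wev big_cons; apply: SM => //; case: b.
Qed.

Ltac sclose := repeat match goal with
  | |- S (_ + _) => apply: SD | |- S (- _) => apply: SN | |- S (_ * _) => apply: SM
  | |- S (?p%:M) => change (scal_in p)
  | |- scal_in (_ + _) => apply: scal_inD | |- scal_in (- _) => apply: scal_inN | |- scal_in (_ * _) => apply: scal_inM
  | _ => assumption end.

(** Solving the polarized identity for its scalar term. *)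
Lemma scal_in_polarized A B C : S A -> S B -> S C -> scal_in (\tr A) -> scal_in (\tr B) -> scal_in (\tr C) ->
  scal_in (\tr (A * B)) -> scal_in (\tr (A * C)) -> scal_in (\tr (B * C)) -> scal_in (\tr (A * B * C) + \tr (A * C * B)).
Proof.
move=> sA sB sC dA dB dC dAB dAC dBC.
set p := (X in scal_in X).
pose q := \tr A * \tr B * \tr C - \tr A * \tr (B * C) - \tr B * \tr (A * C) - \tr C * \tr (A * B).
suff : scal_in (q + p).
  move=> h; have -> : p = (q + p) - q by ring.
  by apply: scal_inB => //; rewrite /q; sclose.
have -> : q + p = q + \tr (A * B * C) + \tr (A * C * B) by rewrite /p addrA.
have solve_last (L M N : 'M[R]_3) : L = M + N -> N = L - M by move->; rewrite [M + N]addrC addrK.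
have := cayley_hamilton3 A B C; rewrite -/q mulr1 => /solve_last; rewrite /scal_in => ->.
sclose.
Qed.

Section Step.
Variable n : nat.
Hypothesis IH : forall w, (size w < n)%N -> scal_in (wtr w).

(** Modulo products of traces of shorter words, the sum of the traces of the six
    rearrangements of a, b, c after u is zero. *)
Lemma scal_in_step (u a b c : seq bool) : size (u ++ a ++ b ++ c) = n ->
  u != [::] -> a != [::] -> b != [::] -> c != [::] ->
  scal_in (wtr (u ++ a ++ b ++ c) + wtr (u ++ a ++ c ++ b) + wtr (u ++ b ++ a ++ c)
  + wtr (u ++ b ++ c ++ a) + wtr (u ++ c ++ a ++ b) + wtr (u ++ c ++ b ++ a)).
Proof.
have pos (s : seq bool) : s != [::] -> (0 < size s)%N by case: s.
rewrite !size_cat => hn /pos u0 /pos a0 /pos b0 /pos c0.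
rewrite wtr_polarized; sclose; apply: IH; rewrite ?size_cat; lia.
Qed.

(** With a = b = c, the six rearrangements coincide. When u is empty the identity
    has no factor to be multiplied by, and its scalar term replaces it. *)
Lemma scal_in_cube (u a : seq bool) : size (u ++ a ++ a ++ a) = n -> a != [::] -> scal_in (wtr (u ++ a ++ a ++ a)).
Proof.
move=> hn a0; case: (eqVneq u [::]) => [u0|u0].
  have sa : (0 < size a)%N by case: (a) a0.
  rewrite u0 !size_cat /= in hn *; apply: (@scal_in_div 1); rewrite mulr2n /wtr !wev_cat !mulrA.
  by apply: scal_in_polarized; rewrite -?wev_cat; try exact: S_wev; apply: IH; rewrite ?size_cat; lia.
have := scal_in_step hn u0 a0 a0 a0; set p := wtr _.
have -> : p + p + p + p + p + p = p *+ 6 by ring.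
exact: scal_in_div.
Qed.

Lemma scal_in_xxy (u : seq bool) (x y : bool) : size u = (n - 3)%N -> (3 < n)%N ->
  scal_in (wtr (u ++ [:: x; x; y]) + wtr (u ++ [:: x; y; x]) + wtr (u ++ [:: y; x; x])).
Proof.
move=> hu hn; have u0 : u != [::] by case: (u) hu => //= hu; lia.
have hs : size (u ++ [:: x] ++ [:: x] ++ [:: y]) = n by rewrite size_cat hu /=; lia.
have := scal_in_step hs u0 isT isT isT => /=.
set p1 := wtr _; set p2 := wtr (u ++ [:: x; y; x]); set p3 := wtr (u ++ [:: y; x; x]).
have -> : p1 + p2 + p1 + p2 + p3 + p3 = (p1 + p2 + p3) *+ 2 by ring.
exact: scal_in_div.
Qed.
End Step.

Lemma scal_in_short w : (size w <= 3)%N -> scal_in (wtr w).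
Proof.
have h0 : scal_in (wtr [::]).
  rewrite /wtr wev_nil mxtrace1 (_ : 3%:R = 1 + 1 + 1); last by ring.
  by apply: scal_inD; [apply: scal_inD|]; exact: S1.
have e u : scal_in (wtr u) -> forall m, scal_in (wtr (rot m u)) by move=> h m; rewrite wtr_rot.
case: w => [|a [|b [|c [|//]]]] _ //.
- by rewrite wtr1; case: a.
- have h : scal_in (wtr [:: false; true]) by rewrite wtr2.
  by case: a; case: b; rewrite ?wtr2 //; have := e _ h 1%N; rewrite /= wtr2.
have h : scal_in (wtr [:: false; false; true]) by rewrite wtr3.
have h' : scal_in (wtr [:: false; true; true]) by rewrite wtr3.
by case: a; case: b; case: c; rewrite ?wtr3 //; have := e _ h 1%N; have := e _ h 2%N; have := e _ h' 1%N; have := e _ h' 2%N; rewrite /= !wtr3.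
Qed.

Let x := false. Let y := true.

Let scal_in_sub p q : scal_in (p + q) -> scal_in q -> scal_in p.
Proof. by move=> h1 h2; rewrite -[p](addrK q); apply: scal_inB. Qed.

(** Induction on the length, and on the lexicographic order for each length.
    Cyclically, a trace of a word with a factor XXX or YYY is a combination of
    products of shorter ones, and a factor YXX or YYX can be pushed to smaller
    words. A normal word that remains contains the cube of YX, is cyclically
    one with the cube of X, Y or XY, or has length at most 6; those of length 4, 5
    and 6 need one more relation each. *)
Lemma scal_in_words w : scal_in (wtr w).
Proof.
have [n] := ubnP (size w); elim: n w => // n IHn w; rewrite ltnS leq_eqVlt => /orP[/eqP hw|]; last exact: IHn.
case: (leqP n 3) => hn; first by apply: scal_in_short; rewrite hw.
have IH : forall w, (size w < n)%N -> scal_in (wtr w) by exact: IHn.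
have xyz (u : seq bool) (a b : bool) : size u = (n - 3)%N ->
   scal_in (wtr (u ++ [:: a; a; b]) + wtr (u ++ [:: a; b; a]) + wtr (u ++ [:: b; a; a])).
  by move=> hu; exact: (scal_in_xxy IH a b hu hn).
have cube (u a : seq bool) : size (u ++ a ++ a ++ a) = n -> a != [::] -> scal_in (wtr (u ++ a ++ a ++ a)).
  exact: scal_in_cube.
have cube1 (u : seq bool) (a : bool) : size u = (n - 3)%N -> scal_in (wtr (u ++ [:: a; a; a])).
  by move=> hu; apply: (cube u [:: a]); rewrite // size_cat hu /=; lia.
apply: (word_reduction (P := fun w => scal_in (wtr w)) _ _ _ _ _ hw) => {w hw}.
- by move=> u v hs; rewrite catA wtrC catA; apply: cube1; move: hs; rewrite !size_cat /=; lia.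
- by move=> u v hs; rewrite catA wtrC catA; apply: cube1; move: hs; rewrite !size_cat /=; lia.
- move=> u v hs h1 h2; rewrite catA wtrC catA.
  have := @xyz (v ++ u) x y; rewrite -!catA => h.
  have {h} := h _; rewrite addrC => h; apply: (scal_in_sub (h _)).
    by move: hs; rewrite !size_cat /=; lia.
  by apply: scal_inD; rewrite -wtrC -catA.
- move=> u v hs h1 h2; rewrite catA wtrC catA.
  have := @xyz (v ++ u) y x; rewrite -!catA => h.
  have {h} := h _; rewrite -addrA => h; apply: (scal_in_sub (h _)).
    by move: hs; rewrite !size_cat /=; lia.
  by apply: scal_inD; rewrite -wtrC -catA.
have rotE m (u v : seq bool) : rot m u = v -> scal_in (wtr v) -> scal_in (wtr u) by move=> <-; rewrite wtr_rot.
have eqrot m (u v : seq bool) : rot m u = v -> wtr u = wtr v by move=> <-; rewrite wtr_rot.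
have twice p : scal_in (p + p) -> scal_in p by rewrite -mulr2n; apply: scal_in_div.
have case4 : n = 4%N -> scal_in (wtr [:: x; x; y; y]) /\ scal_in (wtr [:: x; y; x; y]).
  move=> n4; have h1 := xyz [:: y] x y; rewrite n4 in h1; move: {h1}(h1 erefl); rewrite [_ ++ _]/= [X in _ + wtr X]/= [X in _ + wtr X + _]/=.
  rewrite (eqrot 1%N [:: y; x; x; y] [:: x; x; y; y]) // (eqrot 1%N [:: y; x; y; x] [:: x; y; x; y]) //.
  rewrite (eqrot 2%N [:: y; y; x; x] [:: x; x; y; y]) //.
  (* A second relation, from the matrices X, Y, XY. *)
  have : scal_in (wtr [:: x; y; x; y] + wtr [:: x; x; y; y]).
    have w2 : wev [:: x; y] = X * Y by rewrite /wev !big_cons big_nil mulr1.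
    have := @scal_in_polarized X Y (wev [:: x; y]) SX SY (S_wev _).
    have -> : \tr (X * Y * wev [:: x; y]) = wtr [:: x; y; x; y].
      by rewrite -w2 -wev_cat.
    have -> : \tr (X * wev [:: x; y] * Y) = wtr [:: x; x; y; y].
      by rewrite /wtr /wev !big_cons big_nil !mulr1 !mulrA.
    apply => //.
    - by apply: IH; rewrite n4.
    - by have -> : X * wev [:: x; y] = wev [:: x; x; y]; [rewrite /wev !big_cons|apply: IH; rewrite n4].
    - by have -> : Y * wev [:: x; y] = wev [:: y; x; y]; [rewrite /wev !big_cons|apply: IH; rewrite n4].
  move: (wtr [:: x; x; y; y]) (wtr _) => p q h1 h2.
  have hp : scal_in p by apply: (@scal_in_sub _ (q + p)) => //; rewrite (_ : p + (q + p) = p + q + p) // addrA.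
  by split => //; exact: scal_in_sub h1 hp.
have case6 : n = 6%N -> scal_in (wtr [:: x; x; y; x; y; y]).
  move=> n6; have h1 := xyz [:: y; y; x] x y; rewrite n6 in h1; move: {h1}(h1 erefl).
  rewrite [_ ++ _]/= [X in _ + wtr X]/= [X in _ + wtr X + _]/=.
  rewrite (eqrot 5%N [:: y; y; x; x; x; y] [:: y; y; y; x; x; x]) //.
  rewrite (eqrot 2%N [:: y; y; x; x; y; x] [:: x; x; y; x; y; y]) //.
  rewrite (eqrot 4%N [:: y; y; x; y; x; x] [:: x; x; y; y; x; y]) // => h1.
  have {h1} hpq : scal_in (wtr [:: x; x; y; x; y; y] + wtr [:: x; x; y; y; x; y]).
    move: h1; rewrite -addrA [X in scal_in X]addrC => /scal_in_sub; apply.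
    by apply: (cube1 [:: y; y; y] x); rewrite n6.
  (* The relations so far give the sum of the traces of XXYXYY and XXYYXY; the
     cube of the commutator XY - YX gives their difference. *)
  pose U := wev [:: x; y]; pose V := wev [:: y; x].
  have sUV : S (U - V) by apply: SD; [exact: S_wev|apply: SN; exact: S_wev].
  have tUV : \tr (U - V) = 0.
    by rewrite raddfB /= -!/(wtr _) (eqrot 1%N [:: x; y] [:: y; x]) // subrr.
  have D0 : scal_in 0 by rewrite -(subrr (\tr X)); exact: scal_inB.
  have w4 : wtr [:: x; y; y; x] = wtr [:: x; x; y; y] by rewrite (eqrot 3%N [:: x; y; y; x] [:: x; x; y; y]).
  have := @scal_in_polarized (U - V) (U - V) (U - V) sUV sUV sUV; rewrite tUV.
  have -> : \tr ((U - V) * (U - V)) = wtr [:: x; y; x; y] - wtr [:: x; y; y; x] - wtr [:: y; x; x; y] + wtr [:: y; x; y; x].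
    by rewrite !(mulrBl, mulrBr) -!wev_cat !(raddfB, raddfD) /= /wtr; ring.
  have -> : \tr ((U - V) * (U - V) * (U - V)) = 3%:R * (wtr [:: x; x; y; y; x; y] - wtr [:: x; x; y; x; y; y]).
    rewrite !(mulrBl, mulrBr) -!wev_cat !(raddfB, raddfD) /= -!/(wtr _).
    rewrite (eqrot 1%N [:: y; x; y; x; y; x] [:: x; y; x; y; x; y]) //.
    rewrite (eqrot 5%N [:: x; y; x; y; y; x] [:: x; x; y; x; y; y]) //.
    rewrite (eqrot 1%N [:: y; x; x; y; x; y] [:: x; x; y; x; y; y]) //.
    rewrite (eqrot 3%N [:: x; y; y; x; x; y] [:: x; x; y; x; y; y]) //.
    rewrite (eqrot 1%N [:: y; x; x; y; y; x] [:: x; x; y; y; x; y]) //.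
    rewrite (eqrot 5%N [:: x; y; y; x; y; x] [:: x; x; y; y; x; y]) //.
    rewrite (eqrot 3%N [:: y; x; y; x; x; y] [:: x; x; y; y; x; y]) //.
    ring.
  move: hpq; move: (wtr [:: x; x; y; x; y; y]) (wtr [:: x; x; y; y; x; y]) => q p hpq h.
  have d2 : scal_in (wtr [:: x; y; x; y] - wtr [:: x; y; y; x] - wtr [:: y; x; x; y] + wtr [:: y; x; y; x]).
    by sclose; apply: IH; rewrite n6.
  have {h} := h D0 D0 D0 d2 d2 d2; rewrite (_ : _ + _ = (p - q) *+ 6); last by ring.
  move=> /scal_in_div h; apply: twice.
  by rewrite (_ : q + q = (q + p) - (p - q)); [exact: scal_inB|ring].
move=> i k j hi hj hs.
have [p3|k2] : (3 <= k)%N \/ (k <= 2)%N by lia.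
  case: k p3 hs => [|[|[|k]]] // _; rewrite /std_word => hs.
  have e : nseq i false ++ flatten (nseq k.+3 [:: true; false]) ++ nseq j true =
    nseq i false ++ ([:: true; false] ++ [:: true; false] ++ [:: true; false]) ++ (flatten (nseq k [:: true; false]) ++ nseq j true) by [].
  rewrite e wtrC -catA wtrC; apply: cube => //.
  by rewrite -hs e !size_cat; lia.
have low m (u v : seq bool) (a : bool) : rot m u = v ++ [:: a; a; a] -> size u = n -> scal_in (wtr u).
  move=> e hu; apply: (rotE m _ _ e); apply: cube1.
  by move: (congr1 size e); rewrite size_rot size_cat hu /=; lia.
have cub m (u v : seq bool) : rot m u = v ++ [:: x; y] ++ [:: x; y] ++ [:: x; y] -> size u = n -> scal_in (wtr u).
  by move=> e hu; apply: (rotE m _ _ e); apply: cube => //; rewrite -e size_rot.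
have case5 a b : n = 5 -> scal_in (wtr [:: a; a; b; a; b]).
  move=> n5; have h1 := xyz [:: a; b] a b; rewrite n5 in h1; move: {h1}(h1 erefl).
  rewrite [_ ++ _]/= [X in _ + wtr X]/= [X in _ + wtr X + _]/=.
  rewrite (eqrot 2%N [:: a; b; a; a; b] [:: a; a; b; a; b]) // (eqrot 4%N [:: a; b; a; b; a] [:: a; a; b; a; b]) //.
  by move=> /scal_in_sub h; apply: twice; apply: h; apply: (low 1%N _ [:: b; b] a).
move: hs; case: k k2 => [|[|[|//]]] _; case: i hi => [|[|[|//]]] _; case: j hj => [|[|[|//]]] _;
  rewrite /std_word /= => hs; try (by exfalso; move: hn; rewrite -hs).
all: rewrite -/x -/y.
- by have [] := case4 (esym hs).
- by apply: (low 1%N _ [:: x] y).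
- by have [] := case4 (esym hs).
- by apply: (rotE 3%N _ [:: y; y; x; y; x]) => //; apply: case5.
- by apply: (low 2%N _ [:: y] x).
- exact: case5.
- exact: case6.
- by apply: (rotE 1%N _ [:: x; y; x; y]) => //; have [] := case4 (esym hs).
- by apply: (rotE 4%N _ [:: y; y; x; y; x]) => //; apply: case5.
- by apply: (low 1%N _ [:: x; y; x] y).
- by apply: (rotE 4%N _ [:: x; x; y; x; y]) => //; apply: case5.
- by apply: (cub 0%N _ [::]).
- by apply: (cub 6%N _ [:: y]).
- by apply: (low 2%N _ [:: y; x; y] x).
- by apply: (cub 0%N _ [:: x]).
by apply: (cub 7%N _ [:: y; x]).
Qed.
End Words.

(** * Words over the ring generated by nine traces *)

Section Span.
Variables (R : comNzRingType) (X Y : 'M[R]_3) (L : 'M[R]_3 -> Prop).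
Hypothesis LD : forall A B, L A -> L B -> L (A + B).
Hypothesis LN : forall A, L A -> L (- A).
Hypothesis Ldiv : forall A n, L (A *+ n.+1) -> L A.

Definition multiplier (M : 'M[R]_3) : Prop := forall A, L A -> L (M * A).
Definition coefficient (p : R) : Prop := multiplier p%:M.

Hypothesis cX : coefficient (\tr X).
Hypothesis cY : coefficient (\tr Y).
Hypothesis cXX : coefficient (\tr (X * X)).
Hypothesis cXY : coefficient (\tr (X * Y)).
Hypothesis cYY : coefficient (\tr (Y * Y)).
Hypothesis cXXX : coefficient (\tr (X * X * X)).
Hypothesis cXXY : coefficient (\tr (X * X * Y)).
Hypothesis cXYY : coefficient (\tr (X * Y * Y)).
Hypothesis cYYY : coefficient (\tr (Y * Y * Y)).

Let wx := wev X Y.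
Let tx := wtr X Y.

Let m1 : multiplier 1. Proof. by move=> A; rewrite mul1r. Qed.
Let mD A B : multiplier A -> multiplier B -> multiplier (A + B).
Proof. by move=> hA hB C hC; rewrite mulrDl; apply: LD; auto. Qed.
Let mN A : multiplier A -> multiplier (- A).
Proof. by move=> hA C hC; rewrite mulNr; apply: LN; auto. Qed.
Let mM A B : multiplier A -> multiplier B -> multiplier (A * B).
Proof. by move=> hA hB C hC; rewrite -mulrA; auto. Qed.

Lemma short_coefficient w : (size w <= 3)%N -> coefficient (tx w).
Proof. by move=> hw; apply: (scal_in_short (S := multiplier)). Qed.

Let cD p q : coefficient p -> coefficient q -> coefficient (p + q).
Proof. exact: (scal_inD (S := multiplier)). Qed.
Let cN p : coefficient p -> coefficient (- p).
Proof. exact: (scal_inN (S := multiplier)). Qed.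
Let cM p q : coefficient p -> coefficient q -> coefficient (p * q).
Proof. exact: (scal_inM (S := multiplier)). Qed.

Lemma sandwich_scal (p : R) (U A V : 'M[R]_3) : U * (p%:M * A) * V = p%:M * (U * A * V).
Proof.
by rewrite mulrA (_ : U * p%:M = p%:M * U) -?mulrA //; exact: scalar_mxC.
Qed.

(** Between two words, the polarized identity expresses the sum of the six
    rearrangements of three letters by shorter words with coefficients in the
    ring of traces. *)
Lemma polarized_words (n : nat) (u v : seq bool) (a b c : bool) :
  (forall w, (size w < n)%N -> L (wx w)) -> size (u ++ [:: a; b; c] ++ v) = n ->
  L (wx (u ++ [:: a; b; c] ++ v) + wx (u ++ [:: a; c; b] ++ v) + wx (u ++ [:: b; a; c] ++ v)
   + wx (u ++ [:: b; c; a] ++ v) + wx (u ++ [:: c; a; b] ++ v) + wx (u ++ [:: c; b; a] ++ v)).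
Proof.
move=> IH hn.
have e (s : seq bool) : wx (u ++ s ++ v) = wx u * wx s * wx v.
  by rewrite /wx !wev_cat mulrA.
have e1 x : wx [:: x] = if x then Y else X by rewrite /wx /wev big_cons big_nil mulr1.
have e2 x y : wx [:: x; y] = wx [:: x] * wx [:: y] by rewrite /wx -wev_cat.
have e3 x y z : wx [:: x; y; z] = wx [:: x] * wx [:: y] * wx [:: z] by rewrite /wx -!wev_cat.
have t1 x : \tr (wx [:: x]) = tx [:: x] by [].
have t2 x y : \tr (wx [:: x] * wx [:: y]) = tx [:: x; y] by rewrite -e2.
have t3 x y z : \tr (wx [:: x] * wx [:: y] * wx [:: z]) = tx [:: x; y; z] by rewrite -e3.
have sh (s : seq bool) : (size s < 3)%N -> L (wx u * wx s * wx v).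
  move=> hs; rewrite -e; apply: IH; move: hn; rewrite !size_cat /=; lia.
have := congr1 (fun M => wx u * M * wx v) (cayley_hamilton3 (wx [:: a]) (wx [:: b]) (wx [:: c])).
rewrite /= -!e3 -!e2 !(mulrDr, mulrDl, mulrN, mulNr) !sandwich_scal -!e => ->.
have sc (s : seq bool) : (size s <= 3)%N -> coefficient (\tr (wx s)) by exact: short_coefficient.
have cL p A : coefficient p -> L A -> L (p%:M * A) by move=> h; exact: h.
have hu : (size u + size v + 3)%N = n by rewrite -hn !size_cat /=; lia.
repeat match goal with
  | |- L (_ + _) => apply: LD | |- L (- _) => apply: LN | |- L (_%:M * _) => apply: cL
  | |- coefficient (_ + _) => apply: cD | |- coefficient (- _) => apply: cN
  | |- coefficient (_ * _) => apply: cM | |- coefficient _ => exact: sc end.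
all: rewrite ?mulr1 /wx -?wev_cat; apply: IH; rewrite !size_cat /=; lia.
Qed.

Hypothesis Lstd : forall i k j, (i <= 2)%N -> (j <= 2)%N -> L (wx (std_word i k j)).

(** The same reduction as for traces, now without cyclic permutations: the words
    that cannot be reduced are the normal ones. *)
Lemma words_in_span w : L (wx w).
Proof.
have [n] := ubnP (size w); elim: n w => // n IHn w; rewrite ltnS leq_eqVlt => /orP[/eqP hw|]; last exact: IHn.
have IH : forall w, (size w < n)%N -> L (wx w) by exact: IHn.
have cube u v (a : bool) : size (u ++ [:: a; a; a] ++ v) = n -> L (wx (u ++ [:: a; a; a] ++ v)).
  move=> hs; have := polarized_words IH hs; set p := wx _.
  by rewrite (_ : p + p + p + p + p + p = p *+ 6); [exact: Ldiv|rewrite !mulrS mulr0n !addrA addr0].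
have two u v (a b : bool) : size (u ++ [:: a; a; b] ++ v) = n ->
   L (wx (u ++ [:: a; a; b] ++ v) + wx (u ++ [:: a; b; a] ++ v) + wx (u ++ [:: b; a; a] ++ v)).
  move=> hs; have := polarized_words IH hs; set p := wx _.
  set q := wx (u ++ [:: a; b; a] ++ v); set r := wx (u ++ [:: b; a; a] ++ v).
  rewrite (_ : p + q + p + q + r + r = (p + q + r) *+ 2); first exact: Ldiv.
  by rewrite mulr2n [RHS]addrACA !addrA.
have Lsub A B C : L (A + B + C) -> L A -> L B -> L C.
  by move=> h hA hB; rewrite -[C](addKr (A + B)) addrC; apply: LD => //; apply: LN; exact: LD.
apply: (word_reduction (P := fun w => L (wx w)) _ _ _ _ _ hw) => {w hw}.
- by move=> u v; exact: cube.
- by move=> u v; exact: cube.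
- move=> u v hs h1 h2; apply: (Lsub _ _ _ (two u v false true _)) => //.
  by rewrite -hs !size_cat.
- move=> u v hs h1 h2; apply: (Lsub (wx (u ++ [:: true; false; true] ++ v)) (wx (u ++ [:: false; true; true] ++ v))) => //.
  by have := two u v true false hs; rewrite -addrA addrC.
by move=> i k j hi hj _; exact: Lstd.
Qed.
End Span.

(** * Counting solutions of linear systems *)

Section Counting.
Import Order.TTheory Num.Theory.

(** The exponents s with sum over i of s_i ws_i = (a, b). The search range for
    each exponent is finite because a nonzero weight makes it at most a + b. *)
Fixpoint sols (ws : seq (nat * nat)) (a b : nat) : seq (seq nat) :=
  if ws is w :: ws' then
    [seq t :: s | t <- [seq t <- iota 0 (a + b).+1 | (t * w.1 <= a)%N && (t * w.2 <= b)%N],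
                  s <- sols ws' (a - t * w.1) (b - t * w.2)]
  else if (a == 0%N) && (b == 0%N) then [:: [::]] else [::].

Definition weight (ws : seq (nat * nat)) (s : seq nat) : nat * nat :=
  (sumn [seq p.1.1 * p.2 | p <- zip ws s]%N, sumn [seq p.1.2 * p.2 | p <- zip ws s]%N).

Lemma sols_cons w ws a b : sols (w :: ws) a b =
  [seq t :: s | t <- [seq t <- iota 0 (a + b).+1 | (t * w.1 <= a)%N && (t * w.2 <= b)%N],
                s <- sols ws (a - t * w.1) (b - t * w.2)].
Proof. by []. Qed.

Lemma mem_sols ws a b s : all (fun w => 0 < w.1 + w.2)%N ws ->
  (s \in sols ws a b) = (size s == size ws) && (weight ws s == (a, b)).
Proof.
elim: ws a b s => [|w ws IH] a b s.
  move=> _; case: s => [|x s]; rewrite /weight /=.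
    by rewrite xpair_eqE eq_sym (eq_sym 0%N b); case: ifP => //; rewrite inE.
  by case: ifP => //; rewrite inE.
case/andP=> w0 hws; rewrite sols_cons; apply/allpairsPdep/idP.
  case=> t [s' [ht hs ->]]; move: ht; rewrite mem_filter => /andP[/andP[h1 h2] _].
  move: hs; rewrite IH // => /andP[/eqP hsz]; rewrite /weight /= hsz xpair_eqE => /andP[/eqP e1 /eqP e2].
  rewrite eqxx xpair_eqE /= e1 e2; apply/andP; split; apply/eqP; lia.
case: s => [//|t s] /andP[/eqP[hsz]]; rewrite /weight => /eqP[e1 e2]; rewrite /= in e1 e2.
exists t, s; split => //.
  rewrite mem_filter mem_iota; apply/andP; split; first by apply/andP; split; lia.
  by rewrite leq0n add0n ltnS; nia.
by rewrite IH // hsz eqxx /weight xpair_eqE /=; apply/andP; split; apply/eqP; lia.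
Qed.

Lemma sols_uniq ws a b : uniq (sols ws a b).
Proof.
elim: ws a b => [|w ws IH] a b; first by rewrite /=; case: ifP.
rewrite sols_cons; apply: allpairs_uniq_dep.
- exact: (filter_uniq _ (iota_uniq _ _)).
- by move=> t _; exact: IH.
by move=> [t s] [t' s'] _ _ /= [-> ->].
Qed.

(** The sum of phi (a - x-degree) over the solutions of y-degree b; the argument
    of phi may be negative, so that quasi-polynomials can be summed too. *)
Fixpoint wsum (ws : seq (nat * nat)) (phi : int -> rat) (a : int) (b : nat) : rat :=
  if ws is (c, d) :: ws' then
    \sum_(t < (b %/ d).+1) wsum ws' phi (a - (t * c)%N%:Z) (b - t * d)
  else if b == 0%N then phi a else 0.

Lemma wsum_rec c d ws phi a b : (0 < d)%N ->
  wsum ((c, d) :: ws) phi a b =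
  wsum ws phi a b + (if (d <= b)%N then wsum ((c, d) :: ws) phi (a - c%:Z) (b - d) else 0).
Proof.
move=> d0; rewrite /= big_ord_recl mul0n subr0 mul0n subn0; congr (_ + _).
case: leqP => h; last by rewrite divn_small // big_ord0.
have -> : (b %/ d = ((b - d) %/ d).+1)%N by rewrite -[in LHS](subnK h) divnDr // divnn d0 addn1.
by apply: eq_bigr => i _; rewrite /= /bump /= add1n !mulSn; congr wsum; lia.
Qed.

Lemma eq_wsum ws phi psi a b : (forall n, phi n = psi n) -> wsum ws phi a b = wsum ws psi a b.
Proof.
move=> e; elim: ws a b => [|[c d] ws IH] a b /=; first by rewrite e.
by apply: eq_bigr => t _; exact: IH.
Qed.

Lemma wsum_lin ws x phi psi a b :
  wsum ws (fun n => x * phi n + psi n) a b = x * wsum ws phi a b + wsum ws psi a b.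
Proof.
elim: ws a b => [|[c d] ws IH] a b /=; first by case: eqP => //; rewrite mulr0 addr0.
by rewrite mulr_sumr -big_split; apply: eq_bigr => t _; exact: IH.
Qed.

Lemma wsum_shift ws x phi a b : wsum ws phi (x + a) b = wsum ws (fun n => phi (x + n)) a b.
Proof.
elim: ws a b => [|[c d] ws IH] a b //=.
by apply: eq_bigr => t _; rewrite -IH addrA.
Qed.

Lemma wsum_neg ws phi a b : (forall n, n < 0 -> phi n = 0) -> a < 0 -> wsum ws phi a b = 0.
Proof.
move=> h; elim: ws a b => [|[c d] ws IH] a b a0 /=; first by rewrite h // if_same.
by rewrite big1 // => t _; apply: IH; lia.
Qed.

(** Each weight but the last allows at most b + 1 exponents, and the last one at
    most one. *)
Lemma wsum_bound ws phi B : (forall n, `|phi n| <= B) ->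
  all (fun w => 0 < w.2)%N ws -> ws != [::] ->
  forall a b, `|wsum ws phi a b| <= B * (b%:R + 1) ^+ (size ws).-1.
Proof.
move=> hB; have B0 : 0 <= B by apply: le_trans (hB 0).
elim: ws => [//|[c d] ws IH] /= /andP[d0 hws] _ a b.
case: ws IH hws => [|w ws] IH hws.
  rewrite expr0 mulr1 /=.
  case: (boolP (d %| b)%N) => hd.
    have hlt : (b %/ d < (b %/ d).+1)%N by [].
    rewrite (bigD1 (Ordinal hlt)) //= divnK // subnn /= big1 ?addr0 ?hB // => t ht.
    case: eqP => // /eqP; rewrite subn_eq0 => e; case/negP: ht; apply/eqP/val_inj => /=.
    by apply/eqP; rewrite eqn_leq -ltnS ltn_ord /= -(leq_pmul2r d0) divnK.
  rewrite big1 ?normr0 // => t _.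
  case: eqP => // /eqP; rewrite subn_eq0 => e; case/negP: hd.
  have : (t <= b %/ d)%N by rewrite -ltnS.
  rewrite leq_divRL // => e'; apply/dvdnP; exists t; lia.
apply: le_trans (ler_norm_sum _ _ _) _.
apply: (@le_trans _ _ (\sum_(t < (b %/ d).+1) B * (b%:R + 1) ^+ (size ws))).
  apply: ler_sum => t _; apply: le_trans (IH hws isT _ _) _.
  apply: ler_wpM2l => //; apply: lerXn2r; rewrite ?nnegrE ?addr_ge0 // lerD2r ler_nat; lia.
rewrite sumr_const card_ord -[X in X <= _]mulr_natl /= exprS mulrCA; apply: ler_wpM2l => //.
apply: ler_wpM2r; first by rewrite exprn_ge0 // addr_ge0.
by rewrite -natr1 lerD2r ler_nat leq_div.
Qed.

Lemma size_sols_cons w ws a b :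
  (size (sols (w :: ws) a b))%:R =
  \sum_(t < (a + b).+1 | (t * w.1 <= a)%N && (t * w.2 <= b)%N)
     (size (sols ws (a - t * w.1) (b - t * w.2)))%:R :> rat.
Proof.
rewrite sols_cons size_allpairs_dep sumnE big_map big_filter natr_sum.
by rewrite -[iota _ _]/(index_iota 0 (a + b).+1) big_mkord.
Qed.

Definition natfun (f : nat -> rat) (n : int) : rat := if n is Posz k then f k else 0.

Lemma natfun_neg f n : n < 0 -> natfun f n = 0. Proof. by case: n. Qed.

(** The weights of ws account for the whole y-degree, and those of vs for what
    remains of the x-degree. *)
Lemma size_sols_cat ws vs a b : all (fun w => 0 < w.2)%N ws -> all (fun w => (0 < w.1)%N && (w.2 == 0)%N) vs ->
  (size (sols (ws ++ vs) a b))%:R =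
  wsum ws (natfun (fun n => (size (sols vs n 0))%:R)) a%:Z b.
Proof.
move=> + hvs; elim: ws a b => [|[c d] ws IH] a b.
  move=> _; rewrite cat0s /=; case: (eqVneq b 0%N) => [->//|b0].
  case: b b0 => // b _; case E: (sols vs a b.+1) => [//|s l].
  have: s \in sols vs a b.+1 by rewrite E inE eqxx.
  rewrite mem_sols; last by apply: sub_all hvs => w /andP[h1 _] /=; rewrite addn_gt0 h1.
  case/andP=> _; rewrite xpair_eqE => /andP[_]; rewrite /=.
  suff -> : sumn [seq p.1.2 * p.2 | p <- zip vs s]%N = 0%N by [].
  move: s {E}; elim: vs hvs => [|v vs IHv] /=; first by move=> _; case.
  by case/andP=> /andP[_ /eqP v0] hvs [|x s] //=; rewrite v0 IHv.
case/andP=> d0 hws; rewrite cat_cons size_sols_cons /=.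
have d0' : (0 < d)%N := d0.
have hb t : (t < (b %/ d).+1)%N = (t * d <= b)%N by rewrite ltnS leq_divRL.
have hn : ((b %/ d).+1 <= (a + b).+1)%N by rewrite ltnS (leq_trans (leq_div _ _)) // leq_addl.
rewrite (big_ord_widen _ (fun t : nat => wsum ws _ (a%:Z - (t * c)%N%:Z) (b - t * d)) hn) [RHS]big_mkcond [LHS]big_mkcond /=.
apply: eq_bigr => t _; rewrite hb /=.
case: (leqP (t * d) b) => h2; last by rewrite andbF.
rewrite andbT; case: leqP => h1.
  by rewrite IH // -subzn.
rewrite wsum_neg //; first exact: natfun_neg.
by lia.
Qed.

(** The partition function of the parts ws, convolved with f. *)
Fixpoint usum (ws : seq nat) (f : nat -> rat) (n : nat) : rat :=
  if ws is w :: ws' then \sum_(t < (n %/ w).+1) usum ws' f (n - t * w) else f n.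

Lemma usum_rec w ws f n : (0 < w)%N ->
  usum (w :: ws) f n = usum ws f n + (if (w <= n)%N then usum (w :: ws) f (n - w) else 0).
Proof.
move=> w0; rewrite /= big_ord_recl mul0n subn0; congr (_ + _).
case: leqP => h; last by rewrite divn_small // big_ord0.
have -> : (n %/ w = ((n - w) %/ w).+1)%N by rewrite -[in LHS](subnK h) divnDr // divnn w0 addn1.
by apply: eq_bigr => i _; rewrite /= /bump /= add1n mulSn; congr usum; lia.
Qed.

Lemma eq_usum ws f g n : (forall n, f n = g n) -> usum ws f n = usum ws g n.
Proof.
move=> e; elim: ws n => [|w ws IH] n /=; first exact: e.
by apply: eq_bigr => t _; exact: IH.
Qed.

Lemma sols_usum vs n : all (fun w => (0 < w)%N) vs ->
  (size (sols [seq (w, 0%N) | w <- vs] n 0))%:R = usum vs (fun n => (n == 0%N)%:R) n.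
Proof.
elim: vs n => [|w vs IH] n; first by move=> _ /=; case: eqP.
case/andP=> w0 hvs; rewrite map_cons size_sols_cons /=.
have hb t : (t < (n %/ w).+1)%N = (t * w <= n)%N by rewrite ltnS leq_divRL.
have hn : ((n %/ w).+1 <= (n + 0).+1)%N by rewrite ltnS addn0 leq_div.
rewrite (big_ord_widen _ (fun t : nat => usum vs _ (n - t * w)) hn).
by apply: eq_big => t; [rewrite hb muln0 andbT|move=> _; rewrite IH].
Qed.

Definition shift k (f : nat -> rat) n : rat := if (k <= n)%N then f (n - k)%N else 0.

Lemma usum_shift ws k f n : all (fun w => 0 < w)%N ws ->
  usum ws (shift k f) n = shift k (usum ws f) n.
Proof.
elim: ws n => [|w ws IH] n //= /andP[w0 hws].
under eq_bigr => t _ do rewrite IH //.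
rewrite /shift /=; case: leqP => h; last first.
  by rewrite big1 // => t _; rewrite ifN //; lia.
have hn : (((n - k) %/ w).+1 <= (n %/ w).+1)%N by rewrite ltnS leq_div2r // leq_subr.
rewrite (big_ord_widen _ (fun t : nat => usum ws f (n - k - t * w)) hn) [RHS]big_mkcond /=.
apply: eq_bigr => t _; have := ltn_ord t; rewrite !ltnS !leq_divRL // => ht.
case: leqP => h1; case: leqP => h2 //; try lia.
by congr usum; lia.
Qed.

Lemma usum_lin ws x f g n : usum ws (fun n => f n + x * g n) n = usum ws f n + x * usum ws g n.
Proof.
elim: ws n => [|w ws IH] n //=.
by rewrite mulr_sumr -big_split; apply: eq_bigr => t _; exact: IH.
Qed.

(** * Growth of partition functions *)

(** f b = x b^n / n! + O(b^(n-1)). The factor n makes this an equality for n = 0,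
    so that summing a constant sequence is covered by the same induction as
    the higher degrees. *)
Definition asymp (n : nat) (x : rat) (f : nat -> rat) : Prop :=
  exists K : rat, forall b : nat,
    `|f b - x * b%:R ^+ n / n`!%:R| <= K * n%:R * (b%:R + 1) ^+ n.-1.

(** q n is the second-order remainder of the Taylor expansion of b^(n+1) at step
    d; it satisfies q (n+1) = (b - d) q n + d^2 (n+1) b^n. *)
Lemma power_step (d b : nat) (q : nat -> rat) : (d <= b)%N ->
  (forall n, q n = d%:R * n.+1%:R * b%:R ^+ n - (b%:R ^+ n.+1 - (b%:R - d%:R) ^+ n.+1)) ->
  forall n, 0 <= q n <= d%:R ^+ 2 * (n * n.+1)%N%:R / 2 * b%:R ^+ n.-1.
Proof.
move=> hd qE; elim=> [|n /andP[h1 h2]].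
  by rewrite !qE !expr0 !expr1 mul0n; apply/andP; split; lra.
have hx : 0 <= (b%:R - d%:R : rat) by rewrite subr_ge0 ler_nat.
have -> : q n.+1 = (b%:R - d%:R) * q n + d%:R ^+ 2 * n.+1%:R * b%:R ^+ n.
  by rewrite !qE -[n.+2%:R]natr1 -[n.+1%:R]natr1 !exprS; ring.
apply/andP; split.
  by rewrite addr_ge0 // !mulr_ge0 // exprn_ge0.
have h3 : (b%:R - d%:R) * q n <= d%:R ^+ 2 * (n * n.+1)%N%:R / 2 * b%:R ^+ n.
  apply: (le_trans (y := b%:R * q n)); first by apply: ler_wpM2r => //; rewrite gerBl.
  apply: le_trans (ler_wpM2l (ler0n _ b) h2) _.
  case: (n) => [|k]; first by rewrite mul0n mulr0n !(mulr0, mul0r).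
  by rewrite mulrCA -exprS.
apply: le_trans (lerD h3 (lexx _)) _.
rewrite -mulrDl /=; apply: ler_wpM2r; first by rewrite exprn_ge0.
rewrite !natrM -[n.+2%:R]natr1 -[n.+1%:R]natr1; lra.
Qed.

(** Summation of a sequence with step d multiplies the leading term as
    integration against the density 1/d does. *)
Lemma asymp_sum (n : nat) (x : rat) (d : nat) (f g : nat -> rat) : (0 < d)%N ->
  asymp n x f -> (forall b, g b = f b + (if (d <= b)%N then g (b - d)%N else 0)) ->
  asymp n.+1 (x / d%:R) g.
Proof.
move=> d0 [K hK] hg.
pose e b := g b - x / d%:R * b%:R ^+ n.+1 / (n.+1)`!%:R.
pose C1 := \sum_(b < d) `|e b|.
pose C2 := `|K| * n%:R + `|x| * d%:R * n%:R.
have C10 : 0 <= C1 by apply: sumr_ge0 => *; exact: normr_ge0.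
have C20 : 0 <= C2 by rewrite addr_ge0 // !mulr_ge0.
have dn0 : (d%:R : rat) != 0 by rewrite pnatr_eq0 -lt0n.
have fn0 k : (k`!%:R : rat) != 0 by rewrite pnatr_eq0 -lt0n fact_gt0.
have stepe b : (d <= b)%N -> `|e b| <= `|e (b - d)%N| + C2 * (b%:R + 1) ^+ n.-1.
  move=> hb; have := power_step hb (fun=> erefl) n.
  set q := _ - (_ - _) => /andP[q0 q1].
  have -> : e b = e (b - d)%N + (f b - x * b%:R ^+ n / n`!%:R) + x / d%:R * q / (n.+1)`!%:R.
    rewrite /e hg hb /q natrB // factS natrM.
    have n1 : (n.+1%:R : rat) != 0 by rewrite pnatr_eq0.
    by field; rewrite dn0 fn0 nat1r n1.
  rewrite -addrA; apply: le_trans (ler_normD _ _) _; rewrite lerD2l.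
  apply: le_trans (ler_normD _ _) _.
  have hb1 : 0 <= (b%:R + 1 : rat) ^+ n.-1 by rewrite exprn_ge0 // addr_ge0.
  rewrite /C2 mulrDl; apply: lerD.
    by apply: le_trans (hK b) _; rewrite ler_wpM2r // ler_wpM2r // ler_norm.
  rewrite !normrM !normfV !normr_nat (ger0_norm q0).
  have hq : q <= d%:R ^+ 2 * (n * n.+1)%N%:R / 2 * (b%:R + 1) ^+ n.-1.
    apply: le_trans q1 _; rewrite ler_wpM2l ?mulr_ge0 ?exprn_ge0 //.
    by rewrite lerXn2r ?nnegrE ?addr_ge0 // lerDl.
  have hxd : 0 <= `|x| / d%:R by rewrite divr_ge0.
  apply: (le_trans (y := `|x| / d%:R * (d%:R ^+ 2 * (n * n.+1)%N%:R / 2 * (b%:R + 1) ^+ n.-1) / (n.+1)`!%:R)).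
    by rewrite ler_wpM2r ?invr_ge0 // ler_wpM2l.
  have -> : `|x| / d%:R * (d%:R ^+ 2 * (n * n.+1)%N%:R / 2 * (b%:R + 1) ^+ n.-1) / (n.+1)`!%:R
     = `|x| * d%:R * n%:R * (b%:R + 1) ^+ n.-1 / (2 * n`!%:R).
    rewrite factS !natrM; have n1 : (n.+1%:R : rat) != 0 by rewrite pnatr_eq0.
    by field; rewrite dn0 fn0 nat1r n1.
  have h1 : 0 <= `|x| * d%:R * n%:R * (b%:R + 1) ^+ n.-1 by rewrite !mulr_ge0.
  rewrite ler_pdivrMr; last by rewrite mulr_gt0 // ltr0n fact_gt0.
  rewrite ler_peMr // -natrM ler1n muln_gt0 /= fact_gt0 //.
exists (C1 + C2); elim/ltn_ind => b IH; rewrite -/(e b) /=.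
have hb0 : 1 <= (b%:R + 1 : rat) by rewrite lerDr.
case: (ltnP b d) => hb.
  apply: (le_trans (y := C1)).
    rewrite /C1 (bigD1 (Ordinal hb)) //= lerDl; apply: sumr_ge0 => *; exact: normr_ge0.
  apply: (le_trans (y := (C1 + C2) * 1 * 1)); first by rewrite !mulr1 lerDl.
  apply: ler_pM => //; first by rewrite mulr1 addr_ge0.
    by apply: ler_wpM2l; [rewrite addr_ge0|rewrite ler1n].
  by rewrite exprn_ege1.
apply: le_trans (stepe b hb) _.
have hlt : (b - d < b)%N by lia.
have hK0 : 0 <= (C1 + C2) * n.+1%:R by rewrite mulr_ge0 // addr_ge0.
apply: le_trans (lerD (IH _ hlt) (lexx _)) _.
have hd1 : (b - d)%:R + 1 <= b%:R :> rat by rewrite natr1 ler_nat; lia.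
have hbd0 : 0 <= (b - d)%:R + 1 :> rat by rewrite addr_ge0.
have C2le : C2 <= C1 + C2 by rewrite lerDr.
have C12 : 0 <= C1 + C2 by rewrite addr_ge0.
have hC2 : n = 0%N -> C2 = 0 by rewrite /C2 => ->; rewrite !mulr0 addr0.
set C := C1 + C2 in C2le C12 hK0 *; clearbody C; clearbody C2 => {C1 C10 stepe IH e}.
case: n hK fn0 hC2 hK0 => [|n] hK fn0 hC2 C0.
  by rewrite hC2 //= !expr0 mul0r addr0.
apply: (le_trans (y := C * n.+2%:R * ((b%:R) * (b%:R + 1) ^+ n) + C * n.+2%:R * (b%:R + 1) ^+ n)).
  apply: lerD.
    apply: ler_wpM2l => //; rewrite [n.+2.-1]/= exprS; apply: ler_pM => //; first exact: exprn_ge0.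
    by apply: lerXn2r; rewrite ?nnegrE ?addr_ge0 //; lra.
  apply: ler_wpM2r; first by rewrite exprn_ge0 // addr_ge0.
  by apply: le_trans C2le _; apply: ler_peMr => //; rewrite ler1n.
by rewrite -mulrDr exprS -[X in b%:R * _ + X]mul1r -mulrDl.
Qed.

Lemma asymp_lin n x y z f g : asymp n x f -> asymp n y g ->
  asymp n (x + z * y) (fun b => f b + z * g b).
Proof.
move=> [K hK] [L hL]; exists (K + `|z| * L) => b.
have -> : f b + z * g b - (x + z * y) * b%:R ^+ n / n`!%:R =
  (f b - x * b%:R ^+ n / n`!%:R) + z * (g b - y * b%:R ^+ n / n`!%:R) by ring.
apply: le_trans (ler_normD _ _) _; rewrite normrM !mulrDl -!mulrA; apply: lerD.
  by rewrite !mulrA.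
by rewrite ler_wpM2l // !mulrA.
Qed.

Lemma asymp_lower n x f : asymp n x f -> asymp n.+1 0 f.
Proof.
move=> [K hK]; exists (`|K| * n%:R + `|x|) => b.
rewrite mul0r mul0r subr0.
have -> : f b = (f b - x * b%:R ^+ n / n`!%:R) + x * b%:R ^+ n / n`!%:R by ring.
apply: le_trans (ler_normD _ _) _ => /=.
have h1 : 1 <= (b%:R + 1 : rat) by rewrite lerDr.
have hp k : 1 <= (b%:R + 1 : rat) ^+ k by rewrite exprn_ege1.
have hA : 0 <= (`|K| * n%:R + `|x|) by rewrite addr_ge0 // mulr_ge0.
apply: (le_trans (y := (`|K| * n%:R + `|x|) * (b%:R + 1) ^+ n)); last first.
  rewrite -mulrA ler_wpM2l // ler_peMl ?ler1n //.
  exact: le_trans (hp n).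
rewrite mulrDl; apply: lerD.
  apply: le_trans (hK b) _; apply: (le_trans (y := `|K| * n%:R * (b%:R + 1) ^+ n.-1)).
    apply: ler_wpM2r; first by apply: le_trans (hp _).
    by rewrite ler_wpM2r // ler_norm.
  rewrite ler_wpM2l ?mulr_ge0 //; case: n {hK hA} => [|n] //=.
  by rewrite exprS ler_peMl // (le_trans ler01).
rewrite !normrM -mulrA ler_wpM2l // normrX normr_nat normfV normr_nat.
apply: (le_trans (y := b%:R ^+ n)).
  by rewrite ler_pdivrMr ?ltr0n ?fact_gt0 // ler_peMr ?exprn_ge0 // ler1n fact_gt0.
by rewrite lerXn2r ?nnegrE ?addr_ge0 // lerDl.
Qed.

(** A shift of the argument changes b^n by O(b^(n-1)) only, by the remainder
    estimate of [power_step]. *)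
Lemma asymp_shift k n x f : asymp n.+1 x f -> asymp n.+1 x (shift k f).
Proof.
move=> [K hK].
pose C := \sum_(b < k) `|x * b%:R ^+ n.+1 / (n.+1)`!%:R|.
have C0 : 0 <= C by apply: sumr_ge0 => *; exact: normr_ge0.
exists (`|K| + C + `|x| * k%:R) => b; rewrite /shift /=.
have h1 : 1 <= (b%:R + 1 : rat) by rewrite lerDr.
have hp j : 1 <= (b%:R + 1 : rat) ^+ j by rewrite exprn_ege1.
have hn : 1 <= (n.+1%:R : rat) by rewrite ler1n.
case: leqP => hb; last first.
  rewrite sub0r normrN; apply: (le_trans (y := C)).
    by rewrite /C (bigD1 (Ordinal hb)) //= lerDl; apply: sumr_ge0 => *; exact: normr_ge0.
  apply: (le_trans (y := (`|K| + C + `|x| * k%:R))); first by rewrite addrAC lerDr addr_ge0 // mulr_ge0.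
  rewrite -mulrA ler_peMr ?addr_ge0 ?mulr_ge0 //.
  by rewrite -[1]mulr1 ler_pM.
have := hK (b - k)%N; rewrite natrB //= => hK'.
have -> : f (b - k)%N - x * b%:R ^+ n.+1 / (n.+1)`!%:R =
  (f (b - k)%N - x * (b%:R - k%:R) ^+ n.+1 / (n.+1)`!%:R) - x * (b%:R ^+ n.+1 - (b%:R - k%:R) ^+ n.+1) / (n.+1)`!%:R by ring.
apply: le_trans (ler_normB _ _) _.
have [q0 _] := andP (power_step hb (fun=> erefl) n).
have xk : b%:R - k%:R <= (b%:R : rat) by rewrite gerBl.
have xk0 : 0 <= b%:R - k%:R :> rat by rewrite subr_ge0 ler_nat.
rewrite addrAC !mulrDl -addrA; apply: lerD.
  apply: le_trans hK' _; apply: (le_trans (y := `|K| * n.+1%:R * (b%:R - k%:R + 1) ^+ n)).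
    apply: ler_wpM2r; first by rewrite exprn_ge0 // addr_ge0.
    by apply: ler_wpM2r; rewrite ?ler_norm.
  apply: ler_wpM2l; first by rewrite mulr_ge0.
  apply: lerXn2r; rewrite ?nnegrE; [exact: addr_ge0|exact: addr_ge0|exact: lerD].
apply: (le_trans (y := `|x| * k%:R * n.+1%:R * (b%:R + 1) ^+ n)); last first.
  by rewrite lerDl mulr_ge0 ?mulr_ge0 // (le_trans ler01).
rewrite !normrM -!mulrA ler_wpM2l // normfV normr_nat mulrA.
apply: (le_trans (y := k%:R * n.+1%:R * b%:R ^+ n)).
  rewrite ler_pdivrMr ?ltr0n ?fact_gt0 // ger0_norm; last by rewrite subr_ge0; apply: lerXn2r; rewrite ?nnegrE.
  apply: (le_trans (y := k%:R * n.+1%:R * b%:R ^+ n)); first by rewrite -subr_ge0.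
  by rewrite ler_peMr ?mulr_ge0 ?exprn_ge0 // ler1n fact_gt0.
rewrite ?mulrA; apply: ler_wpM2l; first by rewrite mulr_ge0.
by rewrite lerXn2r ?nnegrE ?addr_ge0 // lerDl.
Qed.

Lemma asymp_ext n x y f g : (forall b, f b = g b) -> x = y -> asymp n x f -> asymp n y g.
Proof. by move=> e <- [K h]; exists K => b; rewrite -e. Qed.

Lemma asymp_usum w ws n x f : (0 < w)%N ->
  asymp n x (usum ws f) -> asymp n.+1 (x / w%:R) (usum (w :: ws) f).
Proof. by move=> w0 h; apply: (asymp_sum w0 h) => b; exact: usum_rec. Qed.

(** The sum of the r-th powers of the x-degrees of the solutions of y-degree b. *)
Definition moment r ws b : rat := wsum ws (fun n => (- n)%:~R ^+ r) 0 b.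

Lemma moment_rec r c d ws b : (0 < d)%N ->
  moment r ((c, d) :: ws) b = moment r ws b +
   (if (d <= b)%N then wsum ((c, d) :: ws) (fun n => (c%:Z - n)%:~R ^+ r) 0 (b - d) else 0).
Proof.
move=> d0; rewrite /moment wsum_rec //; congr (_ + _); case: ifP => // _.
rewrite [0 - _]addrC wsum_shift; apply: eq_wsum => n; congr (_%:~R ^+ _); lia.
Qed.

Record moments_asymp (n : nat) (x0 x1 x2 : rat) (ws : seq (nat * nat)) : Prop := {
  ma0 : asymp n x0 (moment 0 ws);
  ma1 : asymp n.+1 x1 (moment 1 ws);
  ma2 : asymp n.+2 x2 (moment 2 ws) }.

(** Lowering the new unknown by 1 lowers the x-degree by c and the y-degree by d.
    By the binomial formula the moments of the new family satisfy recursions of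
    step d whose right-hand sides are the old moments plus multiples of lower
    moments of the new family, and [asymp_sum] applies to them. *)
Lemma moments_cons n x0 x1 x2 c d ws : (0 < d)%N ->
  moments_asymp n x0 x1 x2 ws ->
  let r : rat := c%:R / d%:R in
  moments_asymp n.+1 (x0 / d%:R) ((x1 + r * x0) / d%:R) ((x2 + 2 * r * (x1 + r * x0)) / d%:R) ((c, d) :: ws).
Proof.
move=> d0 [h0 h1 h2] r.
have g0 : asymp n.+1 (x0 / d%:R) (moment 0 ((c, d) :: ws)).
  apply: (asymp_sum d0 h0) => b; rewrite moment_rec //; congr (_ + _); case: ifP.
have g1 : asymp n.+2 ((x1 + r * x0) / d%:R) (moment 1 ((c, d) :: ws)).
  have -> : x1 + r * x0 = x1 + c%:R * (x0 / d%:R) by rewrite /r; ring.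
  apply: (asymp_sum d0 (asymp_lin c%:R h1 (asymp_shift d g0))) => b.
  rewrite moment_rec // /shift -addrA; congr (_ + _); case: ifP => // hb; last by rewrite mulr0 addr0.
  rewrite /moment -wsum_lin; apply: eq_wsum => k; rewrite !expr1 expr0 mulr1.
  by rewrite rmorphB rmorphN.
split => //.
have -> : x2 + 2 * r * (x1 + r * x0) = x2 + (2 * c%:R) * ((x1 + r * x0) / d%:R) + c%:R ^+ 2 * 0 by rewrite /r; ring.
apply: (asymp_sum d0 (asymp_lin (c%:R ^+ 2) (asymp_lin (2 * c%:R) h2 (asymp_shift d g1)) (asymp_lower (asymp_shift d g0)))) => b.
rewrite moment_rec // /shift -!addrA; congr (_ + _); case: ifP => // hb; last by rewrite !mulr0 !addr0.
rewrite /moment -!wsum_lin; apply: eq_wsum => k; rewrite !rmorphB rmorphN /=; ring.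
Qed.

(** * The ten weights *)

(** The exponents of the factors of the Hilbert series. The weights of positive
    y-degree come first; one weight (0, 1) is kept apart because passing to
    two-row multiplicities almost cancels it. *)
Definition wts6 : seq (nat * nat) := [:: (0, 1); (1, 1); (1, 1); (0, 2); (1, 2); (2, 1)]%N.
Definition wts7 : seq (nat * nat) := (0, 1)%N :: wts6.
Definition wts10 : seq (nat * nat) := wts7 ++ [:: (1, 0); (1, 0); (2, 0)]%N.

Definition delta (n : nat) : rat := (n == 0%N)%:R.
(** The coefficients of 1 / ((1-x)^2 (1-x^2)). *)
Definition xcount (n : nat) : rat := usum [:: 1; 1; 2]%N delta n.

Lemma usum2 n : usum [:: 2]%N delta n = (1 + (-1) ^+ n) / 2.
Proof.
have [m] := ubnP n; elim: m n => // m IH [|[|n]] hn.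
- by rewrite /= divn_small // big_ord1 subn0 /delta eqxx expr0 /= mulr1n; lra.
- by rewrite /= divn_small // big_ord1 subn0 /delta /= expr1 mulr0n; lra.
rewrite usum_rec // subn2 [n.+2.-2]/= IH; last by lia.
by rewrite /= /delta /= !exprS mulr0n; ring.
Qed.

Lemma usum12 n : usum [:: 1; 2]%N delta n = (2 * n%:R + 3 + (-1) ^+ n) / 4.
Proof.
elim: n => [|n IH]; first by rewrite usum_rec // usum2 /= expr0; lra.
by rewrite usum_rec // usum2 subn1 -[n.+1.-1]/n IH exprS -[n.+1%:R]natr1 /=; field.
Qed.

Lemma xcountE n : xcount n = (n%:R + 2) ^+ 2 / 4 + (-1 / 8 + (-1) ^+ n / 8).
Proof.
rewrite /xcount; elim: n => [|n IH]; first by rewrite usum_rec // usum12 /= expr0; lra.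
by rewrite usum_rec // usum12 subn1 -[n.+1.-1]/n IH exprS -[n.+1%:R]natr1 /=; field.
Qed.

Definition parity (n : int) : rat := -1 / 8 + (-1) ^+ `|n|%N / 8.

(** The quasi-polynomial that gives the coefficients for n >= 0 is symmetric
    about -2 and vanishes at -1, -2 and -3. *)
Lemma xcount_refl n : natfun xcount n = ((n + 2)%:~R ^+ 2 / 4 + parity n) - natfun xcount (- n - 4).
Proof.
case: n => n.
  have -> : - Posz n - 4 = Negz (n + 3) by lia.
  by rewrite /= xcountE subr0 /parity /= !rmorphD.
case: n => [|[|[|n]]].
- by rewrite /parity /= expr1; lra.
- by rewrite /parity /= ?exprS ?expr0; lra.
- by rewrite /parity /= !exprS expr0; lra.
have -> : - Negz n.+3 - 4 = Posz n by lia.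
rewrite /= xcountE /parity /=.
have -> : Negz n.+3 + 2 = - (Posz n + 2) by lia.
by rewrite rmorphN sqrrN rmorphD !exprS /=; ring.
Qed.

(** The exponent of the last weight (2, 1) is what remains of the y-degree. Once
    it is eliminated, an unknown of weight (c, d) contributes 2d - c to the
    single quantity 2b - a, and the sum becomes a partition function of one
    variable. The bound on b makes the other constraint on each exponent
    automatic. *)
Lemma wsum_reflect ws f a b : all (fun w => (0 < w.2)%N && (w.1 <= w.2)%N) ws ->
  (2 * b)%N%:Z - a - 4 <= b%:Z ->
  wsum (ws ++ [:: (2, 1)]%N) (fun n => natfun f (- n - 4)) a b =
  natfun (usum [seq (2 * w.2 - w.1)%N | w <- ws] f) ((2 * b)%N%:Z - a - 4).
Proof.
elim: ws a b => [|[c d] ws IH] a b.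
  move=> _ _; rewrite /= divn1 big_ord_recr /= muln1 subnn eqxx big1 ?add0r.
    by rewrite opprB mulnC.
  by move=> t _; rewrite muln1 subn_eq0 leqNgt ltn_ord.
case/andP=> /= /andP[d0 cd] hws hn.
have w0 : (0 < 2 * d - c)%N by lia.
have E t : (t < (b %/ d).+1)%N ->
   wsum (ws ++ [:: (2, 1)]%N) (fun n => natfun f (- n - 4)) (a - (t * c)%N%:Z) (b - t * d) =
   natfun (usum [seq (2 * w.2 - w.1)%N | w <- ws] f) ((2 * b)%N%:Z - a - 4 - (t * (2 * d - c))%N%:Z).
  rewrite ltnS leq_divRL // => ht.
  have e : (2 * (b - t * d))%N%:Z - (a - (t * c)%N%:Z) - 4 = (2 * b)%N%:Z - a - 4 - (t * (2 * d - c))%N%:Z.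
    by rewrite mulnBr -!subzn ?leq_mul // mulnCA; nia.
  rewrite IH //; rewrite e //.
  have : (t * d <= t * (2 * d - c))%N by rewrite leq_mul2l; lia.
  by rewrite -subzn //; lia.
under eq_bigr => t _ do rewrite E //.
case en : ((2 * b)%N%:Z - a - 4) hn E => [n|n] hn _; last first.
  by rewrite big1 // => t _; rewrite natfun_neg //; lia.
rewrite /=.
have hdiv : ((n %/ (2 * d - c)).+1 <= (b %/ d).+1)%N.
  rewrite ltnS (leq_trans (leq_div2l _ d0 (_ : (d <= _)%N))) //; first by lia.
  by rewrite leq_div2r //; lia.
rewrite (big_ord_widen _ (fun t : nat => usum _ f (n - t * (2 * d - c))) hdiv) [RHS]big_mkcond /=.
apply: eq_bigr => t _; rewrite ltnS leq_divRL //.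
case: leqP => h; last by rewrite natfun_neg //; lia.
by rewrite subzn.
Qed.

Definition hilb (a b : nat) : rat := (size (sols wts10 a b))%:R.

Lemma hilbE a b : hilb a b = wsum wts7 (natfun xcount) a b.
Proof.
rewrite /hilb /wts10 size_sols_cat //; apply: eq_wsum => -[n|n] //=.
by rewrite (sols_usum n (_ : all _ [:: 1; 1; 2]%N)).
Qed.

(** The multiplicity of the partition (a, b). *)
Definition mult2 (a b : nat) : rat :=
  hilb a b - (if b is b'.+1 then hilb a.+1 b' else 0).

(** The correction caused by the reflected part of [xcount], for the multiplicity;
    [Vcorr] is the corresponding correction for the Hilbert series, and going
    from (a, b) to (a + 1, b - 1) lowers 2b - a by 3. *)
Definition Dcorr (n : nat) : rat := usum [:: 2; 2; 1; 1; 4]%N xcount n.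

Lemma hilb_refl a b : (b <= a)%N ->
  hilb a b = 4^-1 * wsum wts7 (fun n => (n + 2)%:~R ^+ 2) a b + wsum wts7 parity a b
     - natfun (usum [:: 2; 2; 1; 1; 4; 3]%N xcount) ((2 * b)%N%:Z - a%:Z - 4).
Proof.
move=> ab; rewrite hilbE (eq_wsum _ _ _ xcount_refl).
rewrite (@eq_wsum _ _ (fun n => (-1) * natfun xcount (- n - 4) + (4^-1 * (n + 2)%:~R ^+ 2 + parity n))); last first.
  by move=> n; ring.
rewrite wsum_lin wsum_lin mulN1r addrC.
rewrite -[in RHS](wsum_reflect (ws := [:: (0, 1); (0, 1); (1, 1); (1, 1); (0, 2); (1, 2)]%N)) //; lia.
Qed.

(** * Exact count for six weights *)

Lemma step_unique d (f g G : nat -> rat) : (0 < d)%N ->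
  (forall b, g b = f b + (if (d <= b)%N then g (b - d)%N else 0)) ->
  (forall b, (b < d)%N -> G b = f b) -> (forall b, G (b + d)%N = f (b + d)%N + G b) ->
  forall b, g b = G b.
Proof.
move=> d0 hg h1 h2 b; elim/ltn_ind: b => b IH; rewrite hg; case: leqP => hb.
  have -> : G b = G (b - d + d)%N by rewrite subnK.
  by rewrite h2 subnK // IH //; lia.
by rewrite addr0 h1.
Qed.

(** A closed form for d consecutive steps determines the sequence: this checks the
    count obtained by appending one weight against a proposed formula. *)
Lemma moment0_unique c d ws f G : (0 < d)%N ->
  (forall b, moment 0 ws b = f b) ->
  (forall b, (b < d)%N -> G b = f b) -> (forall b, G (b + d)%N = f (b + d)%N + G b) ->
  forall b, moment 0 ((c, d) :: ws) b = G b.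
Proof.
by move=> d0 hf; apply: step_unique => // b; rewrite moment_rec // hf; case: ifP.
Qed.

Lemma moment_21 r b : moment r [:: (2, 1)]%N b = (2 * b%:R) ^+ r.
Proof.
rewrite /moment /= divn1 big_ord_recr /= muln1 subnn eqxx big1 ?add0r.
  by rewrite opprK -pmulrn natrM mulrC.
by move=> t _; rewrite muln1 subn_eq0 leqNgt ltn_ord.
Qed.

(** The weights are appended one at a time; F2, ..., F6 are the successive
    quasi-polynomials of period 2. *)
Lemma moment0_wts6 b : moment 0 wts6 b / 4 =
   b%:R ^+ 5 / (5`!%:R * 2 ^+ 4) + b%:R ^+ 4 / (2 ^+ 5 * 3) + 5 * b%:R ^+ 3 / 2 ^+ 6
   + 13 * b%:R ^+ 2 / (4`!%:R * 2) + 1633 * b%:R / (5`!%:R * 2 ^+ 5) + 15 / 2 ^+ 6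
   + (-1) ^+ b * (b%:R / 2 ^+ 8 + 1 / 2 ^+ 6).
Proof.
have e1 k : (-1 : rat) ^+ (k + 1) = - (-1) ^+ k by rewrite addn1 exprS mulN1r.
have e2 k : (-1 : rat) ^+ (k + 2) = (-1) ^+ k by rewrite addn2 !exprS; ring.
pose n (k : nat) : rat := k%:R.
have na k m : n (k + m)%N = n k + n m by rewrite /n natrD.
have n1 : n 1%N = 1 by []. have n2 : n 2%N = 2 by [].
have n0 : n 0%N = 0 by [].
pose F2 k := 3 / 4 + n k / 2 + (-1) ^+ k / 4.
have h2 : forall k, moment 0 [:: (1, 2); (2, 1)]%N k = F2 k.
  apply: (@moment0_unique 1 2 _ (fun=> 1) F2 isT (fun=> moment_21 0 _)).
    by case=> [|[|k]] hk; [| |discriminate hk]; rewrite /F2 ?n0 ?n1 ?expr0 ?expr1 ?expr1n ?expr0n /=; lra.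
  by move=> k; rewrite /F2 na n2 e2; field.
pose F3 k := 11 / 16 + 5 / 8 * n k + n k ^+ 2 / 8 + (-1) ^+ k * (5 / 16 + n k / 8).
have h3 : forall k, moment 0 [:: (0, 2); (1, 2); (2, 1)]%N k = F3 k.
  apply: (@moment0_unique 0 2 _ F2 F3 isT h2).
    by case=> [|[|k]] hk; [| |discriminate hk]; rewrite /F2 /F3 ?n0 ?n1 ?expr0 ?expr1 ?expr1n ?expr0n /=; lra.
  by move=> k; rewrite /F2 /F3 na n2 e2; field.
pose F4 k := 13 / 16 + 49 / 48 * n k + 3 / 8 * n k ^+ 2 + n k ^+ 3 / 24 + (-1) ^+ k * (3 / 16 + n k / 16).
have h4 : forall k, moment 0 [:: (1, 1); (0, 2); (1, 2); (2, 1)]%N k = F4 k.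
  apply: (@moment0_unique 1 1 _ F3 F4 isT h3).
    by move=> k; rewrite ltnS leqn0 => /eqP->; rewrite /F3 /F4 !n0 !expr0 !expr0n /=; lra.
  by move=> k; rewrite /F3 /F4 na n1 e1; field.
pose F5 k := 57 / 64 + 133 / 96 * n k + 17 / 24 * n k ^+ 2 + 7 / 48 * n k ^+ 3 + n k ^+ 4 / 96 + (-1) ^+ k * (7 / 64 + n k / 32).
have h5 : forall k, moment 0 [:: (1, 1); (1, 1); (0, 2); (1, 2); (2, 1)]%N k = F5 k.
  apply: (@moment0_unique 1 1 _ F4 F5 isT h4).
    by move=> k; rewrite ltnS leqn0 => /eqP->; rewrite /F4 /F5 !n0 !expr0 !expr0n /=; lra.
  by move=> k; rewrite /F4 /F5 na n1 e1; field.
pose F6 k := 15 / 16 + 1633 / 960 * n k + 13 / 12 * n k ^+ 2 + 5 / 16 * n k ^+ 3 + n k ^+ 4 / 24 + n k ^+ 5 / 480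
  + (-1) ^+ k * (1 / 16 + n k / 64).
have -> : moment 0 wts6 b = F6 b.
  apply: (@moment0_unique 0 1 _ F5 F6 isT h5).
    by move=> k; rewrite ltnS leqn0 => /eqP->; rewrite /F5 /F6 !n0 !expr0 !expr0n /=; lra.
  by move=> k; rewrite /F5 /F6 na n1 e1; field.
have f4 : 4`! = 24%N by []. have f5 : 5`! = 120%N by [].
by rewrite /F6 /n f4 f5; field.
Qed.

(** The weight (2, 1) alone has a single solution for each b, of x-degree 2b;
    the other weights follow by [moments_cons]. *)
Lemma moments_wts5 : moments_asymp 4 (4^-1) (9 / 8) (53 / 8) (behead wts6).
Proof.
have h0 : moments_asymp 0 1 2 8 [:: (2, 1)]%N.
  split; exists 0 => b; rewrite moment_21 !mul0r.
  - by rewrite !expr0 fact0 divr1 mulr1 subrr normr0.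
  - by rewrite !expr1 (_ : 1`! = 1)%N // divr1 subrr normr0.
  have -> : 2`!%:R = 2 :> rat by [].
  by rewrite (_ : _ - _ = 0) ?normr0; [|field].
have h := moments_cons 1 (d := 1) isT (moments_cons 1 (d := 1) isT
  (moments_cons 0 (d := 2) isT (moments_cons 1 (d := 2) isT h0))).
have e1 : 1%:R = 1 :> rat by []. have e2 : 2%:R = 2 :> rat by []. have e0 : 0%:R = 0 :> rat by [].
case: h => g0 g1 g2; split.
- by apply: asymp_ext g0 => //; lra.
- by apply: asymp_ext g1 => //; lra.
by apply: asymp_ext g2 => //; lra.
Qed.

(** * Estimates for the multiplicities *)

Lemma moments_wts6 : moments_asymp 5 (4^-1) (9 / 8) (53 / 8) wts6.
Proof.
case: (moments_cons 0 (d := 1) isT moments_wts5) => g0 g1 g2; split.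
- by apply: asymp_ext g0 => //; lra.
- by apply: asymp_ext g1 => //; lra.
by apply: asymp_ext g2 => //; lra.
Qed.

Lemma moments_wts7 : moments_asymp 6 (4^-1) (9 / 8) (53 / 8) wts7.
Proof.
case: (moments_cons 0 (d := 1) isT moments_wts6) => g0 g1 g2; split.
- by apply: asymp_ext g0 => //; lra.
- by apply: asymp_ext g1 => //; lra.
by apply: asymp_ext g2 => //; lra.
Qed.

Lemma asymp_xcount : asymp 2 2^-1 xcount.
Proof.
exists 2 => b; rewrite xcountE (_ : 2`!%:R = 2) //=.
have -> : (b%:R + 2) ^+ 2 / 4 + (-1 / 8 + (-1) ^+ b / 8) - 2^-1 * b%:R ^+ 2 / 2 =
  b%:R + (7 / 8 + (-1) ^+ b / 8) :> rat by field.
apply: le_trans (ler_normD _ _) _; rewrite normr_nat expr1.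
have : `|7 / 8 + (-1) ^+ b / 8| <= 1 :> rat.
  by rewrite -signr_odd ler_norml; case: odd; rewrite ?expr0 ?expr1; lra.
have : 0 <= b%:R :> rat by []. lra.
Qed.

Lemma asymp_Dcorr : asymp 7 32^-1 Dcorr.
Proof.
have h := asymp_usum (w := 2) isT (asymp_usum (w := 2) isT (asymp_usum (w := 1) isT (asymp_usum (w := 1) isT (asymp_usum (w := 4) (ws := [::]) isT asymp_xcount)))).
by apply: asymp_ext h => //; lra.
Qed.

Definition Vcorr (n : nat) : rat := usum [:: 2; 2; 1; 1; 4; 3]%N xcount n.

Lemma Vcorr_diff n : Vcorr n = Dcorr n + shift 3 Vcorr n.
Proof.
have e k : usum [:: 3]%N xcount k = xcount k + 1 * shift 3 (usum [:: 3]%N xcount) k.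
  by rewrite mul1r usum_rec.
have e' m : Vcorr m = usum [:: 2; 2; 1; 1; 4]%N (usum [:: 3]%N xcount) m by [].
rewrite e' (eq_usum _ _ e) usum_lin mul1r usum_shift //.
Qed.

Definition pred_val (f : nat -> rat) b := if b is b'.+1 then f b' else 0.

(** Exact formula: expanding the quadratic term in powers of the x-degree leaves
    moments, and the first (0, 1) of the seven weights telescopes with the
    subtraction of the value at (a + 1, b - 1). *)
Lemma mult2E a b : (b <= a)%N ->
  mult2 a b = 4^-1 * ((a%:R + 2) ^+ 2 * moment 0 wts6 b - 2 * (a%:R + 2) * moment 1 wts6 b
     + moment 2 wts6 b - (2 * a%:R + 5) * pred_val (moment 0 wts7) b + 2 * pred_val (moment 1 wts7) b)
   + (wsum wts7 parity a b - pred_val (wsum wts7 parity a.+1) b)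
   - natfun Dcorr ((2 * b)%N%:Z - a%:Z - 4).
Proof.
move=> ab.
have e6 : wsum wts6 (fun n => (n + 2)%:~R ^+ 2) a b = (a%:R + 2) ^+ 2 * moment 0 wts6 b
     + (- (2 * (a%:R + 2)) * moment 1 wts6 b + moment 2 wts6 b).
  rewrite -[a%:Z]addr0 wsum_shift /moment -!wsum_lin; apply: eq_wsum => n.
  by rewrite !rmorphD !rmorphN /=; ring.
have eV n : n < (3 : int) -> natfun Dcorr n = natfun Vcorr n.
  by case: n => n //= h; rewrite Vcorr_diff /shift ifN ?addr0 //; lia.
have eV3 n : natfun Dcorr n = natfun Vcorr n - natfun Vcorr (n - 3).
  case: n => n; last by rewrite !natfun_neg ?subrr //; lia.
  rewrite [natfun Dcorr _]/= [natfun Vcorr (Posz n)]/= Vcorr_diff /shift.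
  case: leqP => h; last by rewrite subzn // [natfun _ _]/= addrK.
  by rewrite natfun_neg ?subr0 ?addr0 //; lia.
have e7 phi : wsum wts7 phi a b = wsum wts6 phi a b + pred_val (wsum wts7 phi a) b.
  by rewrite /wts7 wsum_rec // subr0; case: (b) => [|b'] //; rewrite subn1.
have -> : mult2 a b = hilb a b - pred_val (hilb a.+1) b by [].
rewrite hilb_refl // [wsum wts7 (fun _ => _) a b]e7 e6 eV3.
case: b ab e6 e7 => [|b] ab e6 e7.
  by do 5 rewrite [pred_val _ _]/=; rewrite (natfun_neg _ (_ : _ - 3 < 0)); [rewrite /Vcorr; ring|lia].
have pv f : pred_val f b.+1 = f b by [].
rewrite !pv hilb_refl //; last by lia.
have -> : (2 * b)%N%:Z - a.+1%:Z - 4 = (2 * b.+1)%N%:Z - a%:Z - 4 - 3 by lia.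
have -> : wsum wts7 (fun n => (n + 2)%:~R ^+ 2) a.+1 b = wsum wts7 (fun n => (n + 2)%:~R ^+ 2) a b +
   ((2 * a%:R + 5) * moment 0 wts7 b - 2 * moment 1 wts7 b).
  rewrite -[a%:Z]addr0 -[a.+1%:Z]addr0 !wsum_shift /moment.
  have -> x y z : x + (y - 2 * z) = (- 2) * z + (y + x) :> rat by ring.
  by rewrite -!wsum_lin; apply: eq_wsum => n; rewrite -[a.+1]addn1 PoszD !rmorphD rmorphN /=; ring.
rewrite -/Vcorr; ring.
Qed.

Lemma asymp_pred_val n x f : asymp n.+1 x f -> asymp n.+1 x (pred_val f).
Proof.
move=> h; apply: (asymp_ext _ erefl (asymp_shift 1 h)) => -[|b] //.
by rewrite /shift subn1.
Qed.

Lemma parity_bound n : `|parity n| <= 4^-1.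
Proof.
by rewrite /parity -signr_odd ler_norml; case: odd; rewrite ?expr0 ?expr1; lra.
Qed.

Lemma fact_small : (5`! = 120) * (6`! = 720) * (7`! = 5040).
Proof. by []. Qed.

Lemma wsum_parity_bound a b : `|wsum wts7 parity a b| <= 4^-1 * (b%:R + 1) ^+ 6.
Proof. exact: (wsum_bound parity_bound). Qed.

Lemma parity_diff_bound a b : `|wsum wts7 parity a b - pred_val (wsum wts7 parity (a + 1)) b| <= (b%:R + 1) ^+ 6.
Proof.
have hB k : 0 <= (k%:R + 1 : rat) ^+ 6 by rewrite exprn_ge0 // addr_ge0.
apply: le_trans (ler_normB _ _) _.
have hq : `|pred_val (wsum wts7 parity (a + 1)) b| <= 4^-1 * (b%:R + 1) ^+ 6.
  case: b => [|b]; first by rewrite normr0 mulr_ge0.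
  apply: le_trans (wsum_parity_bound _ _) _; rewrite ler_wpM2l // lerXn2r ?nnegrE ?addr_ge0 //.
  by rewrite lerD2r ler_nat.
have := wsum_parity_bound a b; have := hB b; lra.
Qed.

Lemma asymp_bound n x f : asymp n x f -> exists2 K, 0 <= K &
  forall b s, b%:R + 1 <= s -> `|f b - x * b%:R ^+ n / n`!%:R| <= K * s ^+ n.-1.
Proof.
move=> [K hK]; exists (`|K| * n%:R); first by rewrite mulr_ge0.
move=> b s hs; have hb : 0 <= b%:R + 1 :> rat by rewrite addr_ge0.
apply: le_trans (hK b) _; apply: (le_trans (y := `|K| * n%:R * (b%:R + 1) ^+ n.-1)).
  by rewrite ler_wpM2r ?exprn_ge0 // ler_wpM2r // ler_norm.
by rewrite ler_wpM2l ?mulr_ge0 // lerXn2r // nnegrE (le_trans hb).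
Qed.

Definition main_term (a b : rat) : rat :=
  b ^+ 7 / (7`!%:R * 2 ^+ 5) + (a - b) * b ^+ 6 / (6`!%:R * 2 ^+ 4)
               + (a - b) ^+ 2 * b ^+ 5 / (5`!%:R * 2 ^+ 4).

Lemma ler_prod3 (x y z X Y Z : rat) : `|x| <= X -> `|y| <= Y -> X * Y = Z -> z = x * y -> `|z| <= Z.
Proof. by move=> hx hy <- ->; rewrite normrM; apply: ler_pM. Qed.

Lemma combine_bounds (x1 x2 x3 x4 x5 p y z c1 c2 c3 c4 c5 t : rat) :
  `|x1| <= c1 -> `|x2| <= c2 -> `|x3| <= c3 -> `|x4| <= c4 -> `|x5| <= c5 -> `|p| <= t ->
  0 <= y -> y <= 4 * t -> 0 <= z -> z <= t ->
  `|4^-1 * (x1 + x2 + x3 + x4 + x5) + p + (y / 1920 - 23 * z / 11520)| <= c1 + c2 + c3 + c4 + c5 + 2 * t.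
Proof.
by rewrite !ler_norml => /andP[? ?] /andP[? ?] /andP[? ?] /andP[? ?] /andP[? ?] /andP[? ?] ? ? ? ?; apply/andP; split; lra.
Qed.

(** In [mult2E] the moments are replaced by their leading terms. The leading
    coefficients 1/4, 9/8, 53/8 produce the three terms of the main term up to
    the last two summands y/1920 and 23 z/11520, with y = (4a + 4) b^5 and
    z = b^6, which are of degree 6. *)
Lemma mult2_main : exists2 K : rat, 0 <= K & forall a b : nat, (b <= a)%N ->
  `|mult2 a b + natfun Dcorr ((2 * b)%N%:Z - a%:Z - 4) - main_term a%:R b%:R|
    <= K * (a%:R + b%:R + 1) ^+ 6.
Proof.
have [k0 k00 h0] := asymp_bound (ma0 moments_wts6).
have [k1 k10 h1] := asymp_bound (ma1 moments_wts6).
have [k2 k20 h2] := asymp_bound (ma2 moments_wts6).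
have [l0 l00 g0] := asymp_bound (asymp_pred_val (ma0 moments_wts7)).
have [l1 l10 g1] := asymp_bound (asymp_pred_val (ma1 moments_wts7)).
exists (4 * k0 + 4 * k1 + k2 + 5 * l0 + 2 * l1 + 2); first by rewrite !addr_ge0 // mulr_ge0.
move=> a b ab; rewrite (mult2E ab).
set s : rat := a%:R + b%:R + 1.
have a0 : 0 <= a%:R :> rat by []. have b0 : 0 <= b%:R :> rat by [].
have bs : b%:R + 1 <= s by rewrite /s; lra.
have as2 : `|a%:R + 2| <= 2 * s by rewrite ger0_norm /s; lra.
have as5 : `|2 * a%:R + 5| <= 5 * s by rewrite ger0_norm /s; lra.
have s0 : 0 <= s by rewrite /s; lra.
move: (h0 b s bs) (h1 b s bs) (h2 b s bs) (g0 b s bs) (g1 b s bs).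
set e0 := moment 0 wts6 b - _; set e1 := moment 1 wts6 b - _; set e2 := moment 2 wts6 b - _.
set f0 := pred_val (moment 0 wts7) b - _; set f1 := pred_val (moment 1 wts7) b - _.
rewrite [5.-1]/= [6.-1]/= [7.-1]/= => he0 he1 he2 hf0 hf1.
set p := wsum wts7 parity a b - pred_val (wsum wts7 parity a.+1) b.
have hp : `|p| <= s ^+ 6.
  rewrite /p -[a.+1]addn1; apply: le_trans (parity_diff_bound _ _) _.
  by rewrite lerXn2r ?nnegrE ?addr_ge0.
have -> : 4^-1 * ((a%:R + 2) ^+ 2 * moment 0 wts6 b - 2 * (a%:R + 2) * moment 1 wts6 b
     + moment 2 wts6 b - (2 * a%:R + 5) * pred_val (moment 0 wts7) b + 2 * pred_val (moment 1 wts7) b)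
   + p - natfun Dcorr ((2 * b)%N%:Z - a%:Z - 4) + natfun Dcorr ((2 * b)%N%:Z - a%:Z - 4) - main_term a%:R b%:R =
   4^-1 * ((a%:R + 2) ^+ 2 * e0 + (- 2 * (a%:R + 2)) * e1 + e2 + (- (2 * a%:R + 5)) * f0 + 2 * f1) + p
   + (4^-1 * ((4 * a%:R + 4) * (4^-1 * b%:R ^+ 5 / 120)) - 4^-1 * ((9 / 2 + 5 / 4) * b%:R ^+ 6 / 720)).
  by rewrite /main_term /e0 /e1 /e2 /f0 /f1 !fact_small; field.
clearbody e0 e1 e2 f0 f1 p; clear h0 h1 h2 g0 g1.
have m1 : `|(a%:R + 2) ^+ 2 * e0| <= (4 * k0) * s ^+ 6.
  apply: (@ler_prod3 ((a%:R + 2) ^+ 2) e0 _ (4 * s ^+ 2) _ _ _ he0) => //; last by ring.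
  by apply: (ler_prod3 as2 as2); ring.
have m2 : `|- 2 * (a%:R + 2) * e1| <= (4 * k1) * s ^+ 6.
  apply: (@ler_prod3 (- 2 * (a%:R + 2)) e1 _ (4 * s) _ _ _ he1) => //; last by ring.
  by rewrite mulNr normrN normrM ger0_norm // (le_trans (ler_wpM2l _ as2)) ?mulrA.
have m3 : `|- (2 * a%:R + 5) * f0| <= (5 * l0) * s ^+ 6.
  apply: (@ler_prod3 (- (2 * a%:R + 5)) f0 _ (5 * s) _ _ _ hf0) => //; last by ring.
  by rewrite normrN.
have m4 : `|2 * f1| <= (2 * l1) * s ^+ 6.
  by rewrite normrM ger0_norm // -mulrA ler_wpM2l.
have a4 : 0 <= 4 * a%:R + 4 :> rat by rewrite addr_ge0 // mulr_ge0.
have b_s : b%:R <= s by apply: le_trans bs; rewrite lerDl.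
have m5 : 0 <= (4 * a%:R + 4) * b%:R ^+ 5 :> rat by apply: mulr_ge0; rewrite ?exprn_ge0.
have m5' : (4 * a%:R + 4) * b%:R ^+ 5 <= 4 * s ^+ 6.
  rewrite [_ ^+ 6]exprS mulrA; apply: ler_pM; rewrite ?exprn_ge0 //; last by rewrite lerXn2r ?nnegrE.
  by rewrite -[X in _ + X]mulr1 -mulrDr ler_wpM2l // /s lerD2r lerDl.
have m6 : 0 <= b%:R ^+ 6 :> rat by rewrite exprn_ge0.
have m6' : b%:R ^+ 6 <= s ^+ 6 by rewrite lerXn2r ?nnegrE.
rewrite (_ : _ - 4^-1 * _ = (4 * a%:R + 4) * b%:R ^+ 5 / 1920 - 23 * b%:R ^+ 6 / 11520); last by field.
rewrite (_ : _ * s ^+ 6 = 4 * k0 * s ^+ 6 + 4 * k1 * s ^+ 6 + k2 * s ^+ 6 + 5 * l0 * s ^+ 6 + 2 * l1 * s ^+ 6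
  + 2 * s ^+ 6); last by ring.
exact: combine_bounds.
Qed.

Lemma pow_succ_bound (K : rat) (a b n : nat) : 0 <= K -> (0 < a + b)%N ->
  K * (a%:R + b%:R + 1) ^+ n <= K * 2 ^+ n * (a%:R + b%:R) ^+ n.
Proof.
move=> K0 ab; rewrite -mulrA -exprMn ler_wpM2l // lerXn2r ?nnegrE ?addr_ge0 ?mulr_ge0 ?addr_ge0 //.
have : 1 <= a%:R + b%:R :> rat by rewrite -natrD ler1n.
lra.
Qed.

Lemma mult2_far : exists (K : rat) (N : nat), forall a b : nat,
  (b <= a)%N -> (N <= a + b)%N -> (2 * b < a)%N ->
  `|mult2 a b - main_term a%:R b%:R| <= K * (a%:R + b%:R) ^+ 6.
Proof.
have [K K0 h] := mult2_main; exists (K * 2 ^+ 6), 1%N => a b ab ab0 b2a.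
apply: le_trans (pow_succ_bound 6 K0 ab0); apply: le_trans (h a b ab).
by rewrite natfun_neg ?addr0 //; lia.
Qed.

(** The correction has leading term n^7 / (7! 32) at n = 2b - a - 4; replacing n
    by n + 4 costs a term of degree 6. For 2b - a <= 3 the correction is zero and
    the seventh power is bounded. *)
Lemma Dcorr_bound : exists2 K : rat, 0 <= K & forall a b : nat, (b <= a)%N -> (a <= 2 * b)%N ->
  `|natfun Dcorr ((2 * b)%N%:Z - a%:Z - 4) - (2 * b%:R - a%:R) ^+ 7 / (7`!%:R * 2 ^+ 5)|
    <= K * (a%:R + b%:R + 1) ^+ 6.
Proof.
have [K K0 h] := asymp_bound asymp_Dcorr.
have f1 : 1 <= 7`!%:R :> rat by rewrite ler1n.
move: (7`!%:R) f1 h => f f1 h.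
have -> : f * 2 ^+ 5 = f * 32 by ring.
have [g g28 eg] : exists2 g, 4%:R * 7%:R <= g & f * 32 = g by exists (f * 32); lra.
have fg x : 32^-1 * x / f = x / g.
  by rewrite -eg; field; rewrite gt_eqF // (lt_le_trans _ f1).
have g1 : 1 <= g by lra.
have gp : 0 < g by lra.
rewrite eg; clear eg.
have [C C1 hC] : exists2 C : rat, 1 <= C & forall n : nat, (n <= 3)%N -> n%:R ^+ 7 <= C.
  exists (3%:R ^+ 7); first by rewrite exprn_ege1 // ler1n.
  by move=> n n3; rewrite lerXn2r ?nnegrE ?ler0n // ler_nat.
have C0 : 0 <= C by apply: le_trans C1; exact: ler01.
exists (K + C) => [|a b ba ab]; first exact: addr_ge0.
have ba' : b%:R <= a%:R :> rat by rewrite ler_nat.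
have s1 : 1 <= a%:R + b%:R + 1 :> rat by rewrite lerDr addr_ge0.
case: (leqP (a + 4) (2 * b)) => hab.
  have -> : (2 * b)%N%:Z - a%:Z - 4 = (2 * b - a - 4)%N by lia.
  have e1 : ((2 * b - a - 4) + 4 = 2 * b - a)%N by lia.
  have e2 : 2 * b%:R - a%:R = ((2 * b - a - 4) + 4)%N%:R :> rat by rewrite e1 natrB // natrM.
  move: (2 * b - a - 4)%N e2 {e1} => n en; rewrite [natfun _ _]/=.
  have ns : (n + 4)%N%:R <= a%:R + b%:R + 1 :> rat by rewrite -en; lra.
  rewrite en; move: (a%:R + b%:R + 1) s1 ns {en ba' hab ab ba} => s s1 ns.
  have s0 : 0 <= s by apply: le_trans s1; exact: ler01.
  have s6 : 0 <= s ^+ 6 by exact: exprn_ge0.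
  have hn : `|Dcorr n - n%:R ^+ 7 / g| <= K * s ^+ 6.
    by rewrite -fg; apply: h; apply: le_trans ns; rewrite natrD lerD2l ler1n.
  have -> : Dcorr n - (n + 4)%:R ^+ 7 / g =
     (Dcorr n - n%:R ^+ 7 / g) - ((n + 4)%:R ^+ 7 - n%:R ^+ 7) / g by ring.
  apply: le_trans (ler_normB _ _) _; rewrite [X in _ <= X]mulrDl; apply: lerD; first exact: hn.
  have := @power_step 4 (n + 4) _ (leq_addl _ _) (fun=> erefl) 6.
  rewrite -[_ - 4%:R]natrB ?leq_addl // addnK => /andP[q0 _].
  have le7 : n%:R ^+ 7 <= (n + 4)%:R ^+ 7 :> rat.
    by rewrite lerXn2r ?nnegrE ?ler0n // ler_nat leq_addr.
  rewrite ger0_norm; last by rewrite divr_ge0 ?(ltW gp) // subr_ge0.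
  rewrite ler_pdivrMr //.
  move: q0; rewrite subr_ge0 => q0; apply: le_trans q0 _.
  have le6 : (n + 4)%:R ^+ 6 <= s ^+ 6 by rewrite lerXn2r ?nnegrE ?ler0n.
  apply: (le_trans (y := g * s ^+ 6)).
    apply: ler_pM; [exact: mulr_ge0|exact/exprn_ge0/ler0n| |exact: le6].
    exact: g28.
  by rewrite mulrC ler_wpM2r ?(ltW gp) // ler_peMl.
rewrite natfun_neg ?sub0r ?normrN; last by lia.
have e1 : 2 * b%:R - a%:R = (2 * b - a)%N%:R :> rat by rewrite natrB // natrM.
have e2 : (2 * b - a <= 3)%N by lia.
rewrite e1; move: (2 * b - a)%N e2 => n n3 {e1}.
move: (a%:R + b%:R + 1) s1 => s s1.
have s6 : 1 <= s ^+ 6 by rewrite exprn_ege1.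
have s0 : 0 <= s ^+ 6 by apply: le_trans s6; exact: ler01.
rewrite ger0_norm; last by apply: divr_ge0; [exact/exprn_ge0/ler0n|exact: ltW].
rewrite ler_pdivrMr //.
apply: le_trans (hC n n3) _; rewrite mulrDl mulrDl -[X in X <= _]add0r; apply: lerD.
  by apply: mulr_ge0; [exact: mulr_ge0|exact: ltW].
rewrite -mulrA; apply: ler_peMr => //; rewrite -[1]mulr1; apply: ler_pM => //; exact: ler01.
Qed.

Lemma mult2_near : exists (K : rat) (N : nat), forall a b : nat,
  (b <= a)%N -> (N <= a + b)%N -> (a <= 2 * b)%N ->
  `|mult2 a b - (main_term a%:R b%:R - (2 * b%:R - a%:R) ^+ 7 / (7`!%:R * 2 ^+ 5))|
     <= K * (a%:R + b%:R) ^+ 6.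
Proof.
have [K K0 h] := mult2_main; have [L L0 g] := Dcorr_bound.
exists ((K + L) * 2 ^+ 6), 1%N => a b ab ab0 b2a.
apply: le_trans (pow_succ_bound 6 (addr_ge0 K0 L0) ab0).
have := h a b ab; have := g a b ab b2a.
move: (mult2 a b) (natfun Dcorr _) (main_term _ _) (_ / _) (_ ^+ 6) => x y z t s h1 h2.
have -> : x - (z - t) = (x + y - z) - (y - t) by ring.
by apply: le_trans (ler_normB _ _) _; rewrite mulrDl; apply: lerD.
Qed.

(** For fixed b only the first moment term carries a^2, and the others are at
    most linear in a. *)
Lemma mult2_fixed b : exists (K : rat) (N : nat), forall a : nat,
  (b <= a)%N -> (N <= a)%N -> (2 * b < a)%N ->
  `|mult2 a b - a%:R ^+ 2 * (moment 0 wts6 b / 4)| <= K * a%:R.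
Proof.
pose x0 := moment 0 wts6 b; pose x1 := moment 1 wts6 b; pose x2 := moment 2 wts6 b.
pose y0 := pred_val (moment 0 wts7) b; pose y1 := pred_val (moment 1 wts7) b.
pose B : rat := (b%:R + 1) ^+ 6.
pose u := 4^-1 * (4 * x0 - 2 * x1 - 2 * y0).
pose v := 4^-1 * (4 * x0 - 4 * x1 + x2 - 5 * y0 + 2 * y1).
exists (`|u| + (`|v| + B)), 1%N => a ab a1 b2a.
rewrite mult2E // natfun_neg ?subr0; last by lia.
set p := wsum wts7 parity a b - pred_val (wsum wts7 parity a.+1) b.
have a1' : 1 <= a%:R :> rat by rewrite ler1n.
have hp : `|p| <= B by rewrite /p -[a.+1]addn1; exact: parity_diff_bound.
have -> : 4^-1 * ((a%:R + 2) ^+ 2 * moment 0 wts6 b - 2 * (a%:R + 2) * moment 1 wts6 b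
     + moment 2 wts6 b - (2 * a%:R + 5) * pred_val (moment 0 wts7) b + 2 * pred_val (moment 1 wts7) b)
   + p - a%:R ^+ 2 * (moment 0 wts6 b / 4) = u * a%:R + (v + p).
  by rewrite /u /v /x0 /x1 /x2 /y0 /y1; field.
apply: le_trans (ler_normD _ _) _; rewrite mulrDl normrM normr_nat lerD2l.
apply: le_trans (ler_normD _ _) _; apply: (le_trans (y := `|v| + B)); first by rewrite lerD2l.
by rewrite ler_peMr // addr_ge0 // exprn_ge0 // addr_ge0.
Qed.

End Counting.

(** * The candidate basis *)

(** The index s lists the exponents in the order of [wts10]. Entry 8, for the
    weight (1, 0), stands for X^i tr(XXX)^n through s_8 = 3n + i, and entry 1
    for Y^j tr(YYY)^n. *)
Definition basis_word (s : seq nat) : seq bool :=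
  std_word (nth 0 s 8 %% 3)%N (nth 0%N s 3) (nth 0 s 1 %% 3)%N.

Definition basis_traces (s : seq nat) : seq (seq bool) :=
  nseq (nth 0%N s 0) [:: true] ++ nseq (nth 0%N s 1 %/ 3)%N [:: true; true; true] ++
  nseq (nth 0%N s 2) [:: false; true] ++ nseq (nth 0%N s 4) [:: true; true] ++
  nseq (nth 0%N s 5) [:: false; true; true] ++ nseq (nth 0%N s 6) [:: false; false; true] ++
  nseq (nth 0%N s 7) [:: false] ++ nseq (nth 0%N s 8 %/ 3)%N [:: false; false; false] ++
  nseq (nth 0%N s 9) [:: false; false].

Section TraceMonomials.
Variables (R : comNzRingType) (X Y : 'M[R]_3).

Definition tmon (w0 : seq bool) (ws : seq (seq bool)) : 'M[R]_3 :=
  (\prod_(w <- ws) wtr X Y w)%:M * wev X Y w0.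

Definition basis (s : seq nat) : 'M[R]_3 := tmon (basis_word s) (basis_traces s).

Lemma tmon_cons w0 w ws : tmon w0 (w :: ws) = (wtr X Y w)%:M * tmon w0 ws.
Proof.
rewrite /tmon big_cons mulrA; congr (_ * _).
by rewrite -[RHS]/(_ *m _) -scalar_mxM.
Qed.

Lemma tmon_perm w0 ws ws' : perm_eq ws ws' -> tmon w0 ws = tmon w0 ws'.
Proof. by move=> h; rewrite /tmon (perm_big _ h). Qed.

Lemma basis_trace_mul w s s' : basis_word s' = basis_word s ->
  perm_eq (w :: basis_traces s) (basis_traces s') -> (wtr X Y w)%:M * basis s = basis s'.
Proof. by move=> hw hp; rewrite /basis -tmon_cons hw; exact: tmon_perm. Qed.

End TraceMonomials.

Definition short_words : seq (seq bool) :=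
  [:: [:: true]; [:: true; true; true]; [:: false; true]; [:: true; true];
      [:: false; true; true]; [:: false; false; true]; [:: false]; [:: false; false; false];
      [:: false; false] ].

(** Multiplication by the trace of a short word maps the candidate basis to
    itself: it raises one exponent, by 3 for the cubes. *)
Definition bump_index (w : seq bool) (s : seq nat) : seq nat :=
  if w == [:: true] then incr_nth s 0
  else if w == [:: true; true; true] then iter 3 (incr_nth^~ 1%N) s
  else if w == [:: false; true] then incr_nth s 2
  else if w == [:: true; true] then incr_nth s 4
  else if w == [:: false; true; true] then incr_nth s 5
  else if w == [:: false; false; true] then incr_nth s 6
  else if w == [:: false] then incr_nth s 7
  else if w == [:: false; false; false] then iter 3 (incr_nth^~ 8%N) s
  else incr_nth s 9.

Lemma bump_size w s : size s = 10%N -> size (bump_index w s) = 10%N.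
Proof.
move=> h; rewrite /bump_index; do 8 (case: ifP => _; first by rewrite /= !size_incr_nth h).
by rewrite size_incr_nth h.
Qed.

Lemma bump_indexP (R : comNzRingType) (X Y : 'M[R]_3) w s : w \in short_words ->
  (wtr X Y w)%:M * basis X Y s = basis X Y (bump_index w s).
Proof.
have div3 (a : nat) : ((3 + a) %/ 3)%N = (1 + a %/ 3)%N by rewrite divnDl.
have mod3 (a : nat) : ((3 + a) %% 3)%N = (a %% 3)%N by rewrite modnDl.
move=> hw; apply: basis_trace_mul.
  by move: hw; rewrite /basis_word !inE; repeat case/orP; move=> /eqP ->; rewrite /= !nth_incr_nth /= ?add0n ?addnA ?mod3.
have key (P : pred (seq bool)) : (P w + count P (basis_traces s) = count P (basis_traces (bump_index w s)))%N.
  have eqs (b n : nat) : (b * (1 + n) = b + b * n)%N by rewrite mulnDr muln1.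
  move: hw; rewrite /basis_traces !count_cat !count_nseq.
  by rewrite !inE; repeat case/orP; move=> /eqP ->;
    rewrite /= !nth_incr_nth /= ?add0n ?addnA ?div3 ?eqs; do 9 (move: (muln _ _) => ?); lia.
by apply/seq.permP => P; rewrite -key.
Qed.

Lemma basis_std_word (R : comNzRingType) (X Y : 'M[R]_3) i k j : (i <= 2)%N -> (j <= 2)%N ->
  basis X Y [:: 0; j; 0; k; 0; 0; 0; 0; i; 0]%N = wev X Y (std_word i k j).
Proof.
move=> hi hj; rewrite /basis /basis_word /basis_traces /=.
rewrite !modn_small ?ltnS // !divn_small ?ltnS //.
by rewrite /tmon big_nil mul1r.
Qed.

Lemma tmon_letter (R : comNzRingType) (X Y : 'M[R]_3) (b : bool) w0 ws :
  (if b then Y else X) * tmon X Y w0 ws = tmon X Y (b :: w0) ws.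
Proof.
rewrite /tmon /wev big_cons; move: (if b then Y else X) (\prod_(w <- ws) _) => M p.
by rewrite !mulrA; congr (_ * _); exact: scalar_mxC.
Qed.

Lemma tmon_nil (R : comNzRingType) (X Y : 'M[R]_3) w0 : tmon X Y w0 [::] = wev X Y w0.
Proof. by rewrite /tmon big_nil mul1r. Qed.

Lemma basis_traces_short s : all (mem short_words) (basis_traces s).
Proof. by rewrite /basis_traces !all_cat !all_nseq /= !orbT. Qed.

(** * The candidate basis spans *)

Section Spanning.
Variable F : fieldType.
Hypothesis charF0 : [pchar F] =i pred0.
Notation genpoly := (genpoly F).
Notation genmat := (genmat F).
Let X : genmat := generic_mx F 0.
Let Y : genmat := generic_mx F 1.
Notation mX := (X : 'M[genpoly]_3).

Definition gbasis (s : seq nat) : genmat := basis (generic_mx F 0 : 'M[genpoly]_3) (generic_mx F 1) s.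

Definition in_span (M : genmat) : Prop :=
  exists2 l : seq (F * seq nat), all (fun p => size p.2 == 10%N) l &
    M = \sum_(p <- l) p.1 *: gbasis p.2.

Lemma in_span0 : in_span 0.
Proof. by exists [::]; rewrite ?big_nil. Qed.

Lemma in_spanD A B : in_span A -> in_span B -> in_span (A + B).
Proof.
move=> [l hl ->] [l' hl' ->]; exists (l ++ l'); first by rewrite all_cat hl hl'.
by rewrite big_cat.
Qed.

Lemma in_spanZ (c : F) A : in_span A -> in_span (c *: A).
Proof.
move=> [l hl ->]; exists [seq (c * p.1, p.2) | p <- l].
  by rewrite all_map.
by rewrite big_map scaler_sumr; apply: eq_bigr => p _; rewrite scalerA.
Qed.

Lemma in_spanN A : in_span A -> in_span (- A).
Proof. by move=> hA; rewrite -scaleN1r; exact: in_spanZ. Qed.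

Lemma in_span_div A n : in_span (A *+ n.+1) -> in_span A.
Proof.
move=> /(in_spanZ (n.+1%:R^-1)); rewrite -scaler_nat scalerA mulVf ?scale1r //.
by have /pcharf0P -> := charF0.
Qed.

Lemma in_span_basis s : size s = 10%N -> in_span (gbasis s).
Proof. by move=> hs; exists [:: (1, s)]; rewrite /= ?hs // big_seq1 scale1r. Qed.

Lemma in_span_sub (f : genmat -> genmat) : linear f ->
  (forall s, size s = 10%N -> in_span (f (gbasis s))) -> forall A, in_span A -> in_span (f A).
Proof.
move=> flin fb A [l hl ->].
have f0 : f 0 = 0.
  by have := flin 1 0 0; rewrite !scale1r addr0 => /(congr1 (fun x => x - f 0)); rewrite subrr addrK.
elim: l hl => [|p l IH] /=; first by rewrite big_nil f0 => _; exact: in_span0.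
move=> /andP[/eqP hp /IH h]; rewrite big_cons flin.
by apply: in_spanD => //; apply: in_spanZ; exact: fb.
Qed.

Lemma mulmx_linear (M : genmat) : linear (fun A : genmat => M * A).
Proof. by move=> c A B; rewrite mulrDr -scalerAr. Qed.

Let coef (p : genpoly) : Prop := coefficient (in_span : 'M[genpoly]_3 -> Prop) p.

Lemma short_word_coef w : w \in short_words -> coef (wtr mX Y w).
Proof.
move=> hw A hA; apply: (in_span_sub (f := fun A : genmat => (wtr mX Y w)%:M * A)) => //.
  exact: mulmx_linear.
move=> s hs; rewrite /gbasis (bump_indexP _ _ _ hw).
by apply: in_span_basis; rewrite bump_size.
Qed.

Let cX : coef (\tr X). Proof. by rewrite -(wtr1 mX Y false); exact: short_word_coef. Qed.
Let cY : coef (\tr Y). Proof. by rewrite -(wtr1 mX Y true); exact: short_word_coef. Qed.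
Let cXX : coef (\tr (X * X)). Proof. by rewrite -(wtr2 mX Y false false); exact: short_word_coef. Qed.
Let cXY : coef (\tr (X * Y)). Proof. by rewrite -(wtr2 mX Y false true); exact: short_word_coef. Qed.
Let cYY : coef (\tr (Y * Y)). Proof. by rewrite -(wtr2 mX Y true true); exact: short_word_coef. Qed.
Let cXXX : coef (\tr (X * X * X)). Proof. by rewrite -(wtr3 mX Y false false false); exact: short_word_coef. Qed.
Let cXXY : coef (\tr (X * X * Y)). Proof. by rewrite -(wtr3 mX Y false false true); exact: short_word_coef. Qed.
Let cXYY : coef (\tr (X * Y * Y)). Proof. by rewrite -(wtr3 mX Y false true true); exact: short_word_coef. Qed.
Let cYYY : coef (\tr (Y * Y * Y)). Proof. by rewrite -(wtr3 mX Y true true true); exact: short_word_coef. Qed.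

Lemma std_word_in_span i k j : (i <= 2)%N -> (j <= 2)%N -> in_span (wev mX Y (std_word i k j)).
Proof.
move=> hi hj; rewrite -basis_std_word //; exact: in_span_basis.
Qed.

Lemma word_in_span w : in_span (wev mX Y w).
Proof.
refine (@words_in_span genpoly X Y in_span in_spanD in_spanN in_span_div
  cX cY cXX cXY cYY cXXX cXXY cXYY cYYY std_word_in_span w).
Qed.

Lemma short_tmon_in_span w0 ws : all (mem short_words) ws -> in_span (tmon mX Y w0 ws).
Proof.
elim: ws => [|w ws IH] /=; first by move=> _; rewrite tmon_nil; exact: word_in_span.
by move=> /andP[hw /IH h]; rewrite tmon_cons; exact: short_word_coef.
Qed.

Let mult := multiplier (in_span : 'M[genpoly]_3 -> Prop).

(** A letter in front of a normal word gives a word, which is in the span by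
    [word_in_span]. *)
Lemma letter_multiplier (b : bool) : mult (if b then Y else X).
Proof.
move=> A hA; apply: (in_span_sub (f := fun A : genmat => (if b then Y else X) * A)) => //.
  exact: mulmx_linear.
move=> s hs; have -> : (if b then Y else X) * gbasis s = tmon mX Y (b :: basis_word s) (basis_traces s).
  exact: tmon_letter.
exact/short_tmon_in_span/basis_traces_short.
Qed.

(** The multipliers of the span form an algebra containing X, Y and the nine short
    traces, so [scal_in_words] applies to it. *)
Lemma trace_coef w : coef (wtr mX Y w).
Proof.
have mD A B : mult A -> mult B -> mult (A + B).
  by move=> hA hB C hC; rewrite mulrDl; apply: in_spanD; [exact: hA|exact: hB].
have mN A : mult A -> mult (- A).
  by move=> hA C hC; rewrite mulNr; apply: in_spanN; exact: hA.
have mM A B : mult A -> mult B -> mult (A * B).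
  by move=> hA hB C hC; rewrite -mulrA; apply: hA; exact: hB.
have m1 : mult 1 by move=> A; rewrite mul1r.
have mdiv A n : mult (A *+ n.+1) -> mult A.
  by move=> h C hC; apply: (@in_span_div _ n); rewrite -mulrnAl; exact: h.
exact: (@scal_in_words genpoly X Y mult m1 mD mN mM mdiv (letter_multiplier false) (letter_multiplier true)
  cX cY cXX cXY cYY cXXX cXXY cXYY cYYY).
Qed.

End Spanning.

Section Renaming.
Variable F : fieldType.
Notation genpoly := (genpoly F).
Notation genmat := (genmat F).
Implicit Types (f g : nat -> nat) (M N : genmat) (p : genpoly).

Definition ren_poly f : genpoly -> genpoly := geval (in_alg genpoly) (fun v => var F (rename f v)).
HB.instance Definition _ f := GRing.RMorphism.copy (ren_poly f) (geval (in_alg genpoly) (fun v => var F (rename f v))).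

(** The endomorphism that renames the generic matrices along f. The action of
    permutations and restitution are both of this form. *)
Definition ren f : genmat -> genmat := map_mx (ren_poly f).

Lemma ren_polyZ f c p : ren_poly f (c *: p) = c *: ren_poly f p.
Proof. exact: gensubstZ. Qed.

Lemma renD f M N : ren f (M + N) = ren f M + ren f N.
Proof. exact: (map_mxD (ren_poly f)). Qed.

Lemma renM f M N : ren f (M * N) = ren f M * ren f N.
Proof. exact: (map_mxM (ren_poly f)). Qed.

Lemma ren1 f : ren f 1 = 1.
Proof. exact: (map_mx1 (ren_poly f)). Qed.

Lemma ren_scalar f p : ren f (p%:M : 'M[genpoly]_3) = (ren_poly f p)%:M :> 'M[genpoly]_3.
Proof. exact: (map_scalar_mx (ren_poly f)). Qed.

Lemma ren_trace f M : ren_poly f (\tr (M : 'M[genpoly]_3)) = \tr (ren f M : 'M[genpoly]_3).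
Proof. exact: (esym (trace_map_mx (ren_poly f) M)). Qed.

Lemma genmatZE c M i j : (c *: M) i j = c *: (M i j).
Proof. by rewrite [LHS]mxE mulr_algl. Qed.

Lemma renE f M i j : (ren f M) i j = ren_poly f (M i j).
Proof. exact: mxE. Qed.

Lemma renZ f c M : ren f (c *: M) = c *: ren f M.
Proof. apply/matrixP => i j.
apply: (etrans (renE f (c *: M) i j)).
apply: (etrans _ (esym (genmatZE c (ren f M) i j))).
apply: (etrans (congr1 (ren_poly f) (genmatZE c M i j))).
apply: (etrans (ren_polyZ f c (M i j))).
exact: (congr1 (fun x : genpoly => c *: x) (esym (renE f M i j))). Qed.

Lemma ren_linear f : linear (ren f).
Proof. by move=> c M N; rewrite renD renZ. Qed.

Lemma ren_generic f r : ren f (generic_mx F r) = generic_mx F (f r).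
Proof.
apply/matrixP => i j; apply: (etrans (renE f _ i j)).
have e s : generic_mx F s i j = var F (s, i, j) by exact: mxE.
apply: (etrans (congr1 (ren_poly f) (e r))); apply: (etrans _ (esym (e (f r)))).
exact: gevalV.
Qed.

Lemma ren_word f w : ren f (word_mx F w) = word_mx F (map f w).
Proof.
rewrite /word_mx; elim: w => [|r w IH]; first by rewrite !big_nil ren1.
by rewrite /= !big_cons renM IH ren_generic.
Qed.

Lemma ren_trace_mon f w0 ws : ren f (trace_mon F w0 ws) = trace_mon F (map f w0) (map (map f) ws).
Proof.
rewrite /trace_mon renM ren_word ren_scalar rmorph_prod big_map.
congr (_%:M * _); apply: eq_bigr => w _.
by rewrite -ren_word -ren_trace.
Qed.

Lemma monom_mvars (m : {cmonom genvar}) : exists s, m = mvars s.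
Proof.
elim/cmonom_ind: m => [|v m [s ->]]; first by exists [::]; rewrite /mvars big_nil.
by exists (v :: s); rewrite /mvars big_cons.
Qed.

Lemma genpoly_sum p : p = \sum_(m <- msupp p) p@_m *: (<< m >> : genpoly).
Proof.
rewrite [LHS]monalgE; apply: eq_bigr => m _.
by apply/malgP => m'; rewrite coefZU mcoeffU mulr_natr.
Qed.

Lemma ren_poly_sum f p : ren_poly f p = \sum_(m <- msupp p) p@_m *: ren_poly f (<< m >> : genpoly).
Proof. by rewrite {1}[p]genpoly_sum; exact: gensubst_sum. Qed.

Lemma ren_poly_mvars f s : ren_poly f (<< mvars s >> : genpoly) = << mvars (map (rename f) s) >>.
Proof. exact: gensubst_rename. Qed.

Lemma ren_poly_comp f g p : ren_poly f (ren_poly g p) = ren_poly (f \o g) p.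
Proof.
apply: (etrans (congr1 (ren_poly f) (ren_poly_sum g p))); apply: (etrans _ (esym (ren_poly_sum (f \o g) p))).
apply: (etrans (gensubst_sum _ _ _ _ _)); apply: eq_bigr => m _.
apply: (congr1 (fun x : genpoly => p@_m *: x)); have [s ->] := monom_mvars m.
apply: (etrans (congr1 (ren_poly f) (ren_poly_mvars g s))).
apply: (etrans (ren_poly_mvars f _)); apply: (etrans _ (esym (ren_poly_mvars (f \o g) s))).
by rewrite -map_comp.
Qed.

Lemma eq_ren_poly f g p : f =1 g -> ren_poly f p = ren_poly g p.
Proof.
move=> e; apply: (etrans (ren_poly_sum f p)); apply: (etrans _ (esym (ren_poly_sum g p))).
apply: eq_bigr => m _; apply: (congr1 (fun x : genpoly => p@_m *: x)); have [s ->] := monom_mvars m.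
apply: (etrans (ren_poly_mvars f s)); apply: (etrans _ (esym (ren_poly_mvars g s))).
by congr (<< mvars _ >>); apply: eq_map => v; rewrite /rename e.
Qed.

Lemma ren_comp f g M : ren f (ren g M) = ren (f \o g) M.
Proof.
apply/matrixP => i j; apply: (etrans (renE f (ren g M) i j)).
apply: (etrans (congr1 (ren_poly f) (renE g M i j))).
apply: (etrans _ (esym (renE (f \o g) M i j))); exact: ren_poly_comp.
Qed.

Lemma eq_ren f g M : f =1 g -> ren f M = ren g M.
Proof.
move=> e; apply/matrixP => i j; apply: (etrans (renE f M i j)).
apply: (etrans _ (esym (renE g M i j))); exact: eq_ren_poly.
Qed.

Lemma tmonE w0 ws : trace_mon F (map nat_of_bool w0) (map (map nat_of_bool) ws) =
  tmon (generic_mx F 0 : 'M[genpoly]_3) (generic_mx F 1) w0 ws.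
Proof.
have wE w : word_mx F (map nat_of_bool w) = wev (generic_mx F 0 : 'M[genpoly]_3) (generic_mx F 1) w.
  by rewrite /word_mx /wev big_map; apply: eq_bigr => -[].
rewrite /trace_mon /tmon wE big_map; congr (_%:M * _); apply: eq_bigr => w _.
by rewrite wE.
Qed.

Hypothesis charF0 : [pchar F] =i pred0.

Let mult := multiplier (@in_span F : 'M[genpoly]_3 -> Prop).

Lemma multD A B : mult A -> mult B -> mult (A + B).
Proof. by move=> hA hB C hC; rewrite mulrDl; apply: in_spanD; [exact: hA|exact: hB]. Qed.

Lemma multM A B : mult A -> mult B -> mult (A * B).
Proof. by move=> hA hB C hC; rewrite -mulrA; apply: hA; exact: hB. Qed.

Lemma multZ (c : F) : mult (c *: (1 : genmat)).
Proof. by move=> C hC; rewrite -[_ * C](scalerAl c (1 : genmat) C) mul1r; exact: in_spanZ. Qed.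

Lemma gen_alg_mult (S : genmat -> Prop) f :
  (forall A, S A -> mult (ren f A)) -> forall A, gen_alg S A -> mult (ren f A).
Proof.
move=> hS A; elim=> [a /hS //|c|a b _ ha _ hb|a b _ ha _ hb].
- by rewrite renZ ren1; exact: multZ.
- by rewrite renD; exact: multD.
by rewrite renM; exact: multM.
Qed.

Lemma ren_block_letter l1 w : word_mx F (map (block l1) w) =
  wev (generic_mx F 0 : 'M[genpoly]_3) (generic_mx F 1) [seq ~~ (r < l1)%N | r <- w].
Proof.
rewrite /word_mx /wev !big_map; apply: eq_bigr => r _.
by rewrite /block; case: (r < l1)%N.
Qed.

(** An element is built by sums and products, and the multipliers of the span are
    stable under both. *)
Lemma mixed_trace_mult l1 M : mixed_trace_alg M -> mult (ren (block l1) M).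
Proof.
apply: gen_alg_mult => {}M [|[p hp ->]].
  apply: gen_alg_mult => {}M [r ->]; rewrite ren_generic /block.
  by case: ifP => _; [exact: (letter_multiplier charF0 false)|exact: (letter_multiplier charF0 true)].
rewrite ren_scalar; elim: hp => [a [w ->]|c|a b _ ha _ hb|a b _ ha _ hb].
- rewrite ren_trace ren_word ren_block_letter; exact: trace_coef.
- move=> C hC; have e : ren_poly (block l1) c%:A = c%:A by exact: gevalA.
  rewrite e; have E : c *: (C : genmat) = ((c%:A : genpoly)%:M *m (C : 'M[genpoly]_3) : 'M[genpoly]_3).
    by rewrite mul_scalar_mx.
  exact: (eq_ind _ (fun A : genmat => in_span A) (in_spanZ c hC) _ E).
- have E : (ren_poly (block l1) (a + b))%:M = (ren_poly (block l1) a)%:M + (ren_poly (block l1) b)%:M :> 'M[genpoly]_3.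
    by rewrite [ren_poly _ _](rmorphD (ren_poly (block l1))); exact: (raddfD (@scalar_mx genpoly 3)).
  by rewrite E; exact: multD.
have E : (ren_poly (block l1) (a * b))%:M = (ren_poly (block l1) a)%:M *m (ren_poly (block l1) b)%:M :> 'M[genpoly]_3.
  by rewrite [ren_poly _ _](rmorphM (ren_poly (block l1))); exact: scalar_mxM.
by rewrite E; exact: multM.
Qed.

Lemma mixed_trace_in_span l1 M : mixed_trace_alg M -> in_span (ren (block l1) M).
Proof.
move=> /(@mixed_trace_mult l1 M) h.
have := h _ (word_in_span charF0 [::]); rewrite wev_nil => h1.
by apply: (eq_ind _ (fun A : genmat => in_span A) h1); exact: mulr1.
Qed.
End Renaming.

(** * First-order deformation of a nilpotent pair *)

Section FirstOrder.
Variable R : comNzRingType.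
Implicit Types (M N : 'M[{poly R}]_3).

Definition mx3 (rows : seq (seq R)) : 'M[R]_3 := \matrix_(i, j) nth 0 (nth [::] rows i) j.

Definition coef_mx (n : nat) M : 'M[R]_3 := map_mx (fun p : {poly R} => p`_n) M.

Lemma coef_mx0M M N : coef_mx 0 (M * N) = coef_mx 0 M * coef_mx 0 N.
Proof.
apply/matrixP => i j; rewrite [LHS]mxE [in LHS]mxE coef_sum [RHS]mxE.
by apply: eq_bigr => l _; rewrite !mxE coef0M.
Qed.

Lemma coef_mx1M M N : coef_mx 1 (M * N) = coef_mx 0 M * coef_mx 1 N + coef_mx 1 M * coef_mx 0 N.
Proof.
apply/matrixP => i j; rewrite [LHS]mxE [in LHS]mxE coef_sum [RHS]mxE [X in X + _]mxE [X in _ + X]mxE -big_split.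
by apply: eq_bigr => l _; rewrite !mxE coefM big_ord_recr big_ord1 /=.
Qed.

Lemma coef_trace n M : (\tr M)`_n = \tr (coef_mx n M).
Proof. by rewrite /mxtrace coef_sum; apply: eq_bigr => i _; rewrite mxE. Qed.

(** X0 = E_12 + E_23 and Y0 = E_21 - E_32 generate a nilpotent pencil: all the nine
    short traces vanish at this pair. *)
Definition X0 : 'M[R]_3 := mx3 [:: [:: 0; 1; 0]; [:: 0; 0; 1]; [:: 0; 0; 0]].
Definition Y0 : 'M[R]_3 := mx3 [:: [:: 0; 0; 0]; [:: 1; 0; 0]; [:: 0; -1; 0]].

Variable a : nat -> R.
(** The direction of deformation is chosen so that the derivatives of the nine
    short traces are nonzero multiples of nine distinct parameters. *)
Definition X1 : 'M[R]_3 := mx3 [:: [:: a 5; a 2; 0]; [:: a 8; a 6 - a 5; 0]; [:: a 7; 0; 0]].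
Definition Y1 : 'M[R]_3 := mx3 [:: [:: a 4; a 3; a 1]; [:: 0; a 0 - a 4; 0]; [:: 0; 0; 0]].

Definition Xt : 'M[{poly R}]_3 := map_mx polyC X0 + 'X *: map_mx polyC X1.
Definition Yt : 'M[{poly R}]_3 := map_mx polyC Y0 + 'X *: map_mx polyC Y1.

Lemma coef_pencil (A B : 'M[R]_3) (C := map_mx polyC A + 'X *: map_mx polyC B) :
  (coef_mx 0 C = A) * (coef_mx 1 C = B).
Proof.
by split; apply/matrixP => i j; rewrite !mxE coefD coefC coefXM coefC /= ?addr0 ?add0r.
Qed.

(** The factor of the parameter in the first-order term of each short trace. *)
Definition kappa (w : seq bool) : R := nth 0 [:: 1; -3; 1; 2; 1; 1; 1; 3; 2] (index w short_words).

Lemma short_first_order w : w \in short_words ->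
  (wtr Xt Yt w)`_0 = 0 /\ (wtr Xt Yt w)`_1 = kappa w * a (index w short_words).
Proof.
have c0X : coef_mx 0 Xt = X0 by rewrite /Xt coef_pencil.
have c0Y : coef_mx 0 Yt = Y0 by rewrite /Yt coef_pencil.
have c1X : coef_mx 1 Xt = X1 by rewrite /Xt coef_pencil.
have c1Y : coef_mx 1 Yt = Y1 by rewrite /Yt coef_pencil.
rewrite /kappa !inE; repeat case/orP; move=> /eqP ->;
  rewrite ?wtr1 ?wtr2 ?wtr3 !coef_trace ?(coef_mx1M, coef_mx0M) !(c0X, c0Y, c1X, c1Y) !tr3 ?(add3, mul3) !mxE /=;
  split; ring.
Qed.

Lemma coef_mx0_wev w : coef_mx 0 (wev Xt Yt w) = wev X0 Y0 w.
Proof.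
rewrite /wev; elim: w => [|b w IH].
  by rewrite !big_nil; apply/matrixP => i j; rewrite !mxE coefMn coef1.
by rewrite !big_cons coef_mx0M IH; case: b; rewrite /Xt /Yt coef_pencil.
Qed.

Lemma coefM_low (p q : {poly R}) n : p`_0 = 0 -> (forall m, (m < n)%N -> q`_m = 0) ->
  (p * q)`_n.+1 = p`_1 * q`_n.
Proof.
move=> p0 hq; rewrite coefM big_ord_recl p0 mul0r add0r big_ord_recl big1 ?addr0 ?subSS ?subn0 //.
by move=> l _; rewrite [q`__]hq ?mulr0 // /= /bump; have := ltn_ord l; lia.
Qed.

(** Each trace is divisible by t, so the lowest term of the product of n traces is
    t^n times the product of their first-order terms, times the word at t = 0. *)
Lemma coef_tmon w0 ws i j n : all (mem short_words) ws -> (n <= size ws)%N ->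
  (tmon Xt Yt w0 ws i j)`_n =
  (n == size ws)%:R * ((\prod_(w <- ws) (kappa w * a (index w short_words))) * wev X0 Y0 w0 i j).
Proof.
elim: ws n => [|w ws IH] n /=.
  by rewrite leqn0 => _ /eqP ->; rewrite tmon_nil big_nil !mul1r -coef_mx0_wev mxE.
move=> /andP[hw hws]; rewrite tmon_cons scal3.
have [h0 h1] := short_first_order hw.
case: n => [|n] hn; first by rewrite coef0M h0 !mul0r.
rewrite coefM_low //; last first.
  move=> m hm; have hms : (m < size ws)%N := leq_trans hm hn.
  by rewrite IH ?(ltnW hms) // ltn_eqF // mul0r.
rewrite IH // h1 big_cons eqSS.
by ring.
Qed.

Lemma row_delta (A B : 'M[R]_3) (x : R) r c : (forall l, A r l = x * (l == o2)%:R) -> (A * B) r c = x * B o2 c.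
Proof. by move=> h; rewrite mul3 !h /=; ring. Qed.

Lemma wev_std (X Y : 'M[R]_3) i k j : wev X Y (std_word i k j) = X ^+ i * ((Y * X) ^+ k * Y ^+ j).
Proof.
rewrite /std_word !wev_cat; congr (_ * (_ * _)).
- by elim: i => [|i IH]; rewrite /= ?wev_nil // -[LHS]/(wev X Y ([:: false] ++ _)) wev_cat IH exprS /wev big_seq1.
- elim: k => [|k IH]; rewrite /= ?wev_nil //.
  by rewrite -[LHS]/(wev X Y ([:: true; false] ++ _)) wev_cat IH exprS /wev !big_cons big_nil mulr1.
by elim: j => [|j IH]; rewrite /= ?wev_nil // -[LHS]/(wev X Y ([:: true] ++ _)) wev_cat IH exprS /wev big_seq1.
Qed.

Definition neg3 (i : nat) : 'I_3 := inord (2 - i).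

Lemma neg3E : (neg3 0 = o2) * (neg3 1 = o1) * (neg3 2 = o0).
Proof. by do !split; apply: val_inj; rewrite /= inordK. Qed.

(** X0 shifts row vectors one step towards the last basis vector, which it kills. *)
Lemma X0_row i i' l : (i <= i')%N -> (i' <= 2)%N -> (X0 ^+ i') (neg3 i) l = (i == i')%:R * (l == o2)%:R.
Proof.
case: i' => [|[|[|i']]] //; case: i => [|[|[|i]]] // _ _; rewrite ?neg3E; move: l; apply: ord3P;
 rewrite ?expr0 ?expr1 ?expr2 ?mul3 ?one3 ?mxE /=; ring.
Qed.

Lemma YX_row k l : ((Y0 * X0) ^+ k) o2 l = (-1) ^+ k * (l == o2)%:R.
Proof.
elim: k l => [|k IH] l; first by rewrite !expr0 one3 mul1r eq_sym.
rewrite exprSr (@row_delta _ _ ((-1) ^+ k)) //.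
by rewrite exprS mul3; move: l; apply: ord3P; rewrite /= !mxE /=; ring.
Qed.

Lemma word_entry_vanish i i' k j c : (i < i')%N -> (i' <= 2)%N ->
  wev X0 Y0 (std_word i' k j) (neg3 i) c = 0.
Proof.
move=> h1 h2; rewrite wev_std (@row_delta _ _ (0)) ?mul0r // => l.
by rewrite X0_row ?(ltnW h1) // ltn_eqF.
Qed.

(** Y0 X0 is diagonal with eigenvalue -1 on the last basis vector, and powers of Y0
    bring that vector back down the chain, up to sign. *)
Lemma word_entry i k j : (i <= 2)%N -> (j <= 2)%N ->
  wev X0 Y0 (std_word i k j) (neg3 i) (neg3 j) = (-1) ^+ (k + (0 < j)%N).
Proof.
move=> hi hj; rewrite wev_std (@row_delta _ _ (1)); last by move=> l; rewrite X0_row // eqxx.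
rewrite mul1r (@row_delta _ _ ((-1) ^+ k)); last exact: YX_row.
rewrite exprD; congr (_ * _).
by case: j hj => [|[|[|j]]] // _; rewrite ?neg3E ?expr0 ?expr1 ?expr2 ?mul3 ?one3 ?mxE /=; ring.
Qed.

End FirstOrder.

Lemma mem_sols10 a b s : s \in sols wts10 a b -> size s = 10%N /\ weight wts10 s = (a, b).
Proof. by rewrite mem_sols // => /andP[/eqP hs /eqP hw]. Qed.

(** For fixed traces, the bidegree determines the exponents of YX and Y from that
    of X. *)
Lemma basis_index_eq a b (s t : seq nat) : s \in sols wts10 a b -> t \in sols wts10 a b ->
  (forall w, w \in short_words -> count_mem w (basis_traces s) = count_mem w (basis_traces t)) ->
  (nth 0 s 8 %% 3 = nth 0 t 8 %% 3)%N -> s = t.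
Proof.
move=> /mem_sols10[hs ws] /mem_sols10[ht wt] hc hi.
have key (w : seq bool) : w \in short_words -> count_mem w (basis_traces s) = count_mem w (basis_traces t) by exact: hc.
have k0 := key [:: true] isT; have k1 := key [:: true; true; true] isT.
have k2 := key [:: false; true] isT; have k3 := key [:: true; true] isT.
have k4 := key [:: false; true; true] isT; have k5 := key [:: false; false; true] isT.
have k6 := key [:: false] isT; have k7 := key [:: false; false; false] isT.
have k8 := key [:: false; false] isT.
move: k0 k1 k2 k3 k4 k5 k6 k7 k8; rewrite /basis_traces !count_cat !count_nseq /=.
rewrite !mul0n !mul1n !addn0 !add0n => k0 k1 k2 k3 k4 k5 k6 k7 k8 {key hc}.
case: s hs ws hi k0 k1 k2 k3 k4 k5 k6 k7 k8 => [//|s0 [//|s1 [//|s2 [//|s3 [//|s4 [//|s5 [//|s6 [//|s7 [//|s8 [//|s9 [|//]]]]]]]]]]] _.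
case: t ht wt => [//|t0 [//|t1 [//|t2 [//|t3 [//|t4 [//|t5 [//|t6 [//|t7 [//|t8 [//|t9 [|//]]]]]]]]]]] _.
rewrite /weight /= => -[<- <-] [ea eb] hi k0 k1 k2 k3 k4 k5 k6 k7 k8.
have e8 : s8 = t8 by rewrite (divn_eq s8 3) k7 hi -divn_eq.
have e3 : s3 = t3 by move: ea; rewrite k0 k2 k3 k4 k5 k6 k8 e8; lia.
have e1 : s1 = t1 by move: eb; rewrite k0 k2 k3 k4 k5 k6 k8 e8 e3; lia.
by congr [:: _; _; _; _; _; _; _; _; _; _].
Qed.

Lemma kappa_morph (R S : comNzRingType) (f : {rmorphism R -> S}) w : kappa S w = f (kappa R w).
Proof.
rewrite /kappa; case: (ltnP (index w short_words) 9) => h; last by rewrite !nth_default ?rmorph0.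
rewrite -(nth_map 0 0 f) //; congr nth.
by rewrite /= !(rmorphN, rmorph_nat, rmorph1).
Qed.

Lemma kappa_neq0 (F : fieldType) (w : seq bool) : [pchar F] =i pred0 -> w \in short_words -> kappa F w != 0.
Proof.
move=> /pcharf0P c0 hw; rewrite /kappa -index_mem in hw *.
have : all (fun x : F => x != 0) [:: 1; -3; 1; 2; 1; 1; 1; 3; 2].
  by rewrite /= !oppr_eq0 !c0 oner_neq0.
by move=> /all_nthP; apply.
Qed.

Lemma kappa_prod_neq0 (F : fieldType) (ws : seq (seq bool)) : [pchar F] =i pred0 ->
  all (mem short_words) ws -> \prod_(w <- ws) kappa F w != 0.
Proof.
move=> c0; elim: ws => [|w ws IH] /=; first by rewrite big_nil oner_neq0.
by move=> /andP[hw /IH h]; rewrite big_cons mulf_neq0 // kappa_neq0.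
Qed.

Lemma map_wev (R S : comNzRingType) (f : {rmorphism R -> S}) (X Y : 'M[R]_3) w :
  map_mx f (wev X Y w) = wev (map_mx f X) (map_mx f Y) w.
Proof.
rewrite /wev; elim: w => [|b w IH]; first by rewrite !big_nil map_mx1.
by rewrite !big_cons map_mxM IH; case: b.
Qed.

Lemma map_tmon (R S : comNzRingType) (f : {rmorphism R -> S}) (X Y : 'M[R]_3) w0 ws :
  map_mx f (tmon X Y w0 ws) = tmon (map_mx f X) (map_mx f Y) w0 ws.
Proof.
rewrite /tmon map_mxM map_wev map_scalar_mx rmorph_prod; congr (_%:M * _).
by apply: eq_bigr => w _; rewrite /wtr -map_wev trace_map_mx.
Qed.

Lemma wev0_morph (R S : comNzRingType) (f : {rmorphism R -> S}) w i j :
  wev (X0 S) (Y0 S) w i j = f (wev (X0 R) (Y0 R) w i j).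
Proof.
have eX : map_mx f (X0 R) = X0 S.
  by apply/matrixP; apply: ord3P; apply: ord3P; rewrite !mxE /= ?rmorph0 ?rmorph1.
have eY : map_mx f (Y0 R) = Y0 S.
  by apply/matrixP; apply: ord3P; apply: ord3P; rewrite !mxE /= ?rmorphN ?rmorph0 ?rmorph1.
by have := map_wev f (X0 R) (Y0 R) w; rewrite eX eY => <-; rewrite mxE.
Qed.

(** * Linear independence *)

Section Independence.
Variable F : fieldType.
Hypothesis charF0 : [pchar F] =i pred0.
Notation genpoly := (genpoly F).
Notation genmat := (genmat F).

Definition param (n : nat) : genvar := (n, o0, o0).
Definition param_var (n : nat) : genpoly := var F (param n).

Definition pencil (v : genvar) : {poly genpoly} :=
  (if v.1.1 == 0%N then Xt param_var else Yt param_var) v.1.2 v.2.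

Definition scalar_poly : F -> {poly genpoly} := polyC \o in_alg genpoly.
HB.instance Definition _ := GRing.RMorphism.copy scalar_poly (polyC \o in_alg genpoly).

(** Evaluation of X and Y at the deformed pair, with nine variables of the
    algebra itself as parameters. *)
Definition ev : genpoly -> {poly genpoly} := geval scalar_poly pencil.
HB.instance Definition _ := GRing.RMorphism.copy ev (geval scalar_poly pencil).

Lemma ev_generic r : (r < 2)%N -> map_mx ev (generic_mx F r : 'M[genpoly]_3) = if r == 0%N then Xt param_var else Yt param_var.
Proof.
move=> hr; apply/matrixP => i j; rewrite [LHS]mxE.
have e : generic_mx F r i j = var F (r, i, j) by exact: mxE.
by apply: (etrans (congr1 ev e)); exact: gevalV.
Qed.

Lemma ev_basis s r c : ev (gbasis F s r c) = tmon (Xt param_var) (Yt param_var) (basis_word s) (basis_traces s) r c.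
Proof.
have E0 : map_mx ev (generic_mx F 0 : 'M[genpoly]_3) = Xt param_var by exact: (@ev_generic 0 isT).
have E1 : map_mx ev (generic_mx F 1 : 'M[genpoly]_3) = Yt param_var by exact: (@ev_generic 1 isT).
have H := etrans (map_tmon ev _ _ _ _) (f_equal2 (fun A B => tmon A B (basis_word s) (basis_traces s)) E0 E1).
apply: (etrans _ (congr1 (fun M : 'M[{poly genpoly}]_3 => M r c) H)).
by apply: esym; exact: mxE.
Qed.

(** The coefficient of t^n and of a monomial m in the parameters, after
    evaluation at the deformed pair. *)
Definition functional n (m : {cmonom genvar}) (p : genpoly) : F := ((ev p)`_n)@_m.

Lemma functionalD n m p q : functional n m (p + q) = functional n m p + functional n m q.
Proof.
rewrite /functional; have -> : ev (p + q) = ev p + ev q by exact: rmorphD.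
by rewrite coefD; exact: mcoeffD.
Qed.

Lemma functional0 n m : functional n m 0 = 0.
Proof.
rewrite /functional; have -> : ev 0 = 0 by exact: rmorph0.
by rewrite coef0; exact: mcoeff0.
Qed.

Lemma functionalZ n m c p : functional n m (c *: p) = c * functional n m p.
Proof.
rewrite /functional; have -> : ev (c *: p) = (c%:A : genpoly)%:P * ev p.
  rewrite -[c *: p]mulr_algl; have -> : ev (c%:A * p) = ev c%:A * ev p by exact: rmorphM.
  by congr (_ * _); exact: gevalA.
rewrite coefCM; have -> : (c%:A : genpoly) * (ev p)`_n = c *: (ev p)`_n by exact: mulr_algl.
exact: mcoeffZ.
Qed.

Lemma functional_sum n m (l : seq (seq nat)) (c : seq nat -> F) (g : seq nat -> genpoly) :
  functional n m (\sum_(s <- l) c s *: g s) = \sum_(s <- l) c s * functional n m (g s).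
Proof.
elim: l => [|s l IH]; first by rewrite !big_nil functional0.
by rewrite !big_cons functionalD functionalZ IH.
Qed.

Definition letter_var (w : seq bool) : genvar := param (index w short_words).

Definition lead_monom (s : seq nat) : {cmonom genvar} := mvars (map letter_var (basis_traces s)).

Lemma prod_kappa ws : \prod_(w <- ws) (kappa genpoly w * param_var (index w short_words)) =
  (\prod_(w <- ws) kappa F w) *: (<< mvars (map letter_var ws) >> : genpoly).
Proof.
rewrite big_split /= -[RHS]mulr_algl; congr (_ * _).
  transitivity (in_alg genpoly (\prod_(w <- ws) kappa F w)); last by [].
  by rewrite rmorph_prod; apply: eq_bigr => w _; exact: kappa_morph.
by rewrite -prod_var big_map.
Qed.

Lemma functional_basis n m s r c : (n <= size (basis_traces s))%N ->
  functional n m (gbasis F s r c) = (n == size (basis_traces s))%:R *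
    (wev (X0 F) (Y0 F) (basis_word s) r c * (\prod_(w <- basis_traces s) kappa F w) * (lead_monom s == m)%:R).
Proof.
move=> hn; rewrite /functional ev_basis coef_tmon ?basis_traces_short // prod_kappa.
rewrite (wev0_morph (in_alg genpoly)); case: eqP => _; last first.
  by rewrite !mul0r; exact: mcoeff0.
rewrite !mul1r; move: (wev _ _ _ _ _) => x.
have -> p : p * in_alg genpoly x = x *: p by rewrite mulr_algr.
rewrite scalerA; exact: coefZU.
Qed.

(** Orders the candidate basis by number of traces, then by the power of X. *)
Definition lead_order (s : seq nat) : nat := (size (basis_traces s) * 3 + nth 0%N s 8 %% 3)%N.

(** The functional adapted to the index t: number of traces, monomial in the
    parameters and matrix entry are those at which t shows up first. *)
Definition pairing (s t : seq nat) : F :=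
  functional (size (basis_traces t)) (lead_monom t)
    (gbasis F s (neg3 (nth 0%N t 8 %% 3)) (neg3 (nth 0%N t 1 %% 3))).

Let le2 n : (n %% 3 <= 2)%N. Proof. by rewrite -ltnS ltn_mod. Qed.

Lemma pairing_diag s : pairing s s != 0.
Proof.
rewrite /pairing functional_basis // !eqxx mul1r mulr1 /basis_word word_entry //.
by rewrite mulf_neq0 ?signr_eq0 // kappa_prod_neq0 // basis_traces_short.
Qed.

Lemma count_letter_var w ws : w \in short_words -> all (mem short_words) ws ->
  count_mem (letter_var w) (map letter_var ws) = count_mem w ws.
Proof.
move=> hw hws; rewrite count_map; apply: eq_in_count => w' /(allP hws) hw' /=.
apply/eqP/eqP => [h|-> //].
have e : index w' short_words = index w short_words := congr1 (fun v : genvar => v.1.1) h.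
by rewrite -(nth_index [::] hw) -(nth_index [::] hw') e.
Qed.

(** The matrix of pairings is triangular for [lead_order]. More traces mean a
    higher power of t, different traces another monomial, and a higher power of
    X a vanishing row; otherwise the indices agree by [basis_index_eq]. *)
Lemma pairing_vanish a b s t : s \in sols wts10 a b -> t \in sols wts10 a b ->
  (lead_order t <= lead_order s)%N -> s != t -> pairing s t = 0.
Proof.
move=> hs ht hmu st; rewrite /pairing.
have hts : (size (basis_traces t) <= size (basis_traces s))%N.
  by move: hmu (le2 (nth 0%N t 8)) (le2 (nth 0%N s 8)); rewrite /lead_order; lia.
rewrite functional_basis //; case: eqP => [hsz|_]; last by rewrite mul0r.
case: eqP => [hm|_]; last by rewrite !mulr0.
case: (ltnP (nth 0%N t 8 %% 3) (nth 0%N s 8 %% 3)) => hi.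
  by rewrite /basis_word word_entry_vanish // !mul0r mulr0.
case/eqP: st; apply: (basis_index_eq hs ht); last first.
  by move: hmu; rewrite /lead_order hsz; lia.
move=> w hw; rewrite -(count_letter_var hw (basis_traces_short s)) -(count_letter_var hw (basis_traces_short t)).
by rewrite -!mvarsE -/(lead_monom s) hm.
Qed.

(** Induction along the triangular matrix of pairings. *)
Lemma basis_independent a b (c : seq nat -> F) : \sum_(s <- sols wts10 a b) c s *: gbasis F s = 0 ->
  forall s, s \in sols wts10 a b -> c s = 0.
Proof.
move=> h t; have [n] := ubnP (lead_order t); elim: n t => // n IH t hn ht.
have entry i j : \sum_(s <- sols wts10 a b) c s *: gbasis F s i j = 0.
  have e0 : (0 : genmat) i j = 0 by exact: mxE.
  apply: (etrans _ (etrans (congr1 (fun M : genmat => M i j) h) e0)).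
  elim: (sols _ _ _) => [|s l IHl]; first by rewrite !big_nil e0.
  rewrite [LHS]big_cons IHl [in RHS]big_cons; apply: esym.
  apply: (etrans (mxE _ _ _ _)); congr (_ + _); exact: genmatZE.
have H : \sum_(s <- sols wts10 a b) c s * pairing s t = 0.
  apply: (etrans (esym (functional_sum _ _ _ _ _))).
  apply: (etrans (congr1 _ (entry _ _))); exact: functional0.
have := H; rewrite (bigD1_seq t ht (sols_uniq _ _ _)) big_seq_cond big1 ?addr0.
  move=> h0; have /eqP : c t * pairing t t = 0 by rewrite -[RHS]h0; apply: esym; exact: addr0.
  by rewrite mulf_eq0 (negbTE (pairing_diag t)) orbF => /eqP.
move=> s /andP[hs st]; case: (leqP (lead_order t) (lead_order s)) => hmu.
  by rewrite (pairing_vanish hs ht hmu st) mulr0.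
by rewrite IH ?mul0r //; exact: leq_trans hmu hn.
Qed.

End Independence.

(** * Bidegrees *)

Definition letters (s : seq nat) : seq bool := basis_word s ++ flatten (basis_traces s).

Lemma count_letters s : size s = 10%N ->
  (count_mem false (letters s), count_mem true (letters s)) = weight wts10 s.
Proof.
rewrite /letters /basis_word /basis_traces /std_word.
case: s => [//|s0 [//|s1 [//|s2 [//|s3 [//|s4 [//|s5 [//|s6 [//|s7 [//|s8 [//|s9 [|//]]]]]]]]]]] _.
rewrite /weight !count_cat !flatten_cat !count_cat !count_nseq !count_flatten !map_nseq !sumn_nseq /=.
have := divn_eq s8 3; have := divn_eq s1 3.
move: (s8 %/ 3)%N (s8 %% 3)%N (s1 %/ 3)%N (s1 %% 3)%N => a b c d -> ->.
by congr (_, _); lia.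
Qed.

Lemma regroup_combination (K : fieldType) (V : lmodType K) (J : eqType) (B : J -> V) (l : seq (K * J)) (ss : seq J) :
  uniq ss -> exists c : J -> K, \sum_(p <- l | p.2 \in ss) p.1 *: B p.2 = \sum_(s <- ss) c s *: B s.
Proof.
move=> us; elim: l => [|p l [c hc]].
  by exists (fun=> 0); rewrite big_nil big1 // => s _; rewrite scale0r.
rewrite big_cons hc; case: ifP => hp; last by exists c.
exists (fun s => (s == p.2)%:R * p.1 + c s).
rewrite [RHS](eq_bigr (fun s => ((s == p.2)%:R * p.1) *: B s + c s *: B s)); last first.
  by move=> s _; rewrite scalerDl.
rewrite big_split /=; congr (_ + _).
rewrite (bigD1_seq p.2) //= eqxx mul1r big1 ?addr0 // => s /negbTE ->.
by rewrite mul0r scale0r.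
Qed.

Section Degrees.
Variable F : fieldType.
Hypothesis charF0 : [pchar F] =i pred0.
Notation genpoly := (genpoly F).
Notation genmat := (genmat F).

Definition supported (P : {cmonom genvar} -> Prop) (p : genpoly) : Prop :=
  forall m, m \in msupp p -> P m.

Lemma supported0 P : supported P 0.
Proof. by move=> m; rewrite msupp0. Qed.

Lemma supportedD P p q : supported P p -> supported P q -> supported P (p + q).
Proof.
move=> hp hq m /(fsubsetP (msuppD_le p q)); rewrite in_fsetU => /orP[/hp|/hq]; exact.
Qed.

Lemma supportedZ P c p : supported P p -> supported P (c *: p).
Proof. by move=> hp m /(fsubsetP (msuppZ_le c p)) /hp. Qed.

Lemma supportedU (P : {cmonom genvar} -> Prop) m : P m -> supported P (<< m >> : genpoly).
Proof.
move=> hm m'; rewrite -mcoeff_neq0 mcoeffU; case: (eqVneq m m') => [<- //|_].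
by rewrite mulr0n eqxx.
Qed.

Lemma supported_disjoint (P : {cmonom genvar} -> Prop) p :
  supported P p -> supported (fun m => ~ P m) p -> p = 0.
Proof.
move=> h h'; apply/malgP => m; rewrite mcoeff0; apply/eqP; apply/negPn/negP.
by rewrite mcoeff_neq0 => hm; exact: (h' m hm (h m hm)).
Qed.

Lemma deg_in_mvars r s : deg_in r (mvars s) = count (fun v : genvar => v.1.1 == r) s.
Proof.
elim: s => [|v s IH].
  by rewrite /mvars big_nil /deg_in big1 // => a _; rewrite big1 // => b _; rewrite cm1.
rewrite /= -IH; have -> : mvars (v :: s) = mmul (ucm v) (mvars s) by rewrite /mvars big_cons.
have -> : deg_in r (mmul (ucm v) (mvars s)) = (deg_in r (ucm v) + deg_in r (mvars s))%N.
  by rewrite /deg_in -big_split; apply: eq_bigr => a _; rewrite -big_split; apply: eq_bigr => b _; rewrite cmM.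
congr (_ + _)%N; case: v => [[i a] b]; rewrite eq_sym.
apply: (@multideg_var F i a b); rewrite /var -mcoeff_neq0.
have -> : (<< ucm (i, a, b) >> : genpoly)@_(ucm ((i, a, b) : genvar)) = 1 by exact: mcoeffUU.
exact: oner_neq0.
Qed.

Variables (k l1 l2 : nat).
Hypothesis l12 : (l1 + l2)%N = k.

Definition bidegree (m : {cmonom genvar}) : Prop := deg_in 0 m = l1 /\ deg_in 1 m = l2.

Lemma bidegree_restitution (p : genpoly) : multideg (fun r => (r < k)%N : nat) p ->
  supported bidegree (ren_poly (block l1) p).
Proof.
move=> hp; rewrite ren_poly_sum.
have : {subset (msupp p : seq _) <= msupp p} by [].
elim: (msupp p : seq _) => [|m l IH] hl; first by rewrite big_nil; exact: supported0.
rewrite big_cons; apply: supportedD; last first.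
  by apply: IH => x hx; apply: hl; rewrite in_cons hx orbT.
apply: supportedZ; have hm : m \in msupp p by apply: hl; rewrite in_cons eqxx.
have [c ->] := multilin_monom (hp m hm).
rewrite ren_poly_mvars; apply: supportedU; rewrite /bidegree !deg_in_mvars /pvars -!map_comp !count_map.
have e (P : pred nat) : count (fun r : 'I_k => P r) (enum 'I_k) = count P (iota 0 k).
  by rewrite -val_enum_ord count_map.
have h1 : count (fun r => r < l1)%N (iota 0 l1) = l1.
  by rewrite -[RHS](size_iota 0) -[RHS]count_predT; apply: eq_in_count => r; rewrite mem_iota.
have h2 : count (fun r => r < l1)%N (iota (0 + l1) l2) = 0%N.
  by apply/eqP; rewrite -leqn0 leqNgt -has_count; apply/hasPn => r; rewrite mem_iota -leqNgt => /andP[].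
have h3 : count (fun r => ~~ (r < l1)%N) (iota 0 l1) = 0%N.
  by apply/eqP; rewrite -leqn0 leqNgt -has_count; apply/hasPn => r; rewrite mem_iota negbK => /andP[].
have h4 : count (fun r => ~~ (r < l1)%N) (iota (0 + l1) l2) = l2.
  rewrite -[RHS](size_iota (0 + l1)) -[RHS]count_predT; apply: eq_in_count => r; rewrite mem_iota -leqNgt.
  by case/andP.
split.
  apply: (etrans (eq_count (a2 := fun r : 'I_k => (r < l1)%N) _ _)).
    by move=> r /=; rewrite /block; case: (r < l1)%N.
  by rewrite -?enumT; apply: (etrans (e (fun r => r < l1)%N)); rewrite -l12 iotaD count_cat h1 h2 addn0.
apply: (etrans (eq_count (a2 := fun r : 'I_k => ~~ (r < l1)%N) _ _)).
  by move=> r /=; rewrite /block; case: (r < l1)%N.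
by rewrite -?enumT; apply: (etrans (e (fun r => ~~ (r < l1))%N)); rewrite -l12 iotaD count_cat h3 h4.
Qed.

Lemma supported_basis s i j : size s = 10%N ->
  supported (fun m => (deg_in 0 m, deg_in 1 m) = weight wts10 s) (gbasis F s i j).
Proof.
move=> hs m; rewrite /gbasis /basis -tmonE => hm.
rewrite -count_letters // !(multideg_trace_mon hm) -map_flatten -map_cat !count_map.
by congr (_, _); apply: eq_count; case.
Qed.

(** The part of the combination outside the bidegree (l1, l2) is also a difference
    of elements of that bidegree, so it is zero. *)
Lemma span_bidegree (l : seq (F * seq nat)) (N : genmat) : all (fun p => size p.2 == 10%N) l ->
  N = \sum_(p <- l) p.1 *: gbasis F p.2 -> (forall i j, supported bidegree (N i j)) ->
  N = \sum_(p <- l | p.2 \in sols wts10 l1 l2) p.1 *: gbasis F p.2.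
Proof.
move=> hl hN hdeg.
pose N1 : genmat := \sum_(p <- l | p.2 \in sols wts10 l1 l2) p.1 *: gbasis F p.2.
pose N2 : genmat := \sum_(p <- l | p.2 \notin sols wts10 l1 l2) p.1 *: gbasis F p.2.
have eN : N = N1 + N2 by rewrite hN (bigID (fun p : F * seq nat => p.2 \in sols wts10 l1 l2)).
have supp_sum (Q : pred (F * seq nat)) (P : {cmonom genvar} -> Prop) i j :
   (forall p, size p.2 = 10%N -> Q p -> supported P (gbasis F p.2 i j)) ->
   supported P ((\sum_(p <- l | Q p) p.1 *: gbasis F p.2 : genmat) i j).
  move=> hQ; elim: l hl {hN N1 N2 eN} => [|p l' IH] /=.
    move=> _; rewrite big_nil; have -> : (0 : genmat) i j = 0 by exact: mxE.
    exact: supported0.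
  move=> /andP[/eqP hp /IH h]; rewrite big_cons; case: ifP => // hq.
  have -> (A B : genmat) : (A + B) i j = A i j + B i j by exact: mxE.
  apply: supportedD; last exact: h.
  have -> : (p.1 *: gbasis F p.2) i j = p.1 *: (gbasis F p.2 i j) by exact: genmatZE.
  by apply: supportedZ; exact: hQ.
suff N20 : N2 = 0 by rewrite eN N20 addr0.
apply/matrixP => i j; have -> : (0 : genmat) i j = 0 by exact: mxE.
apply: (@supported_disjoint bidegree).
  have -> : N2 = N + (- 1) *: N1 by rewrite eN scaleN1r addrAC subrr add0r.
  have -> (A B : genmat) : (A + B) i j = A i j + B i j by exact: mxE.
  apply: supportedD; first exact: hdeg.
  have -> : ((- 1) *: N1) i j = (- 1) *: (N1 i j) by exact: genmatZE.
  apply: supportedZ; apply: supp_sum => p hp hq m /(supported_basis hp).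
  by have [_ ->] := mem_sols10 hq => -[].
apply: supp_sum => p hp hq m /(supported_basis hp) e [d0 d1].
by move: hq; rewrite mem_sols // hp -e d0 d1 !eqxx.
Qed.

Lemma restitution_span M : mixed_trace_multilin k M ->
  exists c : seq nat -> F, ren (block l1) M = \sum_(s <- sols wts10 l1 l2) c s *: gbasis F s.
Proof.
move=> [hM hdeg]; have [l hl hN] := mixed_trace_in_span charF0 l1 hM.
have hs i j : supported bidegree (ren (block l1) M i j).
  by rewrite (renE (block l1) M i j); apply: bidegree_restitution => m hm r; exact: hdeg hm r.
rewrite (span_bidegree hl hN hs) {hl hN}.
by have [c hc] := regroup_combination (gbasis F) l (sols_uniq wts10 l1 l2); exists c.
Qed.

End Degrees.

(** * A basis of the invariants *)

Lemma map_block_iota l1 l2 : map (block l1) (iota 0 (l1 + l2)) = nseq l1 0%N ++ nseq l2 1%N.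
Proof.
have const (P : nat -> nat) x m n : (forall r, r \in iota m n -> P r = x) -> map P (iota m n) = nseq n x.
  move=> h; rewrite -[in RHS](size_iota m n) -(size_map P); apply/all_pred1P/allP => y /mapP[r hr ->].
  by rewrite /= h.
rewrite iotaD map_cat; congr (_ ++ _); apply: const => r; rewrite mem_iota /block => /andP[].
  by move=> _ ->.
by rewrite add0n => h _; rewrite ltnNge h.
Qed.

Lemma perm_letters (w : seq bool) : perm_eq (map nat_of_bool w) (nseq (count_mem false w) 0%N ++ nseq (count_mem true w) 1%N).
Proof.
apply/seq.permP => P; rewrite count_cat !count_nseq; elim: w => [|b w IH] /=; first by rewrite !muln0.
by rewrite IH; case: b => /=; rewrite ?add0n ?mulnDr ?muln1; lia.
Qed.

(** A word with l1 letters X and l2 letters Y becomes a permutation of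
    0, ..., k - 1 once its letters are numbered, those of each block among
    themselves. *)
Lemma multilinear_lift l1 l2 (w0 : seq bool) (ws : seq (seq bool)) :
  count_mem false (w0 ++ flatten ws) = l1 -> count_mem true (w0 ++ flatten ws) = l2 ->
  exists u0 us, [/\ perm_eq (u0 ++ flatten us) (iota 0 (l1 + l2)),
    map (block l1) u0 = map nat_of_bool w0 & map (map (block l1)) us = map (map nat_of_bool) ws].
Proof.
move=> c0 c1; have := perm_letters (w0 ++ flatten ws); rewrite c0 c1 -map_block_iota => /(perm_iotaP 0%N)[Is hIs eIs].
have {}eIs : map (block l1) Is = map nat_of_bool (w0 ++ flatten ws).
  rewrite eIs; apply/eq_in_map => r; rewrite (perm_mem hIs) mem_iota size_map size_iota => /andP[_ hr].
  by rewrite (nth_map 0%N) ?size_iota // nth_iota.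
rewrite size_map size_iota in hIs.
have sIs : size Is = (size w0 + sumn (shape ws))%N.
  by rewrite -(size_map (block l1)) eIs size_map size_cat size_flatten.
exists (take (size w0) Is), (reshape (shape ws) (drop (size w0) Is)).
split.
- by rewrite reshapeKr ?cat_take_drop // size_drop sIs addKn.
- by rewrite map_take eIs map_cat take_size_cat // size_map.
rewrite map_reshape map_drop eIs map_cat drop_size_cat ?size_map //.
by rewrite -map_reshape flattenK.
Qed.

Section Lifts.
Variable F : fieldType.
Hypothesis charF0 : [pchar F] =i pred0.
Notation genpoly := (genpoly F).
Notation genmat := (genmat F).
Variables (k l1 l2 : nat).
Hypothesis l12 : (l1 + l2)%N = k.

Let U := @mixed_trace_multilin F k.
Let fixed := fixed_vector U (@perm_act F k) (block_group k l1).

Lemma multilinD M N : U M -> U N -> U (M + N).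
Proof.
move=> [hM dM] [hN dN]; split; first exact: gen_alg_add.
move=> i j; have e : (M + N) i j = M i j + N i j by exact: mxE.
by rewrite e; apply: multidegD; [exact: dM|exact: dN].
Qed.

Lemma multilinZ (c : F) M : U M -> U (c *: M).
Proof.
move=> [hM dM]; split.
  have -> : c *: M = (c *: (1 : genmat)) * M by rewrite -scalerAl mul1r.
  by apply: gen_alg_mul => //; exact: gen_alg_scal.
move=> i j; rewrite (genmatZE c M i j) => m /(fsubsetP (msuppZ_le c (M i j))) hm r.
exact: dM hm r.
Qed.

Lemma multilin0 : U 0.
Proof.
split; first by have := @gen_alg_scal F genmat (fun M => generic_alg M \/
    exists2 p, pure_trace_alg p & M = (p%:M : 'M[genpoly]_3)) 0; rewrite scale0r.
move=> i j; have -> : (0 : genmat) i j = 0 by exact: mxE.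
exact: multideg0.
Qed.

Lemma multilin_sum (J : Type) (r : seq J) (P : pred J) (f : J -> genmat) :
  (forall i, P i -> U (f i)) -> U (\sum_(i <- r | P i) f i).
Proof. by move=> hf; elim/big_ind: _ => //; [exact: multilin0|exact: multilinD]. Qed.

Lemma multilin_trace_mon u0 us : perm_eq (u0 ++ flatten us) (iota 0 k) -> U (trace_mon F u0 us).
Proof.
move=> h; split; first exact: trace_mon_mem.
move=> i j m hm r; rewrite [LHS](multideg_trace_mon hm).
by move/seq.permP: h => ->; rewrite count_uniq_mem ?iota_uniq // mem_iota.
Qed.

Lemma ren_sum f (J : Type) (r : seq J) (P : pred J) (g : J -> genmat) :
  ren f (\sum_(i <- r | P i) g i) = \sum_(i <- r | P i) ren f (g i).
Proof.
apply: (big_morph (ren f)); first exact: renD.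
by have := renZ f 0 (0 : genmat); rewrite !scale0r.
Qed.

Lemma perm_actE (h : 'S_k) (M : genmat) : perm_act h M = ren (perm_index h) M.
Proof. by []. Qed.

Lemma perm_indexM (g h : 'S_k) r : perm_index (h * g)%g r = perm_index g (perm_index h r).
Proof.
rewrite /perm_index; case: insubP => [i _ _|hr]; first by rewrite valK permM.
by rewrite insubN.
Qed.

Lemma perm_actM (g h : 'S_k) (M : genmat) : perm_act g (perm_act h M) = perm_act (h * g)%g M.
Proof.
rewrite !perm_actE ren_comp; apply: eq_ren => r /=; by rewrite perm_indexM.
Qed.

Lemma block_perm_index (h : 'S_k) r : h \in block_group k l1 -> block l1 (perm_index h r) = block l1 r.
Proof.
move=> /block_stabP hh; rewrite /perm_index; case: insubP => // i _ <-.
by rewrite /block hh.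
Qed.

Lemma perm_index_iota (h : 'S_k) : perm_eq (map (perm_index h) (iota 0 k)) (iota 0 k).
Proof.
rewrite -val_enum_ord -map_comp.
have -> : [seq (perm_index h \o val) i | i <- enum 'I_k] = map val (map h (enum 'I_k)).
  by rewrite -[RHS]map_comp; apply: eq_map => i; rewrite /= perm_index_ord.
apply: perm_map; apply: uniq_perm; [rewrite map_inj_uniq ?enum_uniq //; exact: perm_inj|exact: enum_uniq|].
by move=> r; rewrite mem_enum; apply/mapP; exists ((h^-1)%g r); rewrite ?mem_enum ?permKV.
Qed.

(** The sum of the images under H of a multilinear lift. All these images have
    the same restitution, because H preserves the blocks. *)
Lemma invariant_lift s : s \in sols wts10 l1 l2 ->
  exists M, fixed M /\
    ren (block l1) M = #|block_group k l1|%:R *: gbasis F s.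
Proof.
move=> /mem_sols10[hs hw]; have := count_letters hs; rewrite hw => -[c0 c1].
have [u0 [us [hu e0 es]]] := multilinear_lift c0 c1.
rewrite l12 in hu.
pose M0 := trace_mon F u0 us.
exists (\sum_(h in block_group k l1) perm_act h M0); split; [split|].
- apply: multilin_sum => h _; rewrite perm_actE ren_trace_mon; apply: multilin_trace_mon.
  rewrite -map_flatten -map_cat; apply: perm_trans (perm_index_iota h).
  exact: perm_map.
- move=> g hg; rewrite perm_actE ren_sum [RHS](reindex_inj (mulIg g)).
  apply: eq_big => h; first by rewrite groupMr.
  by move=> _; rewrite -perm_actE perm_actM.
rewrite ren_sum (eq_bigr (fun=> gbasis F s)); first by rewrite sumr_const scaler_nat.
move=> h hh; rewrite perm_actE ren_comp.
rewrite (eq_ren (g := block l1)); last by move=> r /=; rewrite block_perm_index.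
by rewrite /M0 ren_trace_mon e0 es tmonE.
Qed.

Lemma fixed_restitution_inj M : U M -> (forall h, h \in block_group k l1 -> perm_act h M = M) ->
  ren (block l1) M = 0 -> M = 0.
Proof.
move=> [_ hd] hf h0; apply/matrixP => i j; have -> : (0 : genmat) i j = 0 by exact: mxE.
apply: (restitution_inj charF0 (k := k) (l1 := l1)).
- by move=> m hm r; exact: hd hm r.
- move=> h hh; apply: (etrans (esym (renE (perm_index h) M i j))).
  exact: (congr1 (fun A : genmat => A i j) (hf h hh)).
apply: (etrans (esym (renE (block l1) M i j))).
by rewrite h0; exact: mxE.
Qed.

(** Restitution is injective on the invariants and sends the lifts to multiples of
    a basis of the part of bidegree (l1, l2). *)
Lemma invariant_basis : exists b : 'I_(size (sols wts10 l1 l2)) -> genmat,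
  is_basis fixed b.
Proof.
set S := sols wts10 l1 l2; set nH := #|block_group k l1|%:R : F.
have nH0 : nH != 0 by have /pcharf0P -> := charF0; rewrite -lt0n cardG_gt0.
have /fin_all_exists[b hb] : forall i : 'I_(size S), exists M,
    fixed M /\
    ren (block l1) M = nH *: gbasis F (nth [::] S i).
  by move=> i; apply: invariant_lift; rewrite mem_nth.
have sumE (c : seq nat -> F) : \sum_(s <- S) c s *: gbasis F s = \sum_(i < size S) c (nth [::] S i) *: gbasis F (nth [::] S i).
  by rewrite (big_nth [::]) big_mkord.
have renb (c : 'I_(size S) -> F) :
    ren (block l1) (\sum_i c i *: b i) = \sum_i (c i * nH) *: gbasis F (nth [::] S i).
  rewrite ren_sum; apply: eq_bigr => i _; rewrite renZ; have [_ ->] := hb i.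
  by rewrite scalerA.
have fixc (c : 'I_(size S) -> F) : fixed (\sum_i c i *: b i).
  split; first by apply: multilin_sum => i _; apply: multilinZ; have [[]] := hb i.
  move=> h hh; rewrite perm_actE ren_sum; apply: eq_bigr => i _.
  by rewrite renZ; have [[_ e] _] := hb i; rewrite -perm_actE e.
exists b; split => [v|c hc i].
  split; last by move=> [c ->].
  move=> [vU vf]; have [c hc] := restitution_span charF0 l12 vU.
  pose c' (i : 'I_(size S)) := c (nth [::] S i) / nH; exists c'.
  apply/eqP; rewrite -subr_eq0; apply/eqP; have [cU cf] := fixc c'.
  have e : v - \sum_i c' i *: b i = v + (- 1) *: \sum_i c' i *: b i by rewrite scaleN1r.
  rewrite e; apply: fixed_restitution_inj.
  - by apply: multilinD => //; exact: multilinZ.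
  - move=> h hh; have -> : perm_act h (v + (- 1) *: \sum_i c' i *: b i) = perm_act h v + (- 1) *: perm_act h (\sum_i c' i *: b i).
      apply: (etrans (renD (perm_index h) v _)); congr (_ + _).
      exact: (renZ (perm_index h)).
    exact: (f_equal2 (fun A B : genmat => A + (- 1) *: B) (vf h hh) (cf h hh)).
  rewrite renD renZ renb hc sumE scaleN1r; apply/eqP; rewrite subr_eq0; apply/eqP.
  by apply: eq_bigr => i _; rewrite /c' divfK.
have := congr1 (ren (block l1)) hc; rewrite renb.
have -> : ren (block l1) (0 : genmat) = 0 by have := renZ (block l1) 0 (0 : genmat); rewrite !scale0r.
pose d (s : seq nat) : F := if insub (index s S) is Some j then c j * nH else 0.
have dE (j : 'I_(size S)) : d (nth [::] S j) = c j * nH.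
  by rewrite /d index_uniq ?sols_uniq // valK.
move=> h0; have h1 : \sum_(s <- S) d s *: gbasis F s = 0.
  by rewrite sumE -[RHS]h0; apply: eq_bigr => j _; rewrite dE.
have := basis_independent charF0 h1 (mem_nth [::] (ltn_ord i)); rewrite dE => /eqP.
by rewrite mulf_eq0 (negbTE nH0) orbF => /eqP.
Qed.

End Lifts.

(** * The asymptotic formulas *)

Lemma multiplicity_hilb (F : fieldType) (charF0 : [pchar F] =i pred0)
    (m : seq nat -> nat) (hm : mixed_trace_multiplicities F m) l1 l2 :
  (l2 <= l1)%N -> (m (two_row l1 l2))%:R = mult2 l1 l2.
Proof.
move=> l21; have [chiT [chi [hT hchi hdec]]] := hm (l1 + l2)%N.
have hdd a b : (a + b)%N = (l1 + l2)%N ->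
    \sum_(h in block_group (l1 + l2) a) chiT h = #|block_group (l1 + l2) a|%:R * (size (sols wts10 a b))%:R.
  move=> ab; have [bs hbs] := @invariant_basis F charF0 (l1 + l2) a b ab.
  apply: (@sum_char_invariants F (genmat F) _ (@mixed_trace_multilin F (l1 + l2)) (@perm_act F (l1 + l2))
    chiT (block_group (l1 + l2) a) _ _ charF0 _ bs hT hbs).
  - move=> g; exact: ren_linear.
  - by move=> g h v; exact: perm_actM.
have := multiplicity_difference charF0 hchi hdec hdd erefl l21.
rewrite /mult2 /hilb => ->; rewrite natrD.
by case: l2 {l21 chiT chi hT hchi hdec hdd} => [|l2]; rewrite ?subr0 ?add0r // addrAC subrr add0r.
Qed.

Theorem corollary5 (F : fieldType) (charF0 : [pchar F] =i pred0)
    (m : seq nat -> nat) (hm : mixed_trace_multiplicities F m) :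
  [/\ (exists (K : rat) (N : nat), forall l1 l2 : nat,
         (l2 <= l1)%N -> (N <= l1 + l2)%N -> (2 * l2 < l1)%N ->
         let a : rat := l1%:R in let b : rat := l2%:R in
         `| (m (two_row l1 l2))%:R
            - (b ^+ 7 / (7`!%:R * 2 ^+ 5)
               + (a - b) * b ^+ 6 / (6`!%:R * 2 ^+ 4)
               + (a - b) ^+ 2 * b ^+ 5 / (5`!%:R * 2 ^+ 4)) |
         <= K * (a + b) ^+ 6),
      (exists (K : rat) (N : nat), forall l1 l2 : nat,
         (l2 <= l1)%N -> (N <= l1 + l2)%N -> (l1 <= 2 * l2)%N ->
         let a : rat := l1%:R in let b : rat := l2%:R in
         `| (m (two_row l1 l2))%:R
            - (b ^+ 7 / (7`!%:R * 2 ^+ 5)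
               + (a - b) * b ^+ 6 / (6`!%:R * 2 ^+ 4)
               + (a - b) ^+ 2 * b ^+ 5 / (5`!%:R * 2 ^+ 4)
               - (2 * b - a) ^+ 7 / (7`!%:R * 2 ^+ 5)) |
         <= K * (a + b) ^+ 6) &
      (forall l2 : nat, exists (K : rat) (N : nat), forall l1 : nat,
         (l2 <= l1)%N -> (N <= l1)%N -> (2 * l2 < l1)%N ->
         let a : rat := l1%:R in let b : rat := l2%:R in
         `| (m (two_row l1 l2))%:R
            - a ^+ 2 * ((b ^+ 5 / (5`!%:R * 2 ^+ 4)
                         + b ^+ 4 / (2 ^+ 5 * 3)
                         + 5 * b ^+ 3 / 2 ^+ 6
                         + 13 * b ^+ 2 / (4`!%:R * 2)
                         + 1633 * b / (5`!%:R * 2 ^+ 5)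
                         + 15 / 2 ^+ 6)
                        + (-1) ^+ l2 * (b / 2 ^+ 8 + 1 / 2 ^+ 6)) |
         <= K * a)].
Proof.
have mE := @multiplicity_hilb F charF0 m hm.
split.
- have [K [N h]] := mult2_far; exists K, N => l1 l2 h1 h2 h3; cbv zeta.
  rewrite (mE l1 l2 h1); exact: h.
- have [K [N h]] := mult2_near; exists K, N => l1 l2 h1 h2 h3; cbv zeta.
  rewrite (mE l1 l2 h1); exact: h.
move=> l2; have [K [N h]] := mult2_fixed l2; exists K, N => l1 h1 h2 h3; cbv zeta.
rewrite (mE l1 l2 h1); have := h l1 h1 h2 h3; rewrite moment0_wts6; exact.
Qed.
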